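(* Let $R$ be a non-primitive Dedekind prime ring and let $M$ be a right $R$-module. (1) If $M$ is singular, then the following conditions are equivalent: (a) $M$ is super Bassian; (b) each primary component of $M$ is Noetherian; (c) $M$ is Bassian. (2) $M$ is super Bassian if and only if $M$ is Bassian and there exists a finitely generated submodule $H$ of $M$ such that $M/H$ is singular and Bassian.
   Context: Rings are associative with identity and modules are unital right modules. A module $M$ is Bassian if, for every submodule $N$ of $M$, the existence of a monomorphism $M\to M/N$ forces $N=0$. A module $M$ is super Bassian if every epimorphic image (equivalently every quotient module) of $M$ is Bassian. $\mathrm{Sing}(M)$ denotes the singular submodule of $M$, i.e. the set of $m\in M$ whose right annihilator in $R$ is an essential right ideal; $M$ is singular if $\mathrm{Sing}(M)=M$. An HNP ring is a hereditary Noetherian prime ring (on both sides). A ring is non-primitive if it has no faithful simple right module and no faithful simple left module. A Dedekind prime ring is an HNP ring, with classical ring of fractions $Q$, in which every non-zero two-sided ideal is invertible in $Q$ (an ideal $I$ is invertible if $IJ=JI=R$ for some $R$-sub-bimodule $J$ of $Q$). A maximal invertible ideal is an ideal maximal among the proper invertible ideals of $R$. For a maximal invertible ideal $P$, the $P$-primary component of a module $X$ is $X(P)=\{x\in X : xP^n=0 \text{ for some } n\ge 1\}$; the primary components of $X$ are the submodules $X(P)$ with $P$ ranging over all maximal invertible ideals of $R$. *)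

(* Defs.v *)
From HB Require Import structures.
From mathcomp Require Import all_boot all_algebra.
From mathcomp Require Import boolp classical_sets.
Set Implicit Arguments.
Unset Strict Implicit.
Unset Printing Implicit Defensive.
Import GRing.Theory.
Local Open Scope classical_set_scope.
Local Open Scope ring_scope.

(* An [lmodType S] is a left S-module. Right R-modules are taken to be left
   modules over the opposite ring, i.e. elements of [lmodType R^c]; the right
   action x r is then [(r : R^c) *: x]. Accordingly, left ideals of S are the
   [submodClosed S^o] and right ideals of R the [submodClosed R^c^o].
   Membership in a [submodClosed] is boolean; since [boolp] provides excluded
   middle in Type, these are all the submodules. *)

Section Submodule.
Variables (S : nzRingType) (M : lmodType S) (N : submodClosed M).

Record submod : Type := Submod { submod_val : M; _ : submod_val \in N }.

HB.instance Definition _ := [isSub for submod_val].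
HB.instance Definition _ := [Choice of submod by <:].
HB.instance Definition _ := [SubChoice_isSubLmodule of submod by <:].
End Submodule.

Section QuotientModule.
Variables (S : nzRingType) (M : lmodType S) (N : submodClosed M).
Local Open Scope quotient_scope.
Local Notation "{ 'quot' I }" := (@Quotient.quot _ I) : type_scope.

Lemma submod_oppr : oppr_closed N.
Proof. by move=> x Nx; rewrite -scaleN1r rpredZ. Qed.

Definition submod_zmod : zmodClosed M :=
  HB.pack (GRing.SubmodClosed.sort N) (GRing.isOppClosed.Build M N submod_oppr).

Definition quotmod : Type := {quot submod_zmod}.

HB.instance Definition _ := GRing.Zmodule.on quotmod.
HB.instance Definition _ := EqQuotient.on quotmod.

Definition quotmod_scale (a : S) (x : quotmod) : quotmod :=
  \pi_{quot submod_zmod} (a *: repr x).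

Lemma pi_quotmodZ (a : S) (x : M) :
  \pi_{quot submod_zmod} (a *: x)
  = quotmod_scale a (\pi_{quot submod_zmod} x).
Proof.
apply/eqP; rewrite /quotmod_scale -(Quotient.idealrBE submod_zmod) -scalerBr.
apply: (@rpredZ _ _ N).
change (x - repr (\pi_{quot submod_zmod} x) \in submod_zmod).
by rewrite Quotient.idealrBE reprK.
Qed.

Lemma quotmod_surj (x : quotmod) : exists y : M, x = \pi_{quot submod_zmod} y.
Proof. by exists (repr x); rewrite reprK. Qed.

Lemma quotmod_scalerA a b x :
  quotmod_scale a (quotmod_scale b x) = quotmod_scale (a * b) x.
Proof. by have [y ->] := quotmod_surj x; rewrite -!pi_quotmodZ scalerA. Qed.

Lemma quotmod_scale1r : left_id 1 quotmod_scale.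
Proof.
by move=> x; have [y ->] := quotmod_surj x; rewrite -pi_quotmodZ scale1r.
Qed.

Lemma quotmod_scalerDr : right_distributive quotmod_scale +%R.
Proof.
move=> a x y; have [u ->] := quotmod_surj x; have [v ->] := quotmod_surj y.
rewrite -!pi_quotmodZ; transitivity (\pi_{quot submod_zmod} (a *: u + a *: v)).
  by rewrite -scalerDr pi_quotmodZ; congr quotmod_scale; rewrite raddfD.
by rewrite raddfD.
Qed.

Lemma quotmod_scalerDl x : {morph quotmod_scale^~ x : a b / a + b}.
Proof.
move=> a b; have [u ->] := quotmod_surj x.
by rewrite -!pi_quotmodZ scalerDl raddfD.
Qed.

HB.instance Definition _ := GRing.Zmodule_isLmodule.Build S quotmod
  quotmod_scalerA quotmod_scale1r quotmod_scalerDr quotmod_scalerDl.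

Definition quotmod_pi (x : M) : quotmod := \pi_{quot submod_zmod} x.

Lemma quotmod_pi_linear : linear quotmod_pi.
Proof.
move=> a u v; rewrite /quotmod_pi raddfD; congr (_ + _).
exact: pi_quotmodZ.
Qed.

HB.instance Definition _ :=
  GRing.isLinear.Build S M quotmod *:%R quotmod_pi quotmod_pi_linear.

Lemma quotmod_pi_surj (y : quotmod) : exists x, quotmod_pi x = y.
Proof. by have [x ->] := quotmod_surj y; exists x. Qed.

Lemma quotmod_pi_eq0 x : quotmod_pi x = 0 <-> x \in N.
Proof.
have -> : (x \in N) = (x - 0 \in submod_zmod) by rewrite subr0.
rewrite Quotient.idealrBE; split=> [h|/eqP h].
  by apply/eqP; rewrite -/(quotmod_pi x) h raddf0.
by rewrite /quotmod_pi h raddf0.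
Qed.
End QuotientModule.

Section ModuleNotions.
Variable S : nzRingType.

Definition zero_sub (M : lmodType S) (N : submodClosed M) : Prop :=
  forall x, x \in N -> x = 0.

Definition whole_sub (M : lmodType S) (N : submodClosed M) : Prop :=
  forall x, x \in N.

Definition bassian (M : lmodType S) : Prop :=
  forall N : submodClosed M,
    (exists f : {linear M -> quotmod N}, injective f) -> zero_sub N.

Definition super_bassian (M : lmodType S) : Prop :=
  forall N : submodClosed M, bassian (quotmod N).

Definition noetherian (M : lmodType S) : Prop :=
  forall N : nat -> submodClosed M,
    (forall n x, x \in N n -> x \in N n.+1) ->
    exists m, forall n, (m <= n)%N -> N n =i N m.

Definition fin_gen (M : lmodType S) : Prop :=
  exists (n : nat) (g : 'I_n -> M),
    forall x, exists c : 'I_n -> S, x = \sum_i c i *: g i.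

Definition essential (M : lmodType S) (N : submodClosed M) : Prop :=
  forall K : submodClosed M,
    ~ zero_sub K -> exists x, [/\ x \in K, x \in N & x != 0].

Section Annihilator.
Variables (M : lmodType S) (x : M).

Definition annih : {pred S^o} := [pred a : S^o | (a : S) *: x == 0].

Lemma annih_closed : submod_closed annih.
Proof.
split=> [|a b c]; first by rewrite inE scale0r.
rewrite !inE => /eqP bx /eqP cx.
by rewrite scalerDl -scalerA bx cx scaler0 addr0.
Qed.

HB.instance Definition _ :=
  GRing.isSubmodClosed.Build S S^o annih annih_closed.

Definition annihilator : submodClosed S^o := annih.
End Annihilator.

Definition Sing (M : lmodType S) : set M :=
  [set x | essential (annihilator x)].
Arguments Sing : clear implicits.

Definition singular (M : lmodType S) : Prop := Sing M = setT.

Definition projective (P : lmodType S) : Prop :=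
  forall (A B : lmodType S) (p : {linear A -> B}) (f : {linear P -> B}),
    range p = setT -> exists g : {linear P -> A}, forall x, p (g x) = f x.

Definition simple (M : lmodType S) : Prop :=
  (exists x : M, x != 0) /\
  (forall N : submodClosed M, zero_sub N \/ whole_sub N).

Definition faithful (M : lmodType S) : Prop :=
  forall a : S, (forall x : M, a *: x = 0) -> a = 0.

Definition left_noetherian : Prop := noetherian S^o.

Definition left_hereditary : Prop :=
  forall L : submodClosed S^o, projective (submod L).

Definition left_primitive : Prop :=
  exists M : lmodType S, simple M /\ faithful M.
End ModuleNotions.

Section Rings.
Variable R : nzRingType.

Definition right_noetherian : Prop := left_noetherian R^c.
Definition right_hereditary : Prop := left_hereditary R^c.
Definition right_primitive : Prop := left_primitive R^c.

Definition non_primitive : Prop := ~ right_primitive /\ ~ left_primitive R.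

(* Two-sided ideals, not necessarily proper. *)
Record ideal : Type := Ideal {
  ideal_set :> set R;
  ideal0 : ideal_set 0;
  idealD : forall x y, ideal_set x -> ideal_set y -> ideal_set (x + y);
  idealMl : forall r x, ideal_set x -> ideal_set (r * x);
  idealMr : forall r x, ideal_set x -> ideal_set (x * r) }.

(* Finite sums of products, as in the product of ideals. *)
Definition sum_prods (A B : set R) : set R :=
  [set x | exists (n : nat) (a b : 'I_n -> R),
     [/\ forall i, A (a i), forall i, B (b i) & x = \sum_i a i * b i]].

Definition prime_ring : Prop :=
  forall I J : ideal, sum_prods I J `<=` [set 0] ->
    I `<=` [set 0] \/ J `<=` [set 0].

Definition HNP_ring : Prop :=
  [/\ right_hereditary, left_hereditary R, right_noetherian,
      left_noetherian R & prime_ring].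

Fixpoint ideal_pow (I : ideal) (n : nat) : set R :=
  if n is k.+1 then sum_prods I (ideal_pow I k) else setT.

End Rings.

Section Fractions.
Variables (R : nzRingType) (Q : unitRingType) (iota : {rmorphism R -> Q}).

(* [iota] identifies R with a subring of its two-sided classical ring of
   fractions Q. *)
Definition classical_fractions : Prop :=
  [/\ injective iota,
      forall c : R, GRing.lreg c -> GRing.rreg c -> iota c \is a GRing.unit,
      forall q : Q, exists a c : R,
        [/\ GRing.lreg c, GRing.rreg c & q = iota a * (iota c)^-1]
    & forall q : Q, exists a c : R,
        [/\ GRing.lreg c, GRing.rreg c & q = (iota c)^-1 * iota a]].

Definition sub_bimodule (J : set Q) : Prop :=
  [/\ J 0, forall x y, J x -> J y -> J (x + y),
      forall r x, J x -> J (iota r * x) & forall r x, J x -> J (x * iota r)].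

Definition invertible (I : ideal R) : Prop :=
  exists J : set Q, [/\ sub_bimodule J,
    sum_prods (iota @` I) J = range iota & sum_prods J (iota @` I) = range iota].

Definition dedekind_prime : Prop :=
  HNP_ring R /\
  forall I : ideal R, (exists2 x, (I : set R) x & x != 0) -> invertible I.

Definition proper_invertible (I : ideal R) : Prop :=
  invertible I /\ (I : set R) <> setT.

Definition maximal_invertible (P : ideal R) : Prop :=
  proper_invertible P /\
  forall I : ideal R, proper_invertible I -> P `<=` I -> I `<=` P.
End Fractions.

Section Primary.
Variables (R : nzRingType) (P : ideal R) (X : lmodType R^c).

Definition primary_pred : {pred X} :=
  [pred x | `[< exists2 n : nat, (1 <= n)%N &
     forall r : R, ideal_pow P n r -> (r : R^c) *: x = 0 >]].

Lemma ideal_powW m n : (m <= n)%N -> ideal_pow P n `<=` ideal_pow P m.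
Proof.
have powS k : ideal_pow P k.+1 `<=` ideal_pow P k.
  elim: k => [//|k IHk] x [l [a [b [Pa Pb ->]]]].
  by exists l, a, b; split=> // i; apply: IHk; apply: Pb.
by elim: n => [|n IHn]; rewrite ?leqn0 1?leq_eqVlt;
  [move/eqP-> | case/predU1P => [-> //|/IHn h] x /powS /h].
Qed.

Lemma ideal_powMl n (a r : R) : ideal_pow P n r -> ideal_pow P n (a * r).
Proof.
case: n => [//|n] [l [b [c [Pb Pc ->]]]].
exists l, (fun i => a * b i), c; split=> // [i|]; first exact: idealMl.
by rewrite mulr_sumr; apply: eq_bigr => i _; rewrite mulrA.
Qed.

Lemma primary_pred_closed : submod_closed primary_pred.
Proof.
split=> [|a x y]; first by apply/asboolP; exists 1%N => // r _; rewrite scaler0.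
move=> /asboolP[m m1 xm] /asboolP[n n1 yn]; apply/asboolP.
exists (maxn m n); first by rewrite leq_max m1.
move=> r Pr; rewrite scalerDr scalerA.
rewrite (xm ((a : R) * r)); last first.
  by apply: ideal_powMl; apply: ideal_powW Pr; rewrite leq_maxl.
by rewrite yn ?addr0//; apply: ideal_powW Pr; rewrite leq_maxr.
Qed.

HB.instance Definition _ := GRing.isSubmodClosed.Build R^c X primary_pred
  primary_pred_closed.

Definition primary_component : submodClosed X := primary_pred.
End Primary.
Arguments primary_component {R} P X.

(* Main.v *)
Require Import Defs.
From mathcomp Require Import all_boot all_algebra.
From HB Require Import structures.
From mathcomp Require Import boolp classical_sets.
Set Implicit Arguments.
Unset Strict Implicit.
Unset Printing Implicit Defensive.
Import GRing.Theory.
Local Open Scope classical_set_scope.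
Local Open Scope ring_scope.

(** The heart of the matter is that a P-primary Bassian module X is Noetherian,
    P being a maximal ideal of R. A module is Bassian iff every epimorphism
    onto it from one of its submodules is injective (bassianP), so when X is not
    Noetherian such an epimorphism with a nonzero kernel has to be constructed.
    The means is an extension principle (extend_hom): a partial homomorphism
    from X to D extends to X as soon as its extensions map XP into DP. This
    holds when D is divisible, D = DP, and when D is homogeneous, that is, when
    its socle is DP^n for n + 1 the exponent of D. The proof uses only the
    invertibility of P and the semisimplicity of R/P. If two homomorphisms th
    and j from X to D are such that th maps a submodule B of X onto D and j
    embeds B into D, then X being Bassian forces th to be injective on B
    (bassian_two_maps).

    Filter the socle of X by the heights XP^n. If the filtration is not
    stationary, there is a sum U of independent simple modules of increasing
    heights, lying in a submodule B with socle U; gluing infinitely many of the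
    simple modules together, infinitely often, yields a divisible quotient of B
    whose socle is still a copy of U and in which B embeds (bassian_heights).
    If it is stationary from m on, XP^m is divisible, and a nonzero divisible
    module has noninjective surjective endomorphisms (bassian_reduced), so that
    XP^m = 0. If finally a layer of the filtration is not Noetherian, infinitely
    many simple modules of the same height form the socle of a homogeneous
    submodule, on which the shift is surjective and not injective
    (bassian_homogeneous). Otherwise the socle is Noetherian, and so is X.

    The link with singular modules is that R is bounded (ess_contains_ideal):
    essential right ideals contain nonzero ideals. Over a hereditary Noetherian
    prime ring R/E has a simple submodule for every proper essential E, by
    passing to duals (minimal_over), and simple modules are not faithful. The
    same argument applied to E = P makes R/P simple Artinian. Consequently a
    singular element is the sum of a P-primary element and of one that is
    killed by an ideal not contained in P (primary_decomposition), and the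
    Bassian property passes from a singular module to its primary components.

    Conversely, let H be a Noetherian submodule of M such that M/H is singular
    with Noetherian primary components. Then M is super Bassian: the condition
    passes to quotients, and given an epimorphism g from a submodule of M onto
    M, the chain of the kernels of the powers of g is stationary on H, hence the
    kernel of g is singular, and g is injective on each primary component
    because that is Noetherian (super_bassian_of_components). With H = 0 this
    is the first part, and with H finitely generated one half of the second.

    For the other half, if no M/H with H finitely generated is singular, then M
    contains an infinite direct sum F of modules isomorphic to nonzero principal
    right ideals. Choosing G maximal with G meeting F in FP gives a singular
    quotient M/G with F/FP in its P-primary component; this is not Noetherian,
    so M/G is not Bassian and M is not super Bassian (super_bassian_fin_gen). *)

(** * Submodules as sets *)

Section SubmoduleSets.
Variable S : nzRingType.
Implicit Types M N : lmodType S.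

Definition subm M (A : set M) : Prop :=
  [/\ A 0, forall x y, A x -> A y -> A (x + y) & forall a x, A x -> A (a *: x)].

Lemma subm0 M (A : set M) : subm A -> A 0. Proof. by case. Qed.
Lemma submD M (A : set M) x y : subm A -> A x -> A y -> A (x + y).
Proof. by case=> _ h _; apply: h. Qed.
Lemma submZ M (A : set M) a x : subm A -> A x -> A (a *: x).
Proof. by case=> _ _ h; apply: h. Qed.
Lemma submN M (A : set M) x : subm A -> A x -> A (- x).
Proof. by move=> sA Ax; rewrite -scaleN1r; apply: submZ. Qed.
Lemma submB M (A : set M) x y : subm A -> A x -> A y -> A (x - y).
Proof. by move=> sA Ax Ay; apply: submD => //; apply: submN. Qed.
Lemma subm_sum M (A : set M) (I : Type) (r : seq I) (F : I -> M) :
  subm A -> (forall i, A (F i)) -> A (\sum_(i <- r) F i).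
Proof.
move=> sA AF; elim: r => [|i r IH]; first by rewrite big_nil; apply: subm0.
by rewrite big_cons; apply: submD.
Qed.
Lemma submDr M (A : set M) x y : subm A -> A x -> A (x + y) -> A y.
Proof. by move=> sA Ax Axy; rewrite -(addKr x y) addrC; apply: submB. Qed.

Definition subadd M (A B : set M) : set M :=
  [set x | exists a b, [/\ A a, B b & x = a + b]].

Lemma subm_add M (A B : set M) : subm A -> subm B -> subm (subadd A B).
Proof.
move=> sA sB; split.
- by exists 0, 0; split; rewrite ?addr0//; apply: subm0.
- move=> _ _ [a [b [Aa Bb ->]]] [c [d [Ac Bd ->]]]; exists (a + c), (b + d).
  by split; [exact: submD|exact: submD|rewrite addrACA].
- move=> r _ [a [b [Aa Bb ->]]]; exists (r *: a), (r *: b).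
  by split; [exact: submZ|exact: submZ|rewrite scalerDr].
Qed.

Lemma subadd_l M (A B : set M) : subm B -> A `<=` subadd A B.
Proof.
by move=> sB x Ax; exists x, 0; split; rewrite ?addr0//; apply: subm0.
Qed.
Lemma subadd_r M (A B : set M) : subm A -> B `<=` subadd A B.
Proof.
by move=> sA x Bx; exists 0, x; split; rewrite ?add0r//; apply: subm0.
Qed.
Lemma subadd_min M (A B C : set M) :
  subm C -> A `<=` C -> B `<=` C -> subadd A B `<=` C.
Proof.
by move=> sC AC BC _ [a [b [/AC Ca /BC Cb ->]]]; apply: submD.
Qed.

Lemma subm_setI M (A B : set M) : subm A -> subm B -> subm (A `&` B).
Proof.
move=> sA sB; split; first by split; apply: subm0.
  by move=> x y [Ax Bx] [Ay By]; split; apply: submD.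
by move=> a x [Ax Bx]; split; apply: submZ.
Qed.

Lemma subm_setT M : subm (setT : set M). Proof. by []. Qed.
Lemma subm_set0 M : subm ([set 0] : set M).
Proof.
split=> //= [x y -> ->|a x ->]; by rewrite ?addr0 ?scaler0.
Qed.
Hint Resolve subm_setT subm_set0 : core.

Lemma subm_image M N (f : {linear M -> N}) (A : set M) :
  subm A -> subm (f @` A).
Proof.
move=> sA; split.
- by exists 0; [apply: subm0|rewrite linear0].
- move=> _ _ [x Ax <-] [y Ay <-]; exists (x + y); last by rewrite linearD.
  exact: submD.
- by move=> a _ [x Ax <-]; exists (a *: x); [apply: submZ|rewrite linearZ].
Qed.

Lemma subm_preimage M N (f : {linear M -> N}) (A : set N) :
  subm A -> subm (f @^-1` A).
Proof.
move=> sA; split; rewrite /preimage /=.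
- by rewrite linear0; apply: subm0.
- by move=> x y; rewrite linearD; apply: submD.
- by move=> a x; rewrite linearZ; apply: submZ.
Qed.

Section OfSet.
Variables (M : lmodType S) (A : set M) (sA : subm A).

Definition pred_of_set : {pred M} := [pred x | `[< A x >]].

Lemma pred_of_set_closed : submod_closed pred_of_set.
Proof.
split=> [|a x y]; first by apply/asboolP; apply: subm0.
move=> /asboolP Ax /asboolP Ay; apply/asboolP.
by apply: submD => //; apply: submZ.
Qed.

Definition closed_of_set : submodClosed M :=
  HB.pack pred_of_set
    (GRing.isSubmodClosed.Build S M pred_of_set pred_of_set_closed).

Lemma closed_of_setP x : x \in closed_of_set <-> A x.
Proof. by split=> [/asboolP|h]; last apply/asboolP. Qed.
End OfSet.

Lemma subm_closed M (N : submodClosed M) : subm [set x | x \in N].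
Proof.
split=> /= [|x y|a x]; [exact: rpred0|exact: rpredD|exact: rpredZ].
Qed.

(** Zorn's lemma. An arbitrary set C as upper bound covers all the uses: staying
    inside a submodule, meeting a submodule in a prescribed part, and, for a
    linear relation, being single-valued are all containments. *)
Lemma max_subm M (A C : set M) : subm A -> A `<=` C ->
  exists Z, [/\ subm Z, A `<=` Z, Z `<=` C &
    forall Z', subm Z' -> Z `<=` Z' -> Z' `<=` C -> Z' `<=` Z].
Proof.
move=> sA AC.
pose P (Z : set M) := subm (A `|` Z) /\ A `|` Z `<=` C.
have [F FP Ftot|Z [[sZ ZC] Zmax]] := Zorn_bigcup (P := P).
  have [[X0 FX0]|F0] := pselect (exists X, F X); last first.
    rewrite (_ : \bigcup_(X in F) X = set0) /P ?setU0 //.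
    by rewrite -subset0 => x [X FX]; case: F0; exists X.
  have ub x y : (A `|` \bigcup_(X in F) X) x -> (A `|` \bigcup_(X in F) X) y ->
      exists X, [/\ F X, (A `|` X) x & (A `|` X) y].
    have one z : (A `|` \bigcup_(X in F) X) z -> exists2 X, F X & (A `|` X) z.
      by move=> [Az|[X FX Xz]]; [exists X0 => //; left|exists X => //; right].
    move=> /one[X FX Xx] /one[Y FY Yy].
    have [XY|YX] := Ftot _ _ FX FY.
      exists Y; split=> //; case: Xx; [by left|by move/XY; right].
    exists X; split=> //; case: Yy; [by left|by move/YX; right].
  split; last first.
    move=> x hx; have [X [FX Xx _]] := ub x x hx hx.
    by have [_] := FP _ FX; apply.
  have sub X : F X -> A `|` X `<=` A `|` \bigcup_(X in F) X.
    by move=> FX x [Ax|Xx]; [left|right; exists X].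
  split; first by left; apply: subm0.
    move=> x y hx hy; have [X [FX Xx Xy]] := ub x y hx hy.
    by apply: (sub _ FX); have [sX _] := FP _ FX; apply: submD.
  move=> a x hx; have [X [FX Xx _]] := ub x x hx hx.
  by apply: (sub _ FX); have [sX _] := FP _ FX; apply: submZ.
exists (A `|` Z); split => //.
move=> Z' sZ' ZZ' Z'C.
have AZ' : A `<=` Z' by move=> x Ax; apply: ZZ'; left.
have E : A `|` Z' = Z' by apply/setUidPr.
apply: contrapT => nZ'; apply: (Zmax Z'); last by rewrite /P E.
split; first by move=> x Zx; apply: ZZ'; right.
by move=> Z'Z; apply: nZ' => x /Z'Z; right.
Qed.

End SubmoduleSets.
#[global] Hint Resolve subm_setT subm_set0 : core.

(** * Noetherian submodules *)

Section NoetherianSets.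
Variable S : nzRingType.
Implicit Types M N : lmodType S.

(** A relative notion: all the modules whose chains have to be controlled are
    submodules of a given one. *)
Definition noeth M (A : set M) : Prop :=
  forall N : nat -> set M, (forall n, subm (N n)) ->
    (forall n, N n `<=` N n.+1) -> (forall n, N n `<=` A) ->
    exists m, forall n, (m <= n)%N -> N n `<=` N m.

Lemma chain_le M (N : nat -> set M) : (forall n, N n `<=` N n.+1) ->
  forall m n, (m <= n)%N -> N m `<=` N n.
Proof.
move=> inc m n; elim: n => [|n IH]; first by rewrite leqn0 => /eqP ->.
by rewrite leq_eqVlt => /predU1P[-> //|/IH h] x /h; apply: inc.
Qed.

Lemma noethS M (A B : set M) : A `<=` B -> noeth B -> noeth A.
Proof.
by move=> AB nB N sN iN NA; apply: nB => // n x /NA /AB.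
Qed.

Lemma noetherian_setT M : noetherian M <-> noeth (setT : set M).
Proof.
split=> [nM N sN iN _|nM N iN].
  have [n x|m hm] := nM (fun n => closed_of_set (sN n)).
    by rewrite !closed_of_setP; apply: iN.
  exists m => n mn x Nx.
  have := hm n mn x.
  by move=> e; apply/(closed_of_setP (sN m)); rewrite -e; apply/closed_of_setP.
have [|||m hm] := nM (fun n => [set x | x \in N n]) => //.
  by move=> n; apply: subm_closed.
exists m => n mn x; apply/idP/idP; first exact: hm.
by apply: (@chain_le _ (fun n => [set x | x \in N n])).
Qed.

Lemma noeth_image M N (f : {linear M -> N}) (A : set M) :
  noeth A -> subm A -> noeth (f @` A).
Proof.
move=> nA sA K sK iK KA.
have [n|n x [Ax]|n x []//|m hm] := nA (fun n => A `&` f @^-1` (K n)).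
- by apply: subm_setI => //; apply: subm_preimage.
- by move=> Kx; split=> //; apply: iK.
exists m => n mn y Ky; have [x Ax xy] := KA _ _ Ky.
by have [|_] := hm n mn x; rewrite /preimage /= xy.
Qed.

Lemma noeth_preimage M N (f : {linear M -> N}) (B : set N) : injective f ->
  noeth B -> noeth (f @^-1` B).
Proof.
move=> fI nB K sK iK KB.
have [n|n _ [x Kx <-]|n _ [x Kx <-]|m hm] := nB (fun n => f @` K n).
- exact: subm_image.
- by exists x => //; apply: iK.
- exact: KB Kx.
by exists m => n mn x Kx; have [|z Kz /fI <-] := hm n mn (f x); first exists x.
Qed.

Lemma noeth_ext M N (f : {linear M -> N}) (A : set M) : subm A ->
  noeth (A `&` [set x | f x = 0]) -> noeth (f @` A) -> noeth A.
Proof.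
move=> sA n1 n2 K sK iK KA.
have [n|n x [Kx fx]|n x [Kx fx]|m1 hm1] :=
  n1 (fun n => K n `&` [set x | f x = 0]).
- by apply: subm_setI => //; apply: (subm_preimage f (@subm_set0 _ _)).
- by split=> //; apply: iK.
- by split=> //; apply: KA Kx.
have [n|n _ [x Kx <-]|n _ [x Kx <-]|m2 hm2] := n2 (fun n => f @` K n).
- exact: subm_image.
- by exists x => //; apply: iK.
- by exists x => //; apply: KA Kx.
exists (maxn m1 m2) => n; rewrite geq_max => /andP[n1n n2n] x Kx.
have [|y Ky yx] := hm2 n n2n (f x); first by exists x.
rewrite -(subrK y x); apply: submD => //; last first.
  by apply: chain_le Ky => //; rewrite leq_maxr.
have [|h _] := hm1 n n1n (x - y).
  split; last by rewrite /= linearB yx subrr.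
  by apply: submB => //; apply: chain_le Ky.
by apply: chain_le h => //; rewrite leq_maxl.
Qed.

(** A chain in A + B is controlled by its traces N & A and (N + A) & B. *)
Lemma noeth_add M (A B : set M) : subm A -> subm B ->
  noeth A -> noeth B -> noeth (subadd A B).
Proof.
move=> sA sB nA nB K sK iK KAB.
have [n|n x [Kx Ax]|n x []//|m1 hm1] := nA (fun n => K n `&` A).
- exact: subm_setI.
- by split=> //; apply: iK.
have [n|n x [h Bx]|n x []//|m2 hm2] := nB (fun n => subadd (K n) A `&` B).
- by apply: subm_setI => //; apply: subm_add.
- split=> //; move: h => [k [a [Kk Aa ->]]]; exists k, a; split=> //.
  exact: iK.
exists (maxn m1 m2) => n; rewrite geq_max => /andP[n1n n2n] x Kx.
have [a [b [Aa Bb xE]]] := KAB _ _ Kx.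
have [|[k [c [Kk Ac bE]]] _] := hm2 n n2n b.
  split=> //; exists x, (- a); split=> //; first exact: submN.
  by rewrite xE addrAC subrr add0r.
have Kac : K n (a + c).
  have -> : a + c = x - k.
    by rewrite xE bE addrA [x in x - _]addrAC addrK.
  by apply: submB => //; apply: chain_le Kk.
have [|h _] := hm1 n n1n (a + c); first by split=> //; apply: submD.
have -> : x = (a + c) + k by rewrite xE bE -addrA [c + k]addrC.
apply: submD => //.
  by apply: chain_le h => //; rewrite leq_maxl.
by apply: chain_le Kk => //; rewrite leq_maxr.
Qed.

(** By dependent choice, a family without maximal element would contain a
    strictly ascending chain. *)
Lemma noeth_max M (A : set M) (F : set M -> Prop) : noeth A ->
  (exists B, F B) -> (forall B, F B -> subm B /\ B `<=` A) ->
  exists2 B, F B & forall C, F C -> B `<=` C -> C `<=` B.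
Proof.
move=> nA [B0 FB0] FA; apply: contrapT => nmax.
have next (B : {B | F B}) : {C : {B | F B} |
    sval B `<=` sval C & ~ (sval C `<=` sval B)}.
  apply: cid2; apply: contrapT => nC; apply: nmax; exists (sval B).
    exact: svalP.
  move=> C FC BC; apply: contrapT => CB; apply: nC.
  by exists (exist _ C FC).
pose chain n := sval (iter n (fun B => s2val (next B)) (exist _ B0 FB0)).
have [n|n|n|m hm] := nA chain.
- by have [] := FA _ (svalP (iter n (fun B => s2val (next B)) (exist _ B0 FB0))).
- exact: (s2valP (next _)).
- by have [] := FA _ (svalP (iter n (fun B => s2val (next B)) (exist _ B0 FB0))).
by have := s2valP' (next (iter m (fun B => s2val (next B)) (exist _ B0 FB0)));
  apply; apply: (hm m.+1).
Qed.

Fixpoint gen M (g : nat -> M) (n : nat) : set M :=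
  if n is k.+1 then subadd (gen g k) [set x | exists a, x = a *: g k]
  else [set 0].

Lemma subm_cyc M (x : M) : subm [set y | exists a : S, y = a *: x].
Proof.
split; first by exists 0; rewrite scale0r.
  by move=> _ _ [a ->] [b ->]; exists (a + b); rewrite scalerDl.
by move=> a _ [b ->]; exists (a * b); rewrite scalerA.
Qed.

Lemma subm_gen M (g : nat -> M) n : subm (gen g n).
Proof.
elim: n => [|n IH]; first exact: subm_set0.
by apply: subm_add => //; apply: subm_cyc.
Qed.

Lemma genP M (g : nat -> M) n x :
  gen g n x <-> exists c : nat -> S, x = \sum_(i < n) c i *: g i.
Proof.
elim: n x => [|n IH] x.
  split=> [->|[c ->]]; last by rewrite big_ord0.
  by exists (fun=> 0); rewrite big_ord0.
split=> [[y [_ [/IH[c ->] [a ->] ->]]]|[c ->]].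
  exists (fun i => if i == n then a else c i); rewrite big_ord_recr /= eqxx.
  congr (_ + _); apply: eq_bigr => i _.
  by rewrite ltn_eqF.
rewrite big_ord_recr /=.
exists (\sum_(i < n) c i *: g i), (c n *: g n); split=> //; last by exists (c n).
by apply/IH; exists c.
Qed.

Lemma gen_mem M (g : nat -> M) n i : (i < n)%N -> gen g n (g i).
Proof.
elim: n => // n IH; rewrite ltnS leq_eqVlt => /predU1P[->|/IH h].
  apply: subadd_r; first exact: subm_gen.
  by exists 1; rewrite scale1r.
by apply: subadd_l => //; apply: subm_cyc.
Qed.

Lemma gen_sub M (g : nat -> M) n (A : set M) : subm A ->
  (forall i, (i < n)%N -> A (g i)) -> gen g n `<=` A.
Proof.
move=> sA; elim: n => [|n IH] gA; first by move=> x ->; apply: subm0.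
apply: subadd_min => //; first by apply: IH => i lt; apply: gA; rewrite ltnW.
by move=> _ [a ->]; apply: submZ => //; apply: gA.
Qed.

Lemma eq_gen M (g g' : nat -> M) n : (forall i, (i < n)%N -> g i = g' i) ->
  gen g n `<=` gen g' n.
Proof.
move=> e; apply: gen_sub; first exact: subm_gen.
by move=> i lt; rewrite e//; apply: gen_mem.
Qed.

Lemma noeth_gen M (g : nat -> M) n : noeth (setT : set S^o) -> noeth (gen g n).
Proof.
move=> nS; elim: n => [|n IH].
  move=> N sN iN NA; exists 0%N => k _ x /NA ->; exact: subm0.
apply: noeth_add => //; [exact: subm_gen|exact: subm_cyc|].
have f_lin : linear (fun a : S^o => (a : S) *: g n).
  by move=> a u v; rewrite scalerDl -scalerA.
pose fL := GRing.isLinear.Build _ _ _ _ _ f_lin.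
pose f : {linear S^o -> M} := HB.pack (fun a : S^o => (a : S) *: g n) fL.
apply: (@noethS _ _ (f @` setT)); last exact: noeth_image.
by move=> _ [a ->]; exists a.
Qed.

(** A maximal finitely generated submodule of A is A itself. *)
Lemma noeth_fin_gen M (A : set M) : noeth A -> subm A ->
  exists g n, (forall i, (i < n)%N -> A (g i)) /\ gen g n = A.
Proof.
move=> nA sA.
pose F B := exists g n, (forall i, (i < n)%N -> A (g i)) /\ gen g n = B.
have [||_ [g [n [gA <-]]] gmax] := @noeth_max _ A F nA.
- by exists [set 0], (fun=> 0), 0%N.
- by move=> _ [g [n [gA <-]]]; split; [exact: subm_gen|exact: gen_sub].
exists g, n; split=> //; apply/seteqP; split; first exact: gen_sub.
move=> x Ax.
pose g' i := if (i < n)%N then g i else x.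
have g'x : g' n = x by rewrite /g' ltnn.
apply: (gmax (gen g' n.+1)).
- exists g', n.+1; split=> // i _; rewrite /g'.
  by case: ifP => // /gA.
- apply: subset_trans (subadd_l _); last exact: subm_cyc.
  by apply: eq_gen => i lt; rewrite /g' lt.
- by rewrite -[x in _ x]g'x; apply: gen_mem.
Qed.

End NoetherianSets.

(** * Linear relations and the Bassian condition *)

Section LinearRelations.
Variable S : nzRingType.
Implicit Types M D : lmodType S.

Definition functional M D (G : set (M * D)%type) : Prop :=
  forall z, G (0, z) -> z = 0.

Lemma relB M D (G : set (M * D)%type) x y x' y' :
  subm G -> G (x, y) -> G (x', y') -> G (x - x', y - y').
Proof. by move=> sG h h'; apply: (submB sG h h'). Qed.
Lemma relD M D (G : set (M * D)%type) x y x' y' :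
  subm G -> G (x, y) -> G (x', y') -> G (x + x', y + y').
Proof. by move=> sG h h'; apply: (submD sG h h'). Qed.
Lemma relZ M D (G : set (M * D)%type) a x y :
  subm G -> G (x, y) -> G (a *: x, a *: y).
Proof. by move=> sG h; apply: (submZ a sG h). Qed.
Lemma rel0 M D (G : set (M * D)%type) : subm G -> G (0, 0).
Proof. by move=> sG; apply: (subm0 sG). Qed.

Lemma subm_fst M D (A : set M) : subm A -> subm [set u : (M * D)%type | A u.1].
Proof.
move=> sA; split=> [|u v /= Au Av|a u /= Au].
- exact: subm0 sA.
- exact: submD sA Au Av.
- exact: (submZ a sA Au).
Qed.
Lemma subm_snd M D (A : set D) : subm A -> subm [set u : (M * D)%type | A u.2].
Proof.
move=> sA; split=> [|u v /= Au Av|a u /= Au].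
- exact: subm0 sA.
- exact: submD sA Au Av.
- exact: (submZ a sA Au).
Qed.

Lemma functionalP M D (G : set (M * D)%type) x y y' :
  subm G -> functional G -> G (x, y) -> G (x, y') -> y = y'.
Proof.
move=> sG fG h h'; apply/eqP; rewrite -subr_eq0; apply/eqP/fG.
by rewrite -(subrr x); apply: relB.
Qed.

Lemma functional_linear M D (G : set (M * D)%type) :
  subm G -> functional G -> (forall x, exists y, G (x, y)) ->
  exists f : {linear M -> D}, forall x, G (x, f x).
Proof.
move=> sG fG tG; pose f x := sval (cid (tG x)).
have fP x : G (x, f x) by apply: (svalP (cid (tG x))).
have f_lin : linear f.
  move=> a u v; apply: functionalP (fP _) _ => //.
  by apply: relD => //; apply: relZ.
pose fl : {linear M -> D} := HB.pack f (GRing.isLinear.Build _ _ _ _ _ f_lin).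
by exists fl.
Qed.

Lemma quotmod_pi0 M (N : submodClosed M) : quotmod_pi N 0 = 0.
Proof. exact: linear0. Qed.
Lemma quotmod_piD M (N : submodClosed M) x y :
  quotmod_pi N (x + y) = quotmod_pi N x + quotmod_pi N y.
Proof. exact: linearD. Qed.
Lemma quotmod_piB M (N : submodClosed M) x y :
  quotmod_pi N (x - y) = quotmod_pi N x - quotmod_pi N y.
Proof. exact: linearB. Qed.
Lemma quotmod_piZ M (N : submodClosed M) a x :
  quotmod_pi N (a *: x) = a *: quotmod_pi N x.
Proof. exact: linearZ. Qed.

Lemma quotmod_pi_closedE M (A : set M) (sA : subm A) x :
  quotmod_pi (closed_of_set sA) x = 0 <-> A x.
Proof. by rewrite quotmod_pi_eq0 closed_of_setP. Qed.

(** An embedding of M into M/N, read backwards, is an epimorphism from a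
    submodule of M onto M with kernel N. In this form no quotient module
    occurs, and partial homomorphisms are glued and extended as relations. *)
Lemma bassianP M : bassian M <-> forall G : set (M * M)%type,
  subm G -> functional G -> (forall z, exists y, G (y, z)) ->
  forall y, G (y, 0) -> y = 0.
Proof.
split=> [bM G sG fG oG|hM N [f fI] y Ny]; last first.
  pose G : set (M * M)%type := [set u | quotmod_pi N u.1 = f u.2].
  apply: (hM G) => [|z|z|].
  - split; rewrite /G /=; first by rewrite !linear0.
      by move=> u v /= e1 e2; rewrite !linearD /= e1 e2.
    by move=> a u /= e; rewrite !linearZ /= e.
  - by rewrite /G /= linear0 => /esym h; apply: fI; rewrite h linear0.
  - by have [y' yE] := quotmod_pi_surj (f z); exists y'.
  - by rewrite /G /= linear0; apply/quotmod_pi_eq0.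
pose K := [set y | G (y, 0)].
have sK : subm K.
  split; first exact: rel0.
    by move=> x y Kx Ky; rewrite /K /= -(addr0 0); apply: relD.
  by move=> a x Kx; rewrite /K /= -(scaler0 _ a); apply: relZ.
pose N := closed_of_set sK.
pose F : set (M * quotmod N)%type :=
  [set u | exists2 y, G (y, u.1) & u.2 = quotmod_pi N y].
have sF : subm F.
  split; first by exists 0; [apply: rel0|rewrite /= linear0].
    move=> u v [y Gy uE] [y' Gy' vE]; exists (y + y') => /=.
      exact: (relD sG Gy Gy').
    by rewrite linearD /= uE vE.
  move=> a u [y Gy uE]; exists (a *: y) => /=; first exact: relZ.
  by rewrite linearZ /= uE.
have [||f fP] := functional_linear sF.
- by move=> z [y /= Gy ->]; apply/quotmod_pi_closedE.
- by move=> z; have [y Gy] := oG z; exists (quotmod_pi N y), y.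
move=> y Gy; apply: (bM N); last by apply/closed_of_setP.
exists f => z z' e; apply/eqP; rewrite -subr_eq0; apply/eqP.
have {e} : f (z - z') = 0 by rewrite linearB /= e subrr.
have [w /= Gw ->] := fP (z - z'); move/quotmod_pi_closedE => Kw.
have := relB sG Gw Kw; rewrite subrr subr0; exact: fG.
Qed.

Lemma super_bassian_bassian M : super_bassian M -> bassian M.
Proof.
move=> sM; pose N := closed_of_set (@subm_set0 _ M).
have pi0 x : quotmod_pi N x = 0 -> x = 0 by move/quotmod_pi_closedE.
have pi_inj x y : quotmod_pi N x = quotmod_pi N y -> x = y.
  by move=> e; apply/eqP; rewrite -subr_eq0; apply/eqP/pi0; rewrite quotmod_piB e subrr.
apply/bassianP => G sG fG oG y Gy; apply: (pi0).
pose F : set (quotmod N * quotmod N)%type :=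
  [set u | exists x z, [/\ G (x, z), u.1 = quotmod_pi N x & u.2 = quotmod_pi N z]].
have bN : bassian (quotmod N) by apply: sM.
apply: ((bassianP (quotmod N)).1 bN F).
- split; first by exists 0, 0; rewrite quotmod_pi0; split=> //; apply: rel0.
    move=> u v [x [z [G1 u1 u2]]] [x' [z' [G2 v1 v2]]].
    exists (x + x'), (z + z'); rewrite /= !quotmod_piD u1 u2 v1 v2.
    by split=> //; apply: relD.
  move=> a u [x [z [G1 u1 u2]]]; exists (a *: x), (a *: z).
  by rewrite /= !quotmod_piZ u1 u2; split=> //; apply: relZ.
- move=> w [x [z [Gxz /= x0 ->]]].
  by rewrite (fG z) ?quotmod_pi0 // -(pi0 x).
- move=> z; have [z' <-] := quotmod_pi_surj z; have [x Gx] := oG z'.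
  by exists (quotmod_pi N x), x, z'.
- by exists y, 0; rewrite quotmod_pi0.
Qed.

(** The iterated preimages of 0 under an epimorphism form an ascending chain;
    once two of its steps coincide, so do, applying the epimorphism, all the
    earlier ones. *)
Lemma noeth_rel_inj M (A : set M) (G : set (M * M)%type) :
  noeth A -> subm A -> subm G -> functional G ->
  (forall z, A z -> exists2 y, A y & G (y, z)) ->
  forall y, A y -> G (y, 0) -> y = 0.
Proof.
move=> nA sA sG fG oG.
pose V := fix V n := if n is k.+1 then
  A `&` [set y | exists2 z, V k z & G (y, z)] else [set 0].
have sV n : subm (V n).
  elim: n => [|n IH] //=; apply: subm_setI => //; split.
  - by exists 0; [apply: subm0|apply: rel0].
  - move=> x y [z Vz Gz] [z' Vz' Gz']; exists (z + z'); [exact: submD|exact: relD].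
  - by move=> a x [z Vz Gz]; exists (a *: z); [exact: submZ|exact: relZ].
have iV n : V n `<=` V n.+1.
  elim: n => [_ -> /=|n IH x [Ax [z Vz Gz]]].
    by split; [apply: subm0|exists 0 => //; apply: rel0].
  by split=> //; exists z => //; apply: IH.
have VA n : V n `<=` A by case: n => [_ ->|n x []//]; apply: subm0.
have [m hm] := nA V sV iV VA.
have back n : V n.+2 `<=` V n.+1 -> V n.+1 `<=` V n.
  move=> h v Vv; have [y Ay Gy] := oG v (VA _ _ Vv).
  have [_ [z Vz Gyz]] : V n.+1 y by apply: h; split=> //; exists v.
  by rewrite (functionalP sG fG Gy Gyz).
have V10 : V 1 `<=` V 0%N.
  by move: (hm _ (leqnSn m)); elim: m {hm} => // m IH /back.
by move=> y Ay Gy; apply: V10; split=> //; exists 0.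
Qed.

Lemma noetherian_submod M (N : submodClosed M) :
  noetherian (submod N) <-> noeth [set x | x \in N].
Proof.
pose v : {linear submod N -> M} := val.
have vI : injective v by apply: val_inj.
rewrite noetherian_setT; split=> h.
  apply: (@noethS _ _ _ (v @` setT)); last exact: noeth_image.
  by move=> x Nx; exists (Submod Nx).
apply: (@noethS _ _ _ (v @^-1` [set x | x \in N])); last exact: noeth_preimage.
by move=> x _; apply: (valP x).
Qed.

End LinearRelations.

(** * Right modules *)

Definition ract (R : nzRingType) (M : lmodType R^c) (x : M) (r : R) : M :=
  (r : R^c) *: x.
Notation "x .* r" := (ract x r) (at level 40, left associativity).

Section RightAction.
Variables (R : nzRingType).
Implicit Types M N : lmodType R^c.

Lemma ractA M (x : M) r s : x .* r .* s = x .* (r * s).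
Proof. by rewrite /ract scalerA. Qed.
Lemma ractD M (x y : M) r : (x + y) .* r = x .* r + y .* r.
Proof. exact: scalerDr. Qed.
Lemma ractDr M (x : M) r s : x .* (r + s) = x .* r + x .* s.
Proof. exact: scalerDl. Qed.
Lemma ractB M (x y : M) r : (x - y) .* r = x .* r - y .* r.
Proof. exact: scalerBr. Qed.
Lemma ractBr M (x : M) r s : x .* (r - s) = x .* r - x .* s.
Proof. exact: (@scalerBl R^c). Qed.
Lemma ract1 M (x : M) : x .* 1 = x.
Proof. exact: scale1r. Qed.
Lemma ract0 M (x : M) : x .* 0 = 0.
Proof. exact: scale0r. Qed.
Lemma ract0l M r : (0 : M) .* r = 0.
Proof. exact: scaler0. Qed.
Lemma ract_suml M (I : Type) (r : seq I) (F : I -> M) s :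
  (\sum_(i <- r) F i) .* s = \sum_(i <- r) F i .* s.
Proof. exact: scaler_sumr. Qed.
Lemma ract_sumr M (I : Type) (r : seq I) (F : I -> R) x :
  x .* (\sum_(i <- r) F i) = \sum_(i <- r) x .* F i :> M.
Proof. exact: (@scaler_suml R^c). Qed.
Lemma linear_ract M N (f : {linear M -> N}) x r : f (x .* r) = f x .* r.
Proof. exact: linearZ. Qed.
Lemma subm_ract M (A : set M) x r : subm A -> A x -> A (x .* r).
Proof. exact: submZ. Qed.
Lemma submI M (A : set M) : A 0 -> (forall x y, A x -> A y -> A (x + y)) ->
  (forall x r, A x -> A (x .* r)) -> subm A.
Proof. by move=> h0 hD hZ; split=> // a x; apply: hZ. Qed.
Lemma rel_ract M N (G : set (M * N)%type) x y r :
  subm G -> G (x, y) -> G (x .* r, y .* r).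
Proof. exact: relZ. Qed.

End RightAction.

(** * Prime Noetherian rings: essential right ideals *)

Section PrimeRings.
Variable R : nzRingType.

Definition principal_ideal_set (a : R) : set R :=
  [set x | forall J : ideal R, (J : set R) a -> (J : set R) x].

Definition principal_ideal (a : R) : ideal R.
Proof.
apply: (@Ideal R (principal_ideal_set a)).
- by move=> J _; apply: Defs.ideal0.
- by move=> x y hx hy J Ja; apply: Defs.idealD; [apply: hx|apply: hy].
- by move=> r x hx J Ja; exact: (Defs.idealMl r (hx J Ja)).
- by move=> r x hx J Ja; exact: (Defs.idealMr r (hx J Ja)).
Defined.

Lemma principal_ideal_mem a : (principal_ideal a : set R) a.
Proof. by move=> J. Qed.

(** The elements x with x R b = 0, and then those annihilated by them, form
    ideals, so that the products of the ideals generated by a and b vanish. *)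
Lemma prime_elt (a b : R) : prime_ring R ->
  (forall r, a * r * b = 0) -> a = 0 \/ b = 0.
Proof.
move=> pR ab.
have @I1 : ideal R.
  apply: (@Ideal R [set x | forall r, x * r * b = 0]) => /=.
  - by move=> r; rewrite !mul0r.
  - by move=> x y hx hy r; rewrite !mulrDl hx hy addr0.
  - by move=> s x hx r; rewrite -2!(mulrA s) hx mulr0.
  - by move=> s x hx r; rewrite -(mulrA x) hx.
have @I2 : ideal R.
  apply: (@Ideal R [set y | forall x, (I1 : set R) x -> forall r, x * r * y = 0]) => /=.
  - by move=> x _ r; rewrite mulr0.
  - by move=> y z hy hz x Ix r; rewrite mulrDr hy// hz// addr0.
  - by move=> s y hy x Ix r; rewrite mulrA -(mulrA x) hy.
  - by move=> s y hy x Ix r; rewrite mulrA hy// mul0r.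
have [|h|h] := pR (principal_ideal a) (principal_ideal b).
- move=> _ [n [f [g [hf hg ->]]]]; apply: big1 => i _.
  have If : (I1 : set R) (f i) by apply: hf.
  have Ig : (I2 : set R) (g i) by apply: hg => x Ix r; apply: Ix.
  by rewrite -[f i]mulr1; apply: Ig.
- by left; apply: h; apply: principal_ideal_mem.
- by right; apply: h; apply: principal_ideal_mem.
Qed.

Lemma ract_ring (x r : R) : @ract R R^c^o x r = x * r.
Proof. by []. Qed.

(** Right ideals are kept as sets of elements of R, and not of the module R^c^o,
    so that products of their elements are those of R. *)
Definition rideal (L : set R) : Prop := @subm R^c R^c^o L.

Definition rann (a : R) : set R := [set r | a * r = 0].

Lemma subm_rann a : rideal (rann a).
Proof.
apply: submI => [|x y hx hy|x r hx]; rewrite /rann /= ?mulr0//.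
  by rewrite mulrDr hx hy addr0.
by rewrite ract_ring mulrA hx mul0r.
Qed.

(** It is enough to test essentiality on the right ideals kR. *)
Definition ess (E : set R) : Prop :=
  forall k : R, k <> 0 -> exists r, k * r <> 0 /\ E (k * r).

Lemma rideal_max (F : set R -> Prop) : noeth (setT : set R^c^o) ->
  (exists B, F B) -> (forall B, F B -> rideal B) ->
  exists2 B, F B & forall C, F C -> B `<=` C -> C `<=` B.
Proof.
move=> nR eF sF; apply: (@noeth_max R^c R^c^o setT F nR) => // B FB.
by split=> //; apply: sF.
Qed.

Lemma essential_ess (E : submodClosed R^c^o) :
  essential E <-> ess [set x | x \in E].
Proof.
split=> [eE k k0|eE K nK]; last first.
  have [x /not_implyP[Kx x0]] : exists x, ~ (x \in K -> x = 0).
    by apply/existsNP.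
  have [r [xr0 Er]] := eE x x0.
  exists (@ract R R^c^o x r); split=> //; first exact: (@rpredZ _ _ K).
  exact/eqP.
have [|x [/asboolP[a ->] Ex x0]] :=
    eE (closed_of_set (subm_cyc (k : R^c^o))).
  move=> h; apply: k0; apply: h; apply/closed_of_setP.
  by exists 1; rewrite scale1r.
by exists a; split=> //; apply/eqP.
Qed.

Lemma essS (E F : set R) : E `<=` F -> ess E -> ess F.
Proof.
by move=> EF eE k /eE[r [kr0 Ekr]]; exists r; split=> //; apply: EF.
Qed.

Lemma ess_quot (E : set R) (b : R) : rideal E -> ess E -> ess [set r | E (b * r)].
Proof.
move=> sE eE k k0; have [bk0|bk0] := pselect (b * k = 0).
  by exists 1; rewrite mulr1 /= bk0; split=> //; apply: (subm0 sE).
have [r [bkr0 Er]] := eE _ bk0; exists r; rewrite /= mulrA; split=> //.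
by move=> kr0; apply: bkr0; rewrite -mulrA kr0 mulr0.
Qed.

Lemma ideal_ess (I : ideal R) x : prime_ring R -> (I : set R) x -> x <> 0 ->
  ess I.
Proof.
move=> pR Ix x0 k k0; apply: contrapT => h.
have [//|//] : k = 0 \/ x = 0.
apply: prime_elt => // r; apply: contrapT => krx.
by apply: h; exists (r * x); rewrite mulrA; split=> //; apply: Defs.idealMl.
Qed.

Lemma subm_ideal (I : ideal R) : rideal I.
Proof.
split; [exact: Defs.ideal0|exact: (@Defs.idealD _ I)|].
exact: (fun r x => @Defs.idealMr _ I r x).
Qed.

(** Goldie: by the ascending chain condition, choose a nonzero singular a with
    maximal annihilator; then every aba has a strictly larger one, so aRa = 0. *)
Lemma nonsingular a : prime_ring R -> noeth (setT : set R^c^o) ->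
  ess (rann a) -> a = 0.
Proof.
move=> pR nR ea; apply: contrapT => a0.
pose F B := exists b, [/\ b <> 0, ess (rann b) & rann b = B].
have [||_ [b [b0 eb <-]] bmax] := rideal_max (F := F) nR.
- by exists (rann a), a.
- by move=> _ [b [_ _ <-]]; apply: subm_rann.
have [//|//] : b = 0 \/ b = 0.
apply: prime_elt => // r; apply: contrapT => brb0.
have sub : rann b `<=` rann (b * r * b).
  by move=> s; rewrite /rann /= => h; rewrite -mulrA h mulr0.
have [s [bs0 brbs]] := @ess_quot _ r (subm_rann b) eb b b0.
apply: bs0; apply: (bmax _ _ sub); last by rewrite /rann /= -!mulrA.
by exists (b * r * b); split=> //; apply: essS eb.
Qed.

(** ** Duals of right ideals *)

Definition rlin (L : set R) (h : R -> R) : Prop :=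
  (forall x y, L x -> L y -> h (x + y) = h x + h y) /\
  (forall x r, L x -> h (x * r) = h x * r).

Lemma rlinS (L L' : set R) h : L `<=` L' -> rlin L' h -> rlin L h.
Proof.
by move=> LL' [hD hM]; split=> [x y /LL' ? /LL' ?|x r /LL' ?]; [exact: hD|exact: hM].
Qed.

(** The linear forms h i are the components of a splitting of the projection of
    a free module onto L. *)
Lemma dual_basis (L : set R) : noeth (setT : set R^c^o) ->
  right_hereditary R -> rideal L ->
  exists n (l : nat -> R) (h : nat -> R -> R),
    [/\ forall i, (i < n)%N -> L (l i), forall i, rlin L (h i) &
      forall x, L x -> x = \sum_(i < n) l i * h i x].
Proof.
move=> nR hR sL.
have [l [n [Ll genL]]] := @noeth_fin_gen R^c R^c^o L
  (@noethS R^c R^c^o L setT (@subsetT _ L) nR) sL.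
pose NL : submodClosed R^c^o := closed_of_set sL.
have lN i : (i < n)%N -> l i \in NL by move/Ll/closed_of_setP; apply.
pose v : {linear submod NL -> R^c^o} := val.
have vsum (F : 'I_n -> submod NL) : v (\sum_i F i) = \sum_i v (F i).
  exact: linear_sum.
pose A : lmodType R^c := {ffun 'I_n -> R^c^o}.
pose p0 (w : A) : submod NL := \sum_(i < n) (w i : R^c) *: Submod (lN i (ltn_ord i)).
have p_lin : linear p0.
  move=> a u w; rewrite /p0 scaler_sumr -big_split; apply: eq_bigr => i _ /=.
  by rewrite !ffunE scalerDl scalerA.
pose p : {linear A -> submod NL} :=
  HB.pack p0 (GRing.isLinear.Build _ _ _ _ _ p_lin).
have [|g gP] := hR NL A (submod NL) p idfun.
  apply/seteqP; split=> // x _.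
  have : gen l n (val x) by rewrite genL; apply/closed_of_setP/(valP x).
  move=> /genP[c xE]; exists [ffun i : 'I_n => c i] => //.
  apply: val_inj; rewrite -/(v _) -[RHS]/(v _) [LHS]vsum [RHS]xE.
  by apply: eq_bigr => i _; rewrite ffunE linearZ.
have ffD (w w' : A) j : w j + w' j = (w + w') j by rewrite ffunE.
have ffZ (w : A) r j : (w j : R) * r = ((r : R^c) *: w) j by rewrite ffunE.
pose h i x : R := if insub i is Some j then
  if pselect (L x) is left Lx then g (Submod (proj2 (closed_of_setP sL x) Lx)) j
  else 0 else 0.
exists n, l, h; split=> // [i|x Lx].
  rewrite /h; case: insubP => [j _ _|_]; last by split=> *; rewrite ?addr0 ?mul0r.
  split=> [x y Lx Ly|x r Lx].
    have Lxy := submD sL Lx Ly.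
    case: pselect => // L1; case: pselect => // L2; case: pselect => // L3.
    by rewrite ffD -linearD; congr (g _ j); apply: val_inj.
  have Lxr := subm_ract r sL Lx.
  case: pselect => // L1; case: pselect => // L2.
  by rewrite ffZ -linearZ; congr (g _ j); apply: val_inj.
have NLx : x \in NL by apply: (proj2 (closed_of_setP sL x) Lx).
have e : v (p (g (Submod NLx))) = x by rewrite gP.
rewrite -{1}e.
rewrite [LHS]vsum; apply: eq_bigr => i _.
rewrite linearZ /h valK; case: pselect => [L1|/(_ Lx) //].
change (@GRing.mul R (l i) (g (Submod NLx) i) =
  @GRing.mul R (l i) (g (Submod (proj2 (closed_of_setP sL x) L1)) i)).
by rewrite (bool_irrelevance NLx (proj2 (closed_of_setP sL x) L1)).
Qed.

End PrimeRings.

(** * Boundedness of non-primitive hereditary Noetherian prime rings *)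

Section Bounded.
Variable R : nzRingType.
Hypothesis pR : prime_ring R.
Hypothesis nR : noeth (setT : set R^c^o).
Hypothesis nL : noeth (setT : set R^o).
Hypothesis hR : right_hereditary R.

Definition nonzero_set (A : set R) : Prop := exists2 x, A x & x <> 0.

Lemma noeth_ffun n : noeth (setT : set ({ffun 'I_n -> R^o} : lmodType R)).
Proof.
pose V : lmodType R := {ffun 'I_n -> R^o}.
pose g (i : nat) : V := [ffun j : 'I_n => (i == j)%:R].
apply: (@noethS R V setT (gen g n)); last exact: noeth_gen.
move=> v _; apply/genP.
exists (fun i => if insub i is Some j then v j else 0).
apply/ffunP => j; rewrite sum_ffunE (bigD1 j)//= big1 ?addr0 => [|i ij].
  by rewrite !ffunE valK eqxx [RHS]mulr1.
by rewrite !ffunE valK (negbTE (_ : val i != val j)) // [LHS]mulr0.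
Qed.

(** Duals grow as right ideals shrink. Since right ideals are projective and R is
    nonsingular, L above E is determined by the left module of the restrictions
    to E of the linear forms on L, which lies in a Noetherian module R^n. So an
    L properly above E with maximal dual is minimal: the ascending chain
    condition on the left yields simple modules on the right. *)
Lemma minimal_over (E : set R) : rideal E -> ess E -> ~ E 1 ->
  exists T, [/\ rideal T, E `<=` T, ~ T `<=` E &
    forall L, rideal L -> E `<=` L -> L `<=` T -> ~ L `<=` E -> T `<=` L].
Proof.
move=> sE eE E1.
have [e [n [Ee genE]]] :=
  @noeth_fin_gen R^c R^c^o E (@noethS R^c R^c^o E setT (@subsetT _ E) nR) sE.
pose V : lmodType R := {ffun 'I_n -> R^o}.
pose dual (L : set R) : set V :=
  [set v | exists2 h, rlin L h & forall i : 'I_n, v i = h (e i)].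
have sdual L : subm (dual L).
  split.
  - by exists (fun=> 0) => [|i]; rewrite ?ffunE//; split=> *; rewrite ?addr0 ?mul0r.
  - move=> v w [h [hD hM] vh] [k [kD kM] wk]; exists (fun x => h x + k x).
      split=> [x y Lx Ly|x r Lx]; first by rewrite hD// kD// addrACA.
      by rewrite hM// kM// mulrDl.
    by move=> i; rewrite ffunE vh wk.
  - move=> a v [h [hD hM] vh]; exists (fun x => a * h x).
      split=> [x y Lx Ly|x r Lx]; first by rewrite hD// mulrDr.
      by rewrite hM// mulrA.
    by move=> i; rewrite ffunE vh.
pose F D := exists L, [/\ rideal L, E `<=` L, ~ L `<=` E & dual L = D].
have [||_ [T [sT ET nTE <-]] Tmax] := @noeth_max _ V setT F (@noeth_ffun n).
- by exists (dual setT), setT; split=> // h; apply: E1; apply: h.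
- by move=> _ [L [_ _ _ <-]]; split.
exists T; split=> // L sL EL LT nLE x Tx.
have dTL : dual T `<=` dual L by move=> v [h hh vh]; exists h => //; apply: rlinS hh.
have dLT : dual L `<=` dual T by apply: Tmax dTL; exists L.
have [m [l [h [Ll hlin hE]]]] := dual_basis nR hR sL.
have [h' h'P] : exists h' : nat -> R -> R, forall j,
    rlin T (h' j) /\ forall i : 'I_n, h j (e i) = h' j (e i).
  have ex j : exists k, rlin T k /\ forall i : 'I_n, h j (e i) = k (e i).
    have [|k klin kE] := dLT [ffun i : 'I_n => h j (e i)].
      by exists (h j) => // i; rewrite ffunE.
    by exists k; split=> // i; rewrite -kE ffunE.
  exists (fun j => sval (cid (ex j))) => j; exact: (svalP (cid (ex j))).
(* By the dual basis of L, th maps T into L, and it is the identity on E. *)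
pose th y := \sum_(j < m) l j * h' j y.
have thD y z : T y -> T z -> th (y + z) = th y + th z.
  move=> Ty Tz; rewrite /th -big_split; apply: eq_bigr => j _ /=.
  by rewrite (h'P j).1.1// mulrDr.
have thM y r : T y -> th (y * r) = th y * r.
  move=> Ty; rewrite /th mulr_suml; apply: eq_bigr => j _ /=.
  by rewrite (h'P j).1.2// mulrA.
have thE w : E w -> th w = w.
  have sK : rideal [set y | T y /\ th y = y].
    apply: submI => [|y z [Ty yE] [Tz zE]|y r [Ty yE]].
    - split; first exact: subm0.
      by have := thM 0 0 (subm0 sT); rewrite !mulr0.
    - by split; [exact: (submD sT)|rewrite [LHS]thD// yE zE].
    - by split; [exact: (subm_ract r sT)|rewrite [LHS]thM// yE].
  rewrite -genE => /(gen_sub sK) [|//].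
  move=> i lt; split; first by apply/ET/Ee.
  rewrite [RHS](hE _ (EL _ (Ee _ lt))) /th; apply: eq_bigr => j _.
  by rewrite ((h'P j).2 (Ordinal lt)).
(* (th x - x) r = 0 whenever x r is in E, so th x - x is singular. *)
have thx : th x - x = 0.
  apply: nonsingular => //; apply: essS (ess_quot x sE eE) => r /= Exr.
  by rewrite /rann /= mulrBl -thM// thE// subrr.
have -> : x = th x by apply/esym/eqP; rewrite -subr_eq0 thx.
apply: (subm_sum _ sL) => j; apply: (subm_ract _ sL); exact: Ll.
Qed.

Hypothesis npR : ~ right_primitive R.

(** The simple module R/m is not faithful. *)
Lemma max_rideal_bounded (m : set R) : rideal m -> ~ m 1 ->
  (forall L, rideal L -> m `<=` L -> ~ L `<=` m -> L 1) ->
  exists2 a, a <> 0 & forall r, m (r * a).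
Proof.
move=> sm m1 mmax; apply: contrapT => nb; apply: npR.
pose N : submodClosed R^c^o := closed_of_set sm.
have piP (r : R) : quotmod_pi N r = 0 <-> m r by apply: quotmod_pi_closedE.
exists (quotmod N); split; last first.
  move=> a aN; apply: contrapT => a0; apply: nb; exists a => // r.
  by apply/piP; have := aN (quotmod_pi N r); rewrite -quotmod_piZ.
split; first by exists (quotmod_pi N (1 : R)); apply/eqP => /piP.
move=> K; have [zK|nK] := pselect (zero_sub K); [by left|right].
have sK : rideal [set r : R | quotmod_pi N r \in K].
  exact: (subm_preimage (quotmod_pi N) (subm_closed K)).
have K1 : quotmod_pi N (1 : R) \in K.
  apply: (mmax _ sK) => [r /piP rm|Km]; first by rewrite /= rm rpred0.
  apply: nK => x Kx; have [r rx] := quotmod_pi_surj x.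
  by rewrite -rx in Kx *; apply/piP/Km.
move=> x; have [r <-] := quotmod_pi_surj x.
have -> : quotmod_pi N r = (r : R^c) *: quotmod_pi N (1 : R).
  have e : (r : R^c) *: ((1 : R) : R^c^o) = r :> R^c^o by apply: (@mul1r R r).
  by rewrite -quotmod_piZ e.
exact: rpredZ.
Qed.

(** Let L be a maximal counterexample and T/L simple. Then T contains a nonzero
    ideal I, the annihilator J of T/L is nonzero, and IJ is contained in L. *)
Lemma ess_contains_ideal (E : set R) : rideal E -> ess E ->
  exists2 I : ideal R, nonzero_set I & I `<=` E.
Proof.
move=> sE eE; apply: contrapT => nI.
pose F (L : set R) :=
  [/\ rideal L, ess L & ~ exists2 I : ideal R, nonzero_set I & I `<=` L].
have [||L [sL eL nIL] Lmax] := rideal_max (F := F) nR.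
- by exists E.
- by move=> L [].
apply: nIL.
have [L1|L1] := pselect (L 1).
  exists (principal_ideal 1).
    by exists 1; [exact: principal_ideal_mem|apply/eqP/oner_neq0].
  by move=> x _; rewrite -[x]mul1r; apply: (subm_ract _ sL).
have [T [sT LT nTL Tmin]] := minimal_over sL eL L1.
have [I [i Ii i0] IT] : exists2 I : ideal R, nonzero_set I & I `<=` T.
  apply: contrapT => nIT; apply: nTL; apply: Lmax => //.
  by split=> //; apply: essS eL.
have [t Tt nLt] : exists2 t, T t & ~ L t.
  by apply: contrapT => h; apply: nTL => t Tt; apply: contrapT => ?; apply: h; exists t.
have Tgen (K : set R) : rideal K -> L `<=` K -> K t -> T `<=` K.
  move=> sK LK Kt; apply: subset_trans (Tmin (K `&` T) _ _ _ _) _ => //.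
  - exact: subm_setI.
  - by move=> x Lx; split; [apply: LK|apply: LT].
  - by move=> /(_ t) h; apply: nLt; apply: h.
(* T/L is isomorphic to R/m. *)
pose m := [set r | L (t * r)].
have sm : rideal m.
  apply: submI => [|x y|x r]; rewrite /m /= ?mulr0; first exact: (subm0 sL).
    by rewrite mulrDr; apply: (submD sL).
  by rewrite ract_ring mulrA; apply: (subm_ract _ sL).
have [||a a0 ma] := max_rideal_bounded sm.
- by rewrite /m /= mulr1.
- move=> K sK mK nKm.
  have [k Kk nmk] : exists2 k, K k & ~ m k.
    by apply: contrapT => h; apply: nKm => k Kk; apply: contrapT => ?; apply: h; exists k.
  pose tK : set R := [set x | exists2 k, K k & L (x - t * k)].
  have stK : rideal tK.
    apply: submI => [|x y [k1 K1 Lx] [k2 K2 Ly]|x r [k1 K1 Lx]].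
    - exists 0; [exact: (subm0 sK)|rewrite mulr0 subrr; exact: (subm0 sL)].
    - exists (k1 + k2); first exact: (submD sK).
      by rewrite mulrDr opprD addrACA; apply: (submD sL).
    - exists (k1 * r); first exact: (subm_ract r sK).
      rewrite ract_ring mulrA -mulrBl; exact: (subm_ract r sL).
  have TtK : T `<=` tK `&` T.
    apply: Tmin => [|x Lx||h].
    - exact: subm_setI.
    - split; last exact: LT.
      by exists 0; [exact: (subm0 sK)|rewrite mulr0 subr0].
    - by move=> x [].
    - apply: nmk; apply: h; split; last exact: (subm_ract k sT).
      by exists k => //; rewrite subrr; apply: (subm0 sL).
  have [[k' Kk' Lt] _] := TtK t Tt.
  rewrite -(subrK k' 1); apply: (submD sK) => //.
  by apply: mK; rewrite /m /= mulrBr mulr1.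
have TaL x : T x -> forall r, L (x * (r * a)).
  apply: (Tgen [set x | forall r, L (x * (r * a))]) => [|y Ly r|r].
  - apply: submI => [r|x' y hx hy r|x' s hx r] /=; rewrite ?mul0r.
    + exact: (subm0 sL).
    + by rewrite mulrDl; apply: (submD sL).
    + by rewrite ract_ring -mulrA [s * _]mulrA.
  - exact: (subm_ract _ sL).
  - exact: ma.
have [r iar0] : exists r, i * r * a <> 0.
  apply: contrapT => h; have [//|//] : i = 0 \/ a = 0.
  by apply: prime_elt => // r; apply: contrapT => ?; apply: h; exists r.
have @K : ideal R.
  apply: (@Ideal R [set z | forall s, L (s * z)]) => /=.
  - by move=> s; rewrite mulr0; apply: (subm0 sL).
  - by move=> x y hx hy s; rewrite mulrDr; apply: (submD sL).
  - by move=> s x hx s'; rewrite mulrA; apply: hx.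
  - by move=> s x hx s'; rewrite mulrA; apply: (subm_ract _ sL); apply: hx.
exists K; last by move=> z /(_ 1); rewrite mul1r.
exists (i * r * a) => // s.
by rewrite -mulrA mulrA; apply: TaL; apply: IT; apply: Defs.idealMl.
Qed.

End Bounded.

(** * Invertible ideals and maximal ideals *)

Section MaximalIdeals.
Variable R : nzRingType.

(** The two actions l = (q _) and r = (_ q) on I of an element q of the
    inverse of I; they remember all that is needed of the ring of fractions. *)
Definition multiplier (I : set R) (l r : R -> R) : Prop :=
  [/\ rlin I l, forall x y, I x -> I y -> r (x + y) = r x + r y,
      forall a x, I x -> r (a * x) = a * r x &
      forall a b, I a -> I b -> r a * b = a * l b].

Definition max_ideal (P : ideal R) : Prop :=
  [/\ nonzero_set P, ~ (P : set R) 1 &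
      forall J : ideal R, P `<=` J -> ~ (J : set R) 1 -> J `<=` P].

Lemma max_ideal_above (I : ideal R) : noeth (setT : set R^c^o) ->
  nonzero_set I -> ~ (I : set R) 1 -> exists2 P, max_ideal P & I `<=` P.
Proof.
move=> nR nzI I1.
pose F (B : set R) := exists J : ideal R, [/\ (J : set R) = B, ~ B 1 & I `<=` B].
have [||_ [P [<- P1 IP]] Pmax] := rideal_max (F := F) nR.
- by exists I, I; split.
- by move=> _ [J [<- _ _]]; apply: subm_ideal.
exists P => //; split=> // [|J PJ J1].
  by case: nzI => x Ix x0; exists x => //; apply: IP.
by apply: Pmax => //; exists J; split=> //; apply: subset_trans PJ.
Qed.

(** The ideal associated to a maximal right ideal m is nonzero, because R/m is not
    faithful, and proper. *)
Lemma max_ideal_exists : noeth (setT : set R^c^o) -> ~ right_primitive R ->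
  exists P : ideal R, max_ideal P.
Proof.
move=> nR npR.
pose F (B : set R) := rideal B /\ ~ B 1.
have [||m [sm m1] mmax] := rideal_max (F := F) nR.
- exists [set 0]; split; first exact: (@subm_set0 R^c R^c^o).
  by apply/eqP/oner_neq0.
- by move=> B [].
have [L sL mL nLm|a a0 ma] := max_rideal_bounded npR sm m1.
  by apply: contrapT => L1; apply: nLm; apply: mmax mL; split.
have @I : ideal R.
  apply: (@Ideal R [set x | forall r, m (r * x)]) => /=.
  - by move=> r; rewrite mulr0; apply: (subm0 sm).
  - by move=> x y hx hy r; rewrite mulrDr; apply: (submD sm).
  - by move=> s x hx r; rewrite mulrA; apply: hx.
  - by move=> s x hx r; rewrite mulrA; apply: (subm_ract _ sm); apply: hx.
have [||P maxP _] := @max_ideal_above I nR; last by exists P.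
  by exists a.
by move=> /(_ 1); rewrite mulr1.
Qed.

(** What the theory of P-primary modules uses about a maximal ideal P: a right
    ideal T minimal over P, the generation of R/P by T/P, and the expressions
    of 1 as an element of P P^-1 and of P^-1 P. *)
Record max_data (P : ideal R) (T : set R) : Prop := MaxData {
  md_rideal : rideal T;
  md_sub : P `<=` T;
  md_proper : exists2 t, T t & ~ (P : set R) t;
  md_min : forall L, rideal L -> P `<=` L -> L `<=` T -> ~ L `<=` P -> T `<=` L;
  md_gen : forall B : set R, (forall x y, B x -> B y -> B (x + y)) ->
    P `<=` B -> (forall a t, T t -> B (a * t)) -> B 1;
  md_invr : exists n (p : 'I_n -> R) (l r : 'I_n -> R -> R),
    [/\ forall i, (P : set R) (p i), forall i, multiplier P (l i) (r i) &
      \sum_i r i (p i) = 1];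
  md_invl : exists n (p : 'I_n -> R) (l r : 'I_n -> R -> R),
    [/\ forall i, (P : set R) (p i), forall i, multiplier P (l i) (r i) &
      \sum_i l i (p i) = 1] }.

(** R/P is simple, hence generated by the left multiples of any minimal right
    ideal T/P. *)
Lemma max_ideal_gen (P : ideal R) (T : set R) : max_ideal P -> rideal T ->
  ~ T `<=` P -> forall B : set R, (forall x y, B x -> B y -> B (x + y)) ->
    P `<=` B -> (forall a t, T t -> B (a * t)) -> B 1.
Proof.
move=> [_ P1 Pmax] sT nTP B BD PB TB.
pose ok (B : set R) := [/\ forall x y, B x -> B y -> B (x + y), P `<=` B &
  forall a t, T t -> B (a * t)].
have @J : ideal R.
  apply: (@Ideal R [set x | forall B, ok B -> B x]) => /=.
  - by move=> C [_ PC _]; apply: PC; apply: Defs.ideal0.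
  - by move=> x y hx hy C okC; have [CD _ _] := okC; apply: CD; [apply: hx|apply: hy].
  - move=> s x hx C [CD PC TC]; apply: (hx [set y | C (s * y)]); split.
    + by move=> y z; rewrite /= mulrDr; apply: CD.
    + by move=> y Py; apply: PC; apply: Defs.idealMl.
    + by move=> a t Tt; rewrite /= mulrA; apply: TC.
  - move=> s x hx C [CD PC TC]; apply: (hx [set y | C (y * s)]); split.
    + by move=> y z; rewrite /= mulrDl; apply: CD.
    + by move=> y Py; apply: PC; apply: Defs.idealMr.
    + by move=> a t Tt; rewrite /= -mulrA; apply: TC; apply: (subm_ract _ sT).
have : (J : set R) 1; last by apply.
apply: contrapT => J1; apply: nTP => t Tt; apply: (Pmax J) => //.
  by move=> p Pp C [_ PC _]; apply: PC.
by move=> C [_ _ TC]; rewrite -[t]mul1r; apply: TC.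
Qed.

Section Fractions.
Variables (Q : unitRingType) (iota : {rmorphism R -> Q}).
Hypothesis iotaI : injective iota.

Lemma multiplierP (I : ideal R) (J : set Q) q :
  sum_prods (iota @` I) J = range iota ->
  sum_prods J (iota @` I) = range iota -> J q ->
  exists l r, [/\ multiplier I l r,
    forall x, (I : set R) x -> iota (l x) = q * iota x &
    forall x, (I : set R) x -> iota (r x) = iota x * q].
Proof.
move=> IJ JI Jq.
have exl x : (I : set R) x -> exists z, iota z = q * iota x.
  move=> Ix; have : range iota (q * iota x).
    rewrite -JI; exists 1%N, (fun=> q), (fun=> iota x).
    by split=> //; rewrite big_ord1.
  by case=> z _ <-; exists z.
have exr x : (I : set R) x -> exists z, iota z = iota x * q.
  move=> Ix; have : range iota (iota x * q).
    rewrite -IJ; exists 1%N, (fun=> iota x), (fun=> q).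
    by split=> //; rewrite big_ord1.
  by case=> z _ <-; exists z.
pose l x := xget 0 [set z | iota z = q * iota x].
pose r x := xget 0 [set z | iota z = iota x * q].
have lE x : (I : set R) x -> iota (l x) = q * iota x.
  by move=> /exl[z zE]; rewrite /l; case: xgetP => [z' _ //|/(_ z)].
have rE x : (I : set R) x -> iota (r x) = iota x * q.
  by move=> /exr[z zE]; rewrite /r; case: xgetP => [z' _ //|/(_ z)].
exists l, r; split=> //; split.
- split=> [x y Ix Iy|x s Ix]; apply: iotaI.
    by rewrite rmorphD !lE ?rmorphD ?mulrDr//; apply: Defs.idealD.
  by rewrite rmorphM !lE ?rmorphM ?mulrA//; apply: Defs.idealMr.
- move=> x y Ix Iy; apply: iotaI.
  by rewrite rmorphD !rE ?rmorphD ?mulrDl//; apply: Defs.idealD.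
- move=> a x Ix; apply: iotaI.
  by rewrite rmorphM !rE ?rmorphM ?mulrA//; apply: Defs.idealMl.
- by move=> a b Ia Ib; apply: iotaI; rewrite !rmorphM rE// lE// mulrA.
Qed.

Lemma invertible_right (I : ideal R) : invertible iota I ->
  exists n (p : 'I_n -> R) (l r : 'I_n -> R -> R),
    [/\ forall i, (I : set R) (p i), forall i, multiplier I (l i) (r i) &
      \sum_i r i (p i) = 1].
Proof.
move=> [J [_ IJ JI]].
have : sum_prods (iota @` I) J 1 by rewrite IJ; exists 1; rewrite ?rmorph1.
move=> [n [a [b [Ia Jb e]]]].
have /all_sig2[p Ip pE] i : {x | (I : set R) x & iota x = a i}.
  exact/cid2/Ia.
have ex i : {lr : (R -> R) * (R -> R) | multiplier I lr.1 lr.2 &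
    iota (lr.2 (p i)) = a i * b i}.
  apply: cid2; have [l [r [m _ rE]]] := multiplierP IJ JI (Jb i).
  by exists (l, r) => //=; rewrite rE// pE.
exists n, p, (fun i => (s2val (ex i)).1), (fun i => (s2val (ex i)).2).
split=> // [i|]; first exact: (s2valP (ex i)).
apply: iotaI; rewrite rmorph1 e rmorph_sum.
by apply: eq_bigr => i _; apply: (s2valP' (ex i)).
Qed.

Lemma invertible_left (I : ideal R) : invertible iota I ->
  exists n (p : 'I_n -> R) (l r : 'I_n -> R -> R),
    [/\ forall i, (I : set R) (p i), forall i, multiplier I (l i) (r i) &
      \sum_i l i (p i) = 1].
Proof.
move=> [J [_ IJ JI]].
have : sum_prods J (iota @` I) 1 by rewrite JI; exists 1; rewrite ?rmorph1.
move=> [n [b [a [Jb Ia e]]]].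
have /all_sig2[p Ip pE] i : {x | (I : set R) x & iota x = a i}.
  exact/cid2/Ia.
have ex i : {lr : (R -> R) * (R -> R) | multiplier I lr.1 lr.2 &
    iota (lr.1 (p i)) = b i * a i}.
  apply: cid2; have [l [r [m lE _]]] := multiplierP IJ JI (Jb i).
  by exists (l, r) => //=; rewrite lE// pE.
exists n, p, (fun i => (s2val (ex i)).1), (fun i => (s2val (ex i)).2).
split=> // [i|]; first exact: (s2valP (ex i)).
apply: iotaI; rewrite rmorph1 e rmorph_sum.
by apply: eq_bigr => i _; apply: (s2valP' (ex i)).
Qed.

Lemma invertible_nonzero (I : ideal R) : invertible iota I -> nonzero_set I.
Proof.
move=> /invertible_right[n [p [l [r [Ip mlr e]]]]].
apply: contrapT => nz.
have /eqP : (1 : R) = 0; last by rewrite oner_eq0.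
rewrite -e; apply: big1 => i _.
have p0 : p i = 0 by apply: contrapT => ?; apply: nz; exists (p i).
have [_ _ rM _] := mlr i.
by have := rM 0 (p i) (Ip i); rewrite p0 !mul0r.
Qed.

(** When every nonzero ideal is invertible, being invertible means being nonzero,
    as the zero ideal is not invertible. *)
Lemma max_invertibleP (P : ideal R) :
  (forall I : ideal R, nonzero_set I -> invertible iota I) ->
  maximal_invertible iota P <-> max_ideal P.
Proof.
have top (I : ideal R) : (I : set R) 1 -> (I : set R) = setT.
  move=> I1; apply/seteqP; split=> // x _.
  by rewrite -[x]mulr1; apply: Defs.idealMl.
move=> inv; split=> [[[iP PT] Pmax]|[nzP P1 Pmax]].
  have nzP := invertible_nonzero iP.
  split=> // [/top//|J PJ J1]; apply: Pmax => //; split.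
    by apply: inv; case: nzP => x Px x0; exists x => //; apply: PJ.
  by move=> JT; apply: J1; rewrite JT.
split; first by split; [apply: inv|move=> PT; apply: P1; rewrite PT].
by move=> I [_ IT] PI; apply: Pmax => // /top.
Qed.

End Fractions.
End MaximalIdeals.

Lemma max_data_exists (R : nzRingType) (Q : unitRingType)
    (iota : {rmorphism R -> Q}) (P : ideal R) :
  injective iota -> dedekind_prime iota -> max_ideal P ->
  exists T, max_data P T.
Proof.
move=> iI [[hR _ /noetherian_setT nR /noetherian_setT nL pR] inv] maxP.
have [[x Px x0] P1 _] := maxP.
have eP : ess P by apply: ideal_ess x0.
have [T [sT PT nTP Tmin]] := minimal_over pR nR nL hR (subm_ideal P) eP P1.
have invP : invertible iota P by apply: inv; exists x => //; apply/eqP.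
exists T; split=> //; [|exact: max_ideal_gen|exact: invertible_right invP|
  exact: invertible_left invP].
by apply: contrapT => h; apply: nTP => t Tt; apply: contrapT => ?; apply: h; exists t.
Qed.

(** * Modules over a ring with a maximal invertible ideal *)

Section PModules.
Variables (R : nzRingType) (P : ideal R) (T : set R).
Hypothesis PT : max_data P T.
Implicit Types X Y M : lmodType R^c.

Fixpoint annP X (n : nat) : set X :=
  if n is k.+1 then [set x | forall p, (P : set R) p -> annP k (x .* p)]
  else [set 0].
Arguments annP : clear implicits.

Definition primary X : Prop := forall x : X, exists n, annP X n x.

(** The submodule AP, generated by the products; it is enough to generate it
    additively. *)
Definition mulP X (A : set X) : set X :=
  [set x | forall B : set X, B 0 -> (forall y z, B y -> B z -> B (y + z)) ->
     (forall a p, A a -> (P : set R) p -> B (a .* p)) -> B x].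

Arguments mulP : simpl never.

Definition powP X (A : set X) (n : nat) : set X := iter n (@mulP X) A.

Lemma subm_annP X n : subm (annP X n).
Proof.
elim: n => [|n IH]; first exact: subm_set0.
apply: submI => [p _|x y hx hy p Pp|x r hx p Pp] /=.
- by rewrite ract0l; apply: subm0.
- by rewrite ractD; apply: submD => //; [apply: hx|apply: hy].
- by rewrite ractA; apply: hx; apply: Defs.idealMl.
Qed.

Lemma annP_ract X n (x : X) r : annP X n x -> annP X n (x .* r).
Proof. by move=> h; apply: subm_ract => //; apply: subm_annP. Qed.

Lemma annPS X n : annP X n `<=` annP X n.+1.
Proof.
elim: n => [x -> p _|n IH x hx p Pp]; first by rewrite ract0l.
by apply: IH; apply: hx.
Qed.

Lemma annP_linear X Y (f : {linear X -> Y}) n x : annP X n x -> annP Y n (f x).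
Proof.
elim: n x => [x ->|n IH x hx p Pp]; first by rewrite /= linear0.
by rewrite -linear_ract; apply: IH; apply: hx.
Qed.

Lemma annP_inj X Y (f : {linear X -> Y}) n x : injective f ->
  annP Y n (f x) -> annP X n x.
Proof.
move=> fI; elim: n x => [x /= fx|n IH x hx p Pp].
  by apply: fI; rewrite linear0.
by apply: IH; rewrite linear_ract; apply: hx.
Qed.

Lemma mulP_mem X (A : set X) a p : A a -> (P : set R) p -> mulP A (a .* p).
Proof. by move=> Aa Pp B _ _; apply. Qed.

Lemma subm_mulP X (A : set X) : subm (mulP A).
Proof.
apply: submI => [B //|x y hx hy B B0 BD BM|x r hx].
  exact: BD (hx B B0 BD BM) (hy B B0 BD BM).
apply: (hx [set y | mulP A (y .* r)]) => [|y z hy hz|a p Aa Pp] /=.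
- by rewrite ract0l => B.
- rewrite ractD => B B0 BD BM; exact: BD (hy B B0 BD BM) (hz B B0 BD BM).
- by rewrite ractA; apply: mulP_mem => //; apply: Defs.idealMr.
Qed.

Lemma mulP_min X (A B : set X) : subm B ->
  (forall a p, A a -> (P : set R) p -> B (a .* p)) -> mulP A `<=` B.
Proof.
move=> sB AB x; apply => //; first exact: subm0.
by move=> y z; apply: submD.
Qed.

Lemma mulPS X (A B : set X) : A `<=` B -> mulP A `<=` mulP B.
Proof.
move=> AB; apply: mulP_min; first exact: subm_mulP.
by move=> a p /AB; apply: mulP_mem.
Qed.

Lemma mulP_sub X (A : set X) : subm A -> mulP A `<=` A.
Proof. by move=> sA; apply: mulP_min => // a p Aa _; apply: subm_ract. Qed.

Lemma subm_powP X (A : set X) n : subm A -> subm (powP A n).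
Proof. by case: n => [//|n] _; apply: subm_mulP. Qed.

Lemma powPS X (A B : set X) n : A `<=` B -> powP A n `<=` powP B n.
Proof. by move=> AB; elim: n => //= n; apply: mulPS. Qed.

Lemma powPSr X (A : set X) n : powP A n.+1 = powP (mulP A) n.
Proof. exact: iterSr. Qed.

Lemma powP_add X (A : set X) m n : powP A (m + n) = powP (powP A n) m.
Proof. exact: iterD. Qed.

Lemma powP_le X (A : set X) m n : subm A -> (m <= n)%N ->
  powP A n `<=` powP A m.
Proof.
move=> sA; elim: n => [|n IH]; first by rewrite leqn0 => /eqP ->.
rewrite leq_eqVlt => /predU1P[-> //|/IH h].
by apply: subset_trans h; apply: mulP_sub; apply: subm_powP.
Qed.

Lemma mulP_linear X Y (f : {linear X -> Y}) (A : set X) x :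
  mulP A x -> mulP (f @` A) (f x).
Proof.
suff h : mulP A `<=` f @^-1` (mulP (f @` A)) by apply: h.
apply: mulP_min; first exact/subm_preimage/subm_mulP.
by move=> a p Aa Pp; rewrite /preimage /= linear_ract; apply: mulP_mem => //; exists a.
Qed.

Lemma powP_linear X Y (f : {linear X -> Y}) (A : set X) n x :
  powP A n x -> powP (f @` A) n (f x).
Proof.
elim: n x => [x Ax|n IH x]; first by exists x.
move=> h; apply: (@mulPS _ (f @` powP A n)); last exact: mulP_linear.
by move=> _ [y hy <-]; exact: IH.
Qed.

Lemma mulP_annP X (A : set X) n : A `<=` annP X n.+1 -> mulP A `<=` annP X n.
Proof.
by move=> h; apply: mulP_min => [|a p Aa Pp]; [apply: subm_annP|apply: h].
Qed.

(** Elements of AP can be multiplied by the inverse of P. *)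
Lemma mulP_div X (A : set X) (l r : R -> R) z : subm A -> multiplier P l r ->
  mulP A z -> exists2 u, A u & forall b, (P : set R) b -> u .* b = z .* l b.
Proof.
move=> sA [_ _ _ lr].
apply: (_ : mulP A `<=` [set z | exists2 u, A u &
  forall b, (P : set R) b -> u .* b = z .* l b]).
move=> x hx; apply: hx => [|y y' [u Au uE] [v Av vE]|a p Aa Pp].
- by exists 0 => [|b _]; [apply: subm0|rewrite !ract0l].
- by exists (u + v) => [|b Pb]; [apply: submD|rewrite !ractD uE// vE].
- exists (a .* r p) => [|b Pb]; first exact: subm_ract.
  by rewrite !ractA lr.
Qed.

(** Invertibility makes C/C[P] -> CP faithful on submodules: yP <= YP implies
    y in Y as soon as Y contains the elements of C killed by P. *)
Lemma mulP_cancel X (C Y : set X) y : subm C -> subm Y -> Y `<=` C ->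
  C `&` annP X 1 `<=` Y -> C y ->
  (forall p, (P : set R) p -> mulP Y (y .* p)) -> Y y.
Proof.
move=> sC sY YC CY Cy yY; have [n [p [l [r [Pp m e]]]]] := md_invr PT.
rewrite -[y]ract1 -e ract_sumr; apply: subm_sum => // i.
have [u Yu uE] := mulP_div sY (m i) (yY _ (Pp i)).
rewrite -(subrK u (_ .* _)); apply: submD => //; apply: CY; split.
  by apply: submB => //; [apply: subm_ract|apply: YC].
move=> b Pb; rewrite /= ractB uE// !ractA.
by have [_ _ _ ->//] := m i; rewrite subrr.
Qed.

(** If n is in DP, then the elements n q with q in P^-1 make sense in D; they are
    mapped into N by P, and n = sum (n q_i) p_i. *)
Lemma mulP_lift X (N D : set X) : subm D -> subm N -> N `<=` mulP D ->
  N `<=` mulP [set y | D y /\ forall p, (P : set R) p -> N (y .* p)].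
Proof.
move=> sD sN ND x Nx; have [n [p [l [r [Pp m e]]]]] := md_invl PT.
rewrite -[x]ract1 -e ract_sumr; apply: (subm_sum _ (subm_mulP _)) => i.
have [u Du uE] := mulP_div sD (m i) (ND _ Nx).
rewrite -uE//; apply: mulP_mem => //; split=> // b Pb.
by rewrite uE//; apply: subm_ract.
Qed.

(** Each layer of D is reached from the preceding one by cancelling a factor P,
    which costs one unit of height. *)
Lemma height_step X (A D : set X) n : subm A -> subm D -> A `<=` D ->
  D `&` annP X 1 `<=` powP A n ->
  forall k, (k <= n)%N -> D `&` annP X k.+1 `<=` powP A (n - k).
Proof.
move=> sA sD AD h; elim=> [|k IH] kn; first by rewrite subn0.
move=> d [Dd dk]; apply: (@mulP_cancel _ D) => //; first exact: subm_powP.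
- by apply: (subset_trans _ AD); exact: (@powP_le _ A 0%N (n - k.+1) sA (leq0n _)).
- by apply: subset_trans h _; apply: powP_le => //; apply: leq_subr.
move=> p Pp; rewrite -[mulP _]/(powP A (n - k.+1).+1) subnSK//.
by apply: IH; [apply: ltnW|split; [apply: subm_ract|apply: dk]].
Qed.

(** R/P-modules are semisimple: if a maximal Z meeting U in A missed an element
    of C modulo U, then, T/P generating R/P, it would miss a simple module
    (xT + A)/A, and xT could be added to Z. *)
Lemma complement X (A U C : set X) : subm A -> subm U -> subm C ->
  A `<=` U -> U `<=` C -> (forall c p, C c -> (P : set R) p -> A (c .* p)) ->
  exists Z, [/\ subm Z, A `<=` Z, Z `<=` C, Z `&` U `<=` A & C `<=` subadd Z U].
Proof.
move=> sA sU sC AU UC CA.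
have [|Z [sZ AZ ZK Zmax]] := @max_subm _ _ A [set x | C x /\ (U x -> A x)] sA.
  by move=> x Ax; split=> //; apply/UC/AU.
have ZC : Z `<=` C by move=> x /ZK[].
exists Z; split=> //; first by move=> x [/ZK[_ h] /h].
have sZU : subm (subadd Z U) by apply: subm_add.
move=> c Cc; apply: contrapT => nc.
have [a [t Tt nTx]] : exists a, exists2 t, T t & ~ subadd Z U (c .* (a * t)).
  apply: contrapT => h; apply: nc; rewrite -[c]ract1.
  apply: (md_gen PT (B := [set r | subadd Z U (c .* r)])) => [r s|p Pp|a t Tt] /=.
  - by rewrite ractDr; apply: submD.
  - by apply: subadd_l => //; apply/AZ/CA.
  - by apply: contrapT => ?; apply: h; exists a, t.
pose x := c .* a.
have Cx : C x by apply: subm_ract.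
have sT := md_rideal PT.
have TP s : T s -> subadd Z U (x .* s) -> (P : set R) s.
  move=> Ts xs; apply: contrapT => nPs.
  pose L := T `&` [set r | subadd Z U (x .* r)].
  have : T `<=` L.
    apply: (md_min PT) => [|p Pp|r []//|h].
    - apply: (@subm_setI R^c R^c^o) => //; apply: submI => [|r r'|r r'] /=.
      + by rewrite ract0; apply: subm0.
      + by rewrite ractDr; apply: submD.
      + by rewrite ract_ring -ractA; apply: subm_ract.
    - by split; [apply: (md_sub PT)|apply: subadd_l => //; apply/AZ/CA].
    - by apply: nPs; apply: h; split.
  by move=> /(_ t Tt) [_]; rewrite /= ractA.
pose xT := [set y | exists2 s, T s & y = x .* s].
have sxT : subm xT.
  apply: submI => [|_ _ [s Ts ->] [s' Ts' ->]|_ r [s Ts ->]].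
  - by exists 0; [apply: (subm0 sT)|rewrite ract0].
  - by exists (s + s'); [apply: (submD sT)|rewrite ractDr].
  - by exists (s * r); [apply: (subm_ract r sT)|rewrite ractA].
apply: nTx; apply: subadd_l => //; apply: (Zmax (subadd Z xT)).
- exact: subm_add.
- exact: subadd_l.
- move=> _ [z [_ [Zz [s Ts ->] ->]]]; split.
    by apply: submD => //; [apply: ZC|apply: subm_ract].
  move=> Uzx; have Ps : (P : set R) s.
    apply: TP => //; exists (- z), (z + x .* s); split=> //; first exact: submN.
    by rewrite addKr.
  have [_ h] : [set x | C x /\ (U x -> A x)] (z + x .* s); last exact: h.
  by apply: ZK; apply: submD => //; apply/AZ/CA.
- by apply: subadd_r => //; exists t => //; rewrite ractA.
Qed.

(** A nonzero element v of an R/P-module generates copies of the simple module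
    T/P. *)
Lemma simple_handle X (A : set X) v : subm A -> ~ A v ->
  (forall p, (P : set R) p -> A (v .* p)) ->
  exists a, forall t, T t -> A (v .* a .* t) -> (P : set R) t.
Proof.
move=> sA nAv vP; have sT := md_rideal PT.
have [a [t0 Tt0 nat0]] : exists a, exists2 t, T t & ~ A (v .* (a * t)).
  apply: contrapT => h; apply: nAv; rewrite -[v]ract1.
  apply: (md_gen PT (B := [set r | A (v .* r)])) => [r s|p Pp|a t Tt] /=.
  - by rewrite ractDr; apply: submD.
  - exact: vP.
  - by apply: contrapT => ?; apply: h; exists a, t.
exists a => t Tt Avt; apply: contrapT => nPt.
pose L := T `&` [set r | A (v .* a .* r)].
have : T `<=` L.
  apply: (md_min PT) => [|p Pp|r []//|h].
  - apply: (@subm_setI R^c R^c^o) => //; apply: submI => [|r r'|r r'] /=.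
    + by rewrite ract0; apply: subm0.
    + by rewrite ractDr; apply: submD.
    + by rewrite ract_ring -ractA; apply: subm_ract.
  - split; first exact: (md_sub PT).
    by rewrite /= ractA; apply: vP; apply: Defs.idealMl.
  - by apply: nPt; apply: h; split.
by move=> /(_ t0 Tt0) [_]; rewrite /= ractA.
Qed.

(** A part W of the socle consisting of elements of height n is the socle of a
    submodule B with W = BP^n: the layers are lifted one at a time, each time
    splitting off the part of the socle that is not wanted. *)
Lemma homogeneous_hull X (W : set X) n : subm W -> W `<=` powP setT n ->
  W `<=` annP X 1 -> exists B, [/\ subm B, B `&` annP X 1 `<=` W,
    W `<=` powP B n & B `<=` annP X n.+1].
Proof.
move=> sW Wn W1.
suff h j : (j <= n)%N -> exists Z, [/\ subm Z, Z `<=` powP setT (n - j) &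
    [/\ Z `&` annP X 1 `<=` W, W `<=` powP Z j & Z `<=` annP X j.+1]].
  by have [Z [sZ _ [Z1 WZ Zn]]] := h n (leqnn n); exists Z.
elim: j => [_|j IH jn].
  by exists W; rewrite subn0; split=> //; split=> // x [].
have [Z [sZ Zh [Z1 WZ Zn]]] := IH (ltnW jn).
pose H := powP (setT : set X) (n - j.+1).
have sH : subm H by apply: subm_powP.
have ZH : Z `<=` mulP H.
  by rewrite -[mulP H]/(powP setT (n - j.+1).+1) subnSK.
pose Y := [set y | H y /\ forall p, (P : set R) p -> Z (y .* p)].
have sY : subm Y.
  apply: submI => [|x y [Hx xZ] [Hy yZ]|x r [Hx xZ]].
  - by split; [apply: subm0|move=> p _; rewrite ract0l; apply: subm0].
  - split; first exact: submD.
    by move=> p Pp; rewrite ractD; apply: submD => //; [apply: xZ|apply: yZ].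
  - split; first exact: subm_ract.
    by move=> p Pp; rewrite ractA; apply: xZ; apply: Defs.idealMl.
have ZY : Z `<=` mulP Y := mulP_lift sH sZ ZH.
have ZsY : Z `<=` Y.
  move=> z Zz; split; first by apply: (mulP_sub sH); apply: ZH.
  by move=> p _; apply: subm_ract.
pose U := subadd Z (Y `&` annP X 1).
have sY1 : subm (Y `&` annP X 1) by apply: subm_setI => //; apply: subm_annP.
have [||||K [sK ZK KY KU YK]] := @complement X Z U Y sZ _ sY.
- exact: subm_add.
- exact: subadd_l.
- by apply: subadd_min => // x [].
- by move=> c p [_]; apply.
exists K; split=> //; first by move=> x /KY[].
have K1 : K `&` annP X 1 `<=` Z.
  move=> x [Kx x1]; apply: KU; split=> //; apply: subadd_r => //.
  by split=> //; apply: KY.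
split; [|rewrite powPSr|].
- by move=> x [Kx x1]; apply: Z1; split=> //; apply: K1.
- apply: subset_trans WZ _; apply: powPS; apply: subset_trans ZY _.
  apply: mulP_min; first exact: subm_mulP.
  move=> y p /YK[k [_ [Kk [z [w [Zz [_ w1] ->]]] ->]]] Pp.
  rewrite !ractD (w1 p Pp) addr0; apply: (submD (subm_mulP _)).
    exact: mulP_mem.
  by apply: mulP_mem => //; apply: ZK.
- by move=> x /KY[_ xZ] p Pp; apply: Zn; apply: xZ.
Qed.

Lemma socle_eq0 X (A : set X) : subm A ->
  (forall x, A x -> exists n, annP X n x) -> A `&` annP X 1 `<=` [set 0] ->
  A `<=` [set 0].
Proof.
move=> sA pA h x Ax; have [n] := pA x Ax.
elim: n x Ax => [x _ ->//|n IH] x Ax xn; apply: h; split=> // p Pp.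
by apply: IH; [apply: subm_ract|apply: xn].
Qed.

(** A P-primary module is an essential extension of its socle. *)
Lemma inj_on_socle X Y (f : {linear X -> Y}) (A : set X) : subm A ->
  (forall x, A x -> exists n, annP X n x) ->
  (forall x, A x -> annP X 1 x -> f x = 0 -> x = 0) ->
  forall x, A x -> f x = 0 -> x = 0.
Proof.
move=> sA pA h x Ax fx.
apply: (@socle_eq0 _ (A `&` f @^-1` [set 0])) => // [|y []|y [[Ay fy] y1]].
- by apply: subm_setI => //; apply: subm_preimage.
- by move=> /pA.
- exact: h.
Qed.

Lemma socle_add X (A C : set X) : subm A -> subm C ->
  (forall x, A x -> exists n, annP X n x) ->
  A `&` C `&` annP X 1 `<=` [set 0] ->
  subadd A C `&` annP X 1 `<=` subadd (A `&` annP X 1) (C `&` annP X 1).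
Proof.
move=> sA sC pA h _ [[a [c [Aa Cc ->]]] ac1].
have AC0 : A `&` C `<=` [set 0].
  by apply: socle_eq0 => // [|x []]; [apply: subm_setI|move=> /pA].
have acP p : (P : set R) p -> a .* p = 0 /\ c .* p = 0.
  move=> Pp; have /eqP := ac1 p Pp; rewrite ractD addr_eq0 => /eqP e.
  have a0 : a .* p = 0.
    apply: AC0; split; first exact: subm_ract.
    by rewrite e; apply: submN => //; apply: subm_ract.
  by split=> //; move/eqP: e; rewrite a0 eq_sym oppr_eq0 => /eqP.
by exists a, c; split=> //; split=> // p /acP[].
Qed.

End PModules.

(** * Extension of homomorphisms between primary modules *)

Section Extension.
Variables (R : nzRingType) (P : ideal R) (T : set R).
Hypothesis PT : max_data P T.
Implicit Types X Y : lmodType R^c.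
Local Notation annP X := (@annP R P X).
Local Notation mulP := (@mulP R P _).
Local Notation powP := (@powP R P _).
Local Notation primary := (@primary R P).

(** If 1 = sum p_i q_i, then phi is the multiplication by sum phi(p_i) q_i, which
    is an element of D because the phi(p_i) are in DP. *)
Lemma hom_from_ideal Y (D : set Y) (phi : R -> Y) : subm D ->
  (forall x y, (P : set R) x -> (P : set R) y -> phi (x + y) = phi x + phi y) ->
  (forall x s, (P : set R) x -> phi (x * s) = phi x .* s) ->
  (forall x, (P : set R) x -> mulP D (phi x)) ->
  exists2 d, D d & forall x, (P : set R) x -> phi x = d .* x.
Proof.
move=> sD phiD phiM phiP; have [n [p [l [r [Pp m e]]]]] := md_invr PT.
have ex i : {u | D u & forall b, (P : set R) b -> u .* b = phi (p i) .* l i b}.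
  by apply: cid2; apply: mulP_div (m i) (phiP _ (Pp i)).
exists (\sum_i s2val (ex i)); first by apply: subm_sum => // i; apply: (s2valP (ex i)).
have phi0 : phi 0 = 0.
  by have := phiM 0 0 (Defs.ideal0 P); rewrite mulr0 ract0.
have phi_sum (F : 'I_n -> R) : (forall i, (P : set R) (F i)) ->
    phi (\sum_i F i) = \sum_i phi (F i).
  move=> PF; elim: (index_enum _) => [|i s IH]; first by rewrite !big_nil.
  rewrite !big_cons phiD// ?IH//; exact: (subm_sum s (subm_ideal P) PF).
move=> x Px; rewrite -{1}[x]mul1r -e mulr_suml phi_sum => [|i]; last first.
  exact: Defs.idealMl.
rewrite ract_suml; apply: eq_bigr => i _; rewrite (s2valP' (ex i))//.
by have [_ _ _ ->//] := m i; rewrite phiM.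
Qed.

(** A partial homomorphism X -> D extends as soon as all its extensions map XP
    into DP. By Zorn it is enough to extend from Y to Y + xR with xP <= Y; on P
    this is invertibility of P, modulo P it is semisimplicity of R/P. *)
Lemma extend_hom X Y (D : set Y) (F0 : set (X * Y)%type) :
  primary X -> subm D -> subm F0 -> functional F0 ->
  (forall x d, F0 (x, d) -> D d) ->
  (forall F : set (X * Y)%type, subm F -> functional F -> F0 `<=` F ->
     (forall x d, F (x, d) -> D d) ->
     forall x d, F (x, d) -> mulP setT x -> mulP D d) ->
  exists f : {linear X -> Y},
    (forall x, D (f x)) /\ (forall x d, F0 (x, d) -> f x = d).
Proof.
move=> pX sD sF0 fF0 F0D step.
pose C := [set u : (X * Y)%type | D u.2 /\ (u.1 = 0 -> u.2 = 0)].
have [|F [sF F0F FC Fmax]] := @max_subm _ _ F0 C sF0.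
  by move=> [x d] Fxd; split=> /=; [apply: F0D Fxd|move=> x0; apply: fF0; rewrite -x0].
have fF : functional F by move=> z /FC[_]; apply.
have FD x d : F (x, d) -> D d by move/FC=> [].
pose dom := [set x | exists d, F (x, d)].
have sdom : subm dom.
  apply: submI => [|x y [d Fd] [e Fe]|x r [d Fd]].
  - by exists 0; apply: rel0.
  - by exists (d + e); apply: relD.
  - by exists (d .* r); apply: rel_ract.
suff tot : forall x, dom x.
  have [f fP] := functional_linear sF fF tot.
  exists f; split=> [x|x d Fd]; first exact: FD (fP x).
  by apply: functionalP sF fF (fP x) _; apply: F0F.
move=> x0; apply: contrapT => nx0.
have [x nx xP] : exists2 x, ~ dom x & forall p, (P : set R) p -> dom (x .* p).
  have [n] := pX x0; elim: n x0 nx0 => [x0 nx0 x00|n IH x0 nx0 hx0].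
    by case: nx0; rewrite x00; apply: subm0.
  have [xP|nxP] := pselect (forall p, (P : set R) p -> dom (x0 .* p)).
    by exists x0.
  move/existsNP: nxP => [p /not_implyP[Pp ndom]].
  by apply: IH ndom _; apply: hx0.
pose L : set R := [set r | dom (x .* r)].
have sL : rideal L.
  apply: submI => [|r s|r s]; rewrite /L /= ?ract0 ?ractDr; first exact: subm0.
    exact: submD.
  by rewrite ract_ring -ractA; apply: subm_ract.
have PL : P `<=` L by move=> p; apply: xP.
pose phi r := xget 0 [set d | F (x .* r, d)].
have phiP r : L r -> F (x .* r, phi r).
  by move=> [d Fd]; rewrite /phi; case: xgetP => [y _ //|/(_ d)].
have phiE r d : F (x .* r, d) -> phi r = d.
  by move=> Fd; apply: (functionalP sF fF _ Fd); apply: phiP; exists d.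
(* The values on xP are given by an element d of D. *)
have [d Dd dE] : exists2 d, D d & forall p, (P : set R) p -> phi p = d .* p.
  apply: hom_from_ideal => // [p q /PL Lp /PL Lq|p s /PL Lp|p Pp].
  - by apply: phiE; rewrite ractDr; apply: relD => //; apply: phiP.
  - by apply: phiE; rewrite -ractA; apply: rel_ract => //; apply: phiP.
  - apply: (step F sF fF F0F FD _ _ (phiP _ (PL _ Pp))).
    exact: mulP_mem.
(* L/P is a direct summand of R/P, generated by the idempotent e; the values on
   xL that remain are determined by the one at e. *)
have [Z [sZ ZL [z [e [Zz Le e1]]]]] : exists Z : set R,
    [/\ rideal Z, Z `&` L `<=` P & exists z e, [/\ Z z, L e & 1 = z + e]].
  have [||||||Z [sZ PZ _ ZL RZL]] := @complement _ _ _ PT R^c^o P L setT.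
  - exact: subm_ideal.
  - exact: sL.
  - by [].
  - exact: PL.
  - by [].
  - by move=> c p _ Pp; apply: Defs.idealMl.
  by exists Z; split=> //; apply: RZL.
pose d' := d + (phi e - d .* e).
have Dd' : D d'.
  apply: submD => //; apply: submB; [by []|exact: FD (phiP _ Le)|].
  exact: subm_ract.
have d'P r : L r -> F (x .* r, d' .* r).
  move=> Lr; have sP := subm_ideal P.
  have Ler : L (e * r) by apply: (subm_ract r sL).
  have Pzr : (P : set R) (z * r).
    apply: ZL; split; first exact: (subm_ract r sZ).
    have -> : z * r = r - e * r by rewrite -{2}[r]mul1r e1 mulrDl addrK.
    exact: (submB sL).
  have -> : d' .* r = d .* (z * r) + phi e .* r.
    rewrite /d' ractD ractB ractA -[in d .* r](mul1r r) e1 mulrDl ractDr.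
    by rewrite addrACA subrr addr0.
  have -> : x .* r = x .* (z * r) + x .* e .* r.
    by rewrite ractA -ractDr -mulrDl -e1 mul1r.
  apply: relD => //; first by rewrite -dE//; apply: phiP; apply: PL.
  by apply: rel_ract => //; apply: phiP.
pose F' : set (X * Y)%type := subadd F [set u | exists r, u = (x .* r, d' .* r)].
have sxR : subm [set u : (X * Y)%type | exists r, u = (x .* r, d' .* r)].
  split; first by exists 0; rewrite !ract0.
    by move=> _ _ [r ->] [s ->]; exists (r + s); rewrite !ractDr.
  by move=> a _ [r ->]; exists (r * a); rewrite -!ractA.
apply: nx; exists d'; apply: (Fmax F').
- exact: subm_add.
- exact: subadd_l.
- move=> _ [[y f] [_ [Fyf [r ->] ->]]]; split=> /=.
    by apply: submD => //; [apply: FD Fyf|apply: subm_ract].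
  move=> yx0; have Lr : L r.
    exists (- f); have -> : x .* r = - y.
      by apply/eqP; rewrite -addr_eq0 addrC yx0.
    by apply: (submN sF Fyf).
  by apply: fF; rewrite -yx0; apply: relD => //; apply: d'P.
- by apply: subadd_r => //; exists 1; rewrite !ract1.
Qed.

(** The relation: y - x is in B and th y = j x. It is an epimorphism onto X from
    a submodule of X, single-valued because j embeds B and surjective because
    th B contains both images, and its kernel is that of th on B. *)
Lemma bassian_two_maps X Y (B : set X) (th j : {linear X -> Y}) :
  bassian X -> subm B ->
  (forall x, exists2 b, B b & th b = th x) ->
  (forall x, exists2 b, B b & th b = j x) ->
  (forall b, B b -> j b = 0 -> b = 0) ->
  forall b, B b -> th b = 0 -> b = 0.
Proof.
move=> /bassianP bX sB thB jB jI b Bb tb.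
apply: (bX [set u | B (u.1 - u.2) /\ th u.1 = j u.2]) => [|z|x|].
- split=> /=; first by rewrite subrr !linear0; split=> //; apply: subm0.
    move=> [y x] [y' x'] /= [Byx e] [Byx' e'].
    change (B ((y + y') - (x + x')) /\ th (y + y') = j (x + x')).
    split; last by rewrite !linearD e e'.
    by rewrite opprD addrACA; apply: submD.
  move=> a [y x] /= [Byx e].
  change (B (a *: y - a *: x) /\ th (a *: y) = j (a *: x)).
  split; last by rewrite !linearZ /= e.
  by rewrite -scalerBr; apply: submZ.
- move=> [/= B0z]; rewrite linear0 => /esym; apply: jI.
  by rewrite -[z]opprK; apply: submN => //; rewrite -[- z]add0r.
- have [b1 B1 e1] := thB x; have [b2 B2 e2] := jB x.
  exists (x + (b2 - b1)); split=> /=; first by rewrite addrAC subrr add0r; apply: submB.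
  by rewrite linearD linearB e1 e2 addrC subrK.
- by rewrite /= subr0 linear0.
Qed.

End Extension.

(** * Independent families of simple submodules *)

Section Families.
Variables (R : nzRingType) (P : ideal R) (T : set R).
Hypothesis PT : max_data P T.
Implicit Types X Y : lmodType R^c.
Local Notation annP X := (@annP R P X).
Local Notation mulP := (@mulP R P _).
Local Notation powP := (@powP R P _).
Local Notation primary := (@primary R P).

Lemma subm_cup X (N : nat -> set X) : (forall n, subm (N n)) ->
  (forall n, N n `<=` N n.+1) -> subm [set x | exists n, N n x].
Proof.
move=> sN iN; have le := chain_le iN; split; first by exists 0%N; apply: subm0.
  move=> x y [m Nx] [n Ny]; exists (maxn m n); apply: submD => //.
    by apply: le Nx; rewrite leq_maxl.
  by apply: le Ny; rewrite leq_maxr.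
by move=> a x [n Nx]; exists n; apply: submZ.
Qed.

Definition cycT X (x : X) : set X := [set y | exists2 t, T t & y = x .* t].

Lemma subm_cycT X (x : X) : subm (cycT x).
Proof.
have sT := md_rideal PT.
apply: submI => [|_ _ [s Ts ->] [t Tt ->]|_ r [s Ts ->]].
- by exists 0; [apply: (subm0 sT)|rewrite ract0].
- by exists (s + t); [apply: (submD sT)|rewrite ractDr].
- by exists (s * r); [apply: (subm_ract r sT)|rewrite ractA].
Qed.

Fixpoint spanT X (x : nat -> X) (n : nat) : set X :=
  if n is k.+1 then subadd (spanT x k) (cycT (x k)) else [set 0].

Definition spanTw X (x : nat -> X) : set X := [set u | exists n, spanT x n u].

Lemma subm_spanT X (x : nat -> X) n : subm (spanT x n).
Proof. by elim: n => //= n IH; apply: subm_add => //; apply: subm_cycT. Qed.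

Lemma spanTS X (x : nat -> X) n : spanT x n `<=` spanT x n.+1.
Proof. by apply: subadd_l; apply: subm_cycT. Qed.

Lemma subm_spanTw X (x : nat -> X) : subm (spanTw x).
Proof. by apply: subm_cup => n; [apply: subm_spanT|apply: spanTS]. Qed.

Lemma spanT_mem X (x : nat -> X) k n t : (k < n)%N -> T t ->
  spanT x n (x k .* t).
Proof.
move=> kn Tt; have h := chain_le (@spanTS _ x) kn; apply: h.
by apply: subadd_r; [apply: subm_spanT|exists t].
Qed.

Lemma spanTw_mem X (x : nat -> X) k t : T t -> spanTw x (x k .* t).
Proof. by move=> Tt; exists k.+1; apply: spanT_mem. Qed.

Lemma spanT_min X (x : nat -> X) n (A : set X) : subm A ->
  (forall k t, (k < n)%N -> T t -> A (x k .* t)) -> spanT x n `<=` A.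
Proof.
move=> sA; elim: n => [|n IH] h; first by move=> _ ->; apply: subm0.
apply: subadd_min => //; first by apply: IH => k t kn; apply: h; apply: ltnW.
by move=> _ [t Tt ->]; apply: h.
Qed.

Lemma spanTw_min X (x : nat -> X) (A : set X) : subm A ->
  (forall k t, T t -> A (x k .* t)) -> spanTw x `<=` A.
Proof. by move=> sA h u [n]; apply: spanT_min => // k t _; apply: h. Qed.

Definition socle_family X (x : nat -> X) : Prop :=
  forall k p, (P : set R) p -> x k .* p = 0.

(** The sum of the simple modules x_k T is direct. *)
Definition indep X (x : nat -> X) : Prop :=
  forall k t, T t -> spanT x k (x k .* t) -> (P : set R) t.

Lemma spanTw_socle X (x : nat -> X) : socle_family x -> spanTw x `<=` annP X 1.
Proof.
move=> x0; apply: spanTw_min => [|k t Tt p Pp]; first exact: subm_annP.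
by rewrite ractA x0//; apply: Defs.idealMl.
Qed.

Lemma indep_neq0 X (x : nat -> X) k t : indep x -> T t ->
  ~ (P : set R) t -> x k .* t <> 0.
Proof.
move=> ix Tt nPt x0; apply/nPt/(ix k) => //.
by rewrite x0; apply: (subm0 (subm_spanT x k)).
Qed.

(** The homomorphism from the span of an independent family x to the span of a
    family y that sends x_k t to y_k t, as a linear relation. *)
Definition fam_rel X Y (x : nat -> X) (y : nat -> Y) : set (X * Y)%type :=
  @spanTw (X * Y)%type (fun k => (x k, y k)).

Lemma subm_fam_rel X Y (x : nat -> X) (y : nat -> Y) : subm (fam_rel x y).
Proof. exact: subm_spanTw. Qed.

Lemma fam_rel_mem X Y (x : nat -> X) (y : nat -> Y) k t : T t ->
  fam_rel x y (x k .* t, y k .* t).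
Proof. exact: (@spanTw_mem (X * Y)%type (fun k => (x k, y k))). Qed.

Lemma fam_rel_dom X Y (x : nat -> X) (y : nat -> Y) u z :
  fam_rel x y (u, z) -> spanTw x u.
Proof.
have h : fam_rel x y `<=` [set u | spanTw x u.1].
  apply: (@spanTw_min (X * Y)%type) => [|k t]; last exact: spanTw_mem.
  exact: (@subm_fst R^c X Y _ (subm_spanTw x)).
exact: (h (u, z)).
Qed.

Lemma fam_rel_cod X Y (x : nat -> X) (y : nat -> Y) u z :
  fam_rel x y (u, z) -> spanTw y z.
Proof.
have h : fam_rel x y `<=` [set u | spanTw y u.2].
  apply: (@spanTw_min (X * Y)%type) => [|k t]; last exact: spanTw_mem.
  exact: (@subm_snd R^c X Y _ (subm_spanTw y)).
exact: (h (u, z)).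
Qed.

Lemma fam_rel_functional X Y (x : nat -> X) (y : nat -> Y) :
  indep x -> socle_family x -> socle_family y -> functional (fam_rel x y).
Proof.
move=> ix x0 y0 z [n]; elim: n z => [z [->]//|n IH] z.
move=> [[u w] [_ [uw [t Tt ->] E]]].
have e : 0 = u + x n .* t := congr1 fst E.
have -> : z = w + y n .* t := congr1 snd E.
have spanu : spanT x n u.
  suff h : @spanT (X * Y)%type (fun k => (x k, y k)) n `<=` [set u | spanT x n u.1].
    exact: (h (u, w)).
  apply: spanT_min => [|k s kn Ts]; last exact: spanT_mem.
  exact: (@subm_fst R^c X Y _ (subm_spanT x n)).
have Pt : (P : set R) t.
  apply: (ix n) => //; rewrite (_ : x n .* t = - u).
    exact: submN (subm_spanT x n) spanu.
  by apply/eqP; rewrite -addr_eq0 addrC -e.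
rewrite y0// addr0; apply: IH; move: e; rewrite x0// addr0 => ->; exact: uw.
Qed.

(** ** Divisible and homogeneous submodules *)

Lemma divisible_of_socle X (D : set X) : subm D ->
  (forall x, D x -> exists n, annP X n x) ->
  (forall n, D `&` annP X 1 `<=` powP D n) -> D `<=` mulP D.
Proof.
move=> sD pD h d Dd; have [n dn] := pD d Dd.
have := height_step PT sD sD (@subset_refl _ D) (h n.+1) (leqnSn n).
by rewrite subSnn; apply; split=> //; apply: annPS.
Qed.

Lemma homogeneous_div X (D : set X) n : subm D ->
  D `&` annP X 1 `<=` powP D n -> D `&` annP X n `<=` mulP D.
Proof.
case: n => [|n] sD h; first by move=> _ [_ ->]; exact: (subm0 (@subm_mulP R P X D)).
have := height_step PT sD sD (@subset_refl _ D) h (leqnSn n).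
by rewrite subSnn.
Qed.

Lemma divisible_powP X (D : set X) n : subm D -> D `<=` mulP D ->
  D `<=` powP D n.
Proof.
move=> sD DD; elim: n => // n IH; apply: subset_trans DD _; exact: mulPS.
Qed.

Lemma socle_onto X (A D : set X) : subm A -> subm D -> A `<=` D ->
  (forall x, D x -> exists n, annP X n x) ->
  (forall n, D `&` annP X 1 `<=` powP A n) -> D `<=` A.
Proof.
move=> sA sD AD pD h d Dd; have [n dn] := pD d Dd.
have := height_step PT sA sD AD (h n) (leqnn n).
by rewrite subnn; apply; split=> //; apply: annPS.
Qed.

(** Divisible modules are injective in the category of P-primary modules. *)
Lemma extend_divisible X Y (D : set Y) (F0 : set (X * Y)%type) :
  primary X -> subm D -> D `<=` mulP D -> subm F0 -> functional F0 ->
  (forall x d, F0 (x, d) -> D d) ->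
  exists f : {linear X -> Y},
    (forall x, D (f x)) /\ (forall x d, F0 (x, d) -> f x = d).
Proof.
move=> pX sD DD sF fF F0D; apply: (extend_hom PT) => //.
by move=> F _ _ _ FD x d /FD /DD.
Qed.

(** A homogeneous D of exponent n + 1 is injective over R/P^(n+1): a homomorphism
    killing XP^(n+1) sends XP to elements killed by P^n. *)
Lemma extend_homogeneous X Y (D : set Y) (F0 : set (X * Y)%type) n :
  primary X -> subm D -> D `&` annP Y n `<=` mulP D -> subm F0 ->
  functional F0 -> (forall x d, F0 (x, d) -> D d) ->
  (forall w, powP setT n.+1 w -> F0 (w, 0)) ->
  exists f : {linear X -> Y},
    (forall x, D (f x)) /\ (forall x d, F0 (x, d) -> f x = d).
Proof.
move=> pX sD DD sF0 fF0 F0D F00; apply: (extend_hom PT) => //.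
move=> F sF fF F0F FD x d Fxd Px; apply: DD; split; first exact: FD Fxd.
suff h k : (k <= n.+1)%N -> forall x d, F (x, d) -> powP setT (n.+1 - k) x ->
    annP Y k d.
  by apply: (h n (leqnSn n) x) => //; rewrite subSnn.
elim: k => [_|k IH kn] y e Fye hy.
  by apply: functionalP sF fF Fye _; apply/F0F/F00; rewrite subn0 in hy.
move=> p Pp; apply: (IH (ltnW kn) (y .* p)); first exact: rel_ract.
by rewrite -subnSK//; apply: mulP_mem.
Qed.

(** ** Obstructions to being Bassian *)

(** A divisible submodule B has a noninjective surjective endomorphism: by
    extension it is enough to find one from a submodule onto the socle, and
    this is done by moving a simple summand N of the socle one layer up. *)
Lemma bassian_reduced X (B : set X) : bassian X -> primary X -> subm B ->
  B `<=` mulP B -> B `<=` [set 0].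
Proof.
move=> bX pX sB BB; apply: (@socle_eq0 _ P) => // x1 [Bv v1]; apply: contrapT => v0.
have sA1 : subm (annP X 1) by apply: subm_annP.
have [a ha] := simple_handle PT (@subm_set0 _ X) v0 v1.
pose x0 := x1 .* a; have Bx0 : B x0 by apply: subm_ract.
have x0P p : (P : set R) p -> x0 .* p = 0.
  by move=> Pp; rewrite ractA; apply: v1; apply: Defs.idealMl.
pose N := cycT x0; have sN : subm N by apply: subm_cycT.
have NB : N `<=` B by move=> _ [t _ ->]; apply: subm_ract.
have N1 : N `<=` annP X 1 by move=> _ [t _ ->]; do 2 apply: annP_ract.
have [t0 Tt0 nPt0] := md_proper PT.
pose W := [set y | B y /\ forall p, (P : set R) p -> N (y .* p)].
(* B being divisible, N = WP; in particular P does not kill W. *)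
have [w [Bw wN] nw1] : exists2 w, W w & ~ annP X 1 w.
  apply: contrapT => h; apply: nPt0; apply: ha => //.
  have W0 : mulP W `<=` annP X 0.
    by apply: mulP_annP => w Ww; apply: contrapT => ?; apply: h; exists w.
  by apply: W0; apply: (mulP_lift PT sB sN (subset_trans NB BB)); exists t0.
have [c hc] := simple_handle PT sA1 nw1 (fun p Pp => N1 _ (wN p Pp)).
pose x2 := w .* c.
have Bx2 : B x2 by apply: subm_ract.
have x2P p : (P : set R) p -> N (x2 .* p).
  by move=> Pp; rewrite ractA; apply: wN; apply: Defs.idealMl.
have [|||||Z [sZ _ ZB ZN BZN]] := @complement _ _ _ PT X [set 0] N (B `&` annP X 1)
  (@subm_set0 _ _).
- by [].
- exact: subm_setI.
- by move=> _ ->; apply: subm0.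
- by move=> x Nx; split; [apply: NB|apply: N1].
- by move=> y p [_ y1] Pp; apply: y1.
(* The socle of B is Z + N; the map kills N and sends x2 T onto N. *)
pose F0 : set (X * X)%type := [set u | exists v n t,
  [/\ Z v, N n, T t & u = (v + n + x2 .* t, v + x0 .* t)]].
have sT := md_rideal PT.
have sF0 : subm F0.
  apply: submI => [|_ _ [v [n [t [Zv Nn Tt ->]]]] [v' [n' [t' [Zv' Nn' Tt' ->]]]]|
      _ r [v [n [t [Zv Nn Tt ->]]]]].
  - exists 0, 0, 0; rewrite !ract0 !addr0.
    by split=> //; [apply: subm0|apply: subm0|apply: (subm0 sT)].
  - exists (v + v'), (n + n'), (t + t').
    split; [exact: submD|exact: submD|exact: (submD sT)|].
    by congr (_, _) => /=; rewrite ractDr addrACA // [v + n + _]addrACA.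
  - exists (v .* r), (n .* r), (t * r).
    split; [exact: subm_ract|exact: subm_ract|exact: (subm_ract r sT)|].
    by rewrite -!ractA -!ractD.
have fF0 : functional F0.
  move=> z [v [n [t [Zv Nn Tt [e ->]]]]].
  have x2t : x2 .* t = - (v + n) by apply/eqP; rewrite -addr_eq0 addrC -e.
  have Pt : (P : set R) t.
    apply: hc => //; rewrite -/x2 x2t; apply: (submN sA1); apply: (submD sA1).
      by have [] := ZB _ Zv.
    exact: N1.
  have -> : v = 0.
    apply: ZN; split=> //; have -> : v = - (n + x2 .* t).
      by apply/eqP; rewrite -addr_eq0 addrA -e.
    exact: submN sN (submD sN Nn (x2P _ Pt)).
  by rewrite x0P// addr0.
have F0B x d : F0 (x, d) -> B d.
  move=> [v [n [t [Zv Nn Tt [_ ->]]]]]; apply: submD => //.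
    by have [] := ZB _ Zv.
  exact: subm_ract.
have [th [thB thE]] := extend_divisible pX sB BB sF0 fF0 F0B.
pose F1 : set (X * X)%type := [set u | B u.1 /\ u.2 = u.1].
have sF1 : subm F1.
  apply: submI => [|[x y] [x' y'] [/= Bx /= ->] [/= Bx' /= ->]|[x y] r [/= Bx /= ->]].
  - by split=> //; apply: subm0.
  - by split=> //; apply: submD.
  - by split=> //; apply: subm_ract.
have [j [jB jE]] : exists j : {linear X -> X},
    (forall x, B (j x)) /\ (forall x d, F1 (x, d) -> j x = d).
  apply: extend_divisible => // [z [_ /= ->]//|x d [/= Bx /= ->]//].
have jb b : B b -> j b = b by move=> Bb; apply: jE.
have BA : B `<=` th @` B.
  apply: socle_onto => //.
  - exact: subm_image.
  - by move=> _ [y _ <-].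
  - move=> n y /BZN[v [_ [Zv [t Tt ->] ->]]].
    have <- : th (v + 0 + x2 .* t) = v + x0 .* t.
      by apply: thE; exists v, 0, t; split=> //; apply: subm0.
    apply: powP_linear; apply: divisible_powP => //.
    rewrite addr0; apply: submD => //; last exact: subm_ract.
    by have [] := ZB _ Zv.
have x0t0 : x0 .* t0 = 0.
  apply: (bassian_two_maps bX sB (th := th) (j := j)) => [x|x|b Bb||].
  - by have [b Bb <-] := BA _ (thB x); exists b.
  - by have [b Bb <-] := BA _ (jB x); exists b.
  - by rewrite jb.
  - exact: subm_ract.
  - apply: thE; exists 0, (x0 .* t0), 0; rewrite !ract0 !addr0 add0r.
    by split=> //; [apply: subm0|exists t0|apply: (subm0 sT)].
by apply: nPt0; apply: ha.
Qed.

(** Infinitely many independent simple submodules of the same finite height n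
    form the socle of a homogeneous summand B; the shift of the family extends
    to a noninjective surjective endomorphism of B. *)
Lemma bassian_homogeneous X (x : nat -> X) n : bassian X -> primary X ->
  socle_family x -> indep x -> (forall k t, T t -> powP setT n (x k .* t)) ->
  spanTw x `&` powP setT n.+1 `<=` [set 0] -> False.
Proof.
move=> bX pX x0 ix xh Un.
have sU := subm_spanTw x.
have U1 := spanTw_socle x0.
have [||B [sB BU UB Bn]] := homogeneous_hull PT (n := n) sU.
- by apply: spanTw_min xh; apply: subm_powP.
- by [].
have {}UsB : spanTw x `<=` B.
  by apply: subset_trans UB _; apply: (@powP_le _ _ _ _ 0%N).
have hB : B `&` annP X n `<=` mulP B.
  by apply: homogeneous_div => //; apply: subset_trans BU UB.
have ext (y : nat -> X) : (forall k t, T t -> B (y k .* t)) -> socle_family y ->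
    exists f : {linear X -> X},
      (forall x, B (f x)) /\ (forall k t, T t -> f (x k .* t) = y k .* t).
  move=> yB y0.
  pose F0 := subadd (fam_rel x y) [set u : (X * X)%type | powP setT n.+1 u.1 /\ u.2 = 0].
  have sW : subm [set u : (X * X)%type | powP setT n.+1 u.1 /\ u.2 = 0].
    have sP := @subm_powP R P X setT n.+1 (@subm_setT _ _).
    apply: submI => [|[u v] [u' v'] [/= Pu /= ->] [/= Pu' /= ->]|
      [u v] r [/= Pu /= ->]].
    - by split=> //; apply: subm0.
    - by split; [exact: (submD sP Pu Pu')|rewrite /= addr0].
    - by split; [exact: (subm_ract r sP Pu)|exact: ract0l].
  have sR := subm_fam_rel x y.
  have [|||w Ww|f [fB fE]] := @extend_homogeneous X X B F0 n pX sB hB.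
  - exact: subm_add.
  - move=> z [[u v] [[w _] [uv [/= Ww ->] [e ->]]]]; rewrite addr0.
    have u0 : u = 0.
      apply: Un; split; first exact: fam_rel_dom uv.
      have -> : u = - w by apply/eqP; rewrite -addr_eq0 -e.
      exact: submN (@subm_powP R P X setT n.+1 (@subm_setT _ _)) Ww.
    by apply: (fam_rel_functional ix x0 y0); rewrite -u0.
  - move=> u z [[u' v] [[w _] [uv [/= Ww ->] [_ ->]]]]; rewrite addr0.
    by apply: (spanTw_min sB yB); apply: fam_rel_cod uv.
  - by apply: subadd_r.
  exists f; split=> // k t Tt; apply: fE; apply: subadd_l => //.
  exact: fam_rel_mem.
have xB k t : T t -> B (x k .* t) by move=> Tt; apply/UsB/spanTw_mem.
(* The shift x_(k+1) t |-> x_k t kills x_0 T. *)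
pose y k := if k is i.+1 then x i else 0.
have [||th [thB thE]] := ext y.
- by case=> [|k] t Tt /=; [rewrite ract0l; apply: subm0|apply: xB].
- by case=> [|k] p Pp /=; [rewrite ract0l|apply: x0].
have [j [jB jE]] := ext x xB x0.
have UA : spanTw x `<=` powP (th @` B) n.
  apply: spanTw_min => [|k t Tt]; first exact/subm_powP/subm_image.
  rewrite -[x k]/(y k.+1) -thE//; apply: powP_linear; apply: UB.
  exact: spanTw_mem.
have BA : B `<=` th @` B.
  have := height_step PT (subm_image th sB) sB _ (subset_trans BU UA) (leqnn n).
  rewrite subnn => h b Bb; apply: h; last by split=> //; apply: Bn.
  by move=> _ [z _ <-].
have [t0 Tt0 nPt0] := md_proper PT.
apply: (indep_neq0 (k := 0%N) ix Tt0 nPt0).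
apply: (bassian_two_maps bX sB (th := th) (j := j)) => [u|u|||].
- by have [b Bb <-] := BA _ (thB u); exists b.
- by have [b Bb <-] := BA _ (jB u); exists b.
- apply: (@inj_on_socle _ P) => // b Bb b1 jb.
  have jU : spanTw x `<=` [set u | j u = u].
    apply: spanTw_min => [|k t Tt]; last exact: jE.
    apply: submI => [|u v /= eu /= ev|u r /= eu] /=.
    - exact: linear0.
    - by rewrite linearD [X in X + _]eu [X in _ + X]ev.
    - by rewrite linear_ract eu.
  by rewrite -jb jU//; apply: BU; split.
- exact: xB.
- by rewrite thE// /y ract0l.
Qed.

End Families.

(** * Bassian primary modules are Noetherian *)

Section PrimaryBassian.
Variables (R : nzRingType) (P : ideal R) (T : set R).
Hypothesis PT : max_data P T.
Implicit Types X Y : lmodType R^c.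
Local Notation annP X := (@annP R P X).
Local Notation mulP := (@mulP R P _).
Local Notation powP := (@powP R P _).
Local Notation primary := (@primary R P).
Local Notation cycT := (@cycT R T _).
Local Notation spanT := (@spanT R T _).
Local Notation spanTw := (@spanTw R T _).
Local Notation fam_rel := (@fam_rel R T _ _).
Local Notation indep := (@indep R P T _).
Local Notation socle_family := (@socle_family R P _).

Fixpoint sum_upto X (B : nat -> set X) (n : nat) : set X :=
  if n is k.+1 then subadd (sum_upto B k) (B k) else [set 0].

(** The hulls of the members are independent since their socles are, and so no new
    element appears in the socle of their sum. *)
Lemma hull_of_family X (x : nat -> X) (h : nat -> nat) : primary X ->
  socle_family x -> indep x -> (forall k t, T t -> powP setT (h k) (x k .* t)) ->
  exists B, [/\ subm B, B `&` annP X 1 `<=` spanTw x, spanTw x `<=` B &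
    forall k t, T t -> powP B (h k) (x k .* t)].
Proof.
move=> pX x0 ix xh.
have ex k : {B : set X | [/\ subm B, B `&` annP X 1 `<=` cycT (x k),
    cycT (x k) `<=` powP B (h k) & B `<=` annP X (h k).+1]}.
  apply/cid/(homogeneous_hull PT); first exact: (subm_cycT PT).
    by move=> _ [t Tt ->]; apply: xh.
  move=> _ [t Tt ->]; apply: (spanTw_socle x0); exact: (spanTw_mem PT).
pose B k := sval (ex k).
have [sB B1 BU] : [/\ forall k, subm (B k),
    forall k, B k `&` annP X 1 `<=` cycT (x k) &
    forall k, cycT (x k) `<=` powP (B k) (h k)].
  by split=> k; have [] := svalP (ex k).
have sS n : subm (sum_upto B n).
  by elim: n => //= n IH; apply: subm_add.
have iS n : sum_upto B n `<=` sum_upto B n.+1 by apply: subadd_l.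
have S1 n : sum_upto B n `&` annP X 1 `<=` spanT x n.
  elim: n => [x' []//|n IH].
  apply: subset_trans (@socle_add _ P _ _ _ (sS n) (sB n) _ _) _.
  - by move=> y _; apply: pX.
  - move=> y [[Sy By] y1]; have [t Tt yE] := B1 n _ (conj By y1).
    have Pt : (P : set R) t by apply: (ix n) => //; rewrite -yE; apply: IH.
    by rewrite yE x0.
  - move=> _ [a [b [/IH xa [Bb b1] ->]]]; exists a, b; split=> //.
    by apply: B1.
have sC := subm_cup sS iS.
have BC k : B k `<=` [set y | exists n, sum_upto B n y].
  by move=> b Bb; exists k.+1; apply: subadd_r.
exists [set y | exists n, sum_upto B n y]; split=> //.
- by move=> y [[n Sy] y1]; exists n; apply: S1.
- apply: spanTw_min => // k t Tt; apply: (BC k).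
  by apply: (@powP_le R P X (B k) 0%N (h k)) => //; apply: (BU k); exists t.
- by move=> k t Tt; apply: (@powPS R P _ _ _ (h k) (BC k)); apply: (BU k); exists t.
Qed.

(** Infinitely many independent simple submodules of unbounded heights: let B be
    a hull of their sum U. Identifying x_k with x_(c k), where c has infinite
    fibres, has a kernel K such that all of U has infinite height modulo K.
    For N maximal in B with N & U = K the module B/N is then divisible with
    socle U/K, which is isomorphic to U, so that B embeds in B/N. *)
Lemma bassian_heights X (x : nat -> X) (h : nat -> nat) : bassian X ->
  primary X -> socle_family x -> indep x -> (forall k, (k <= h k)%N) ->
  (forall k t, T t -> powP setT (h k) (x k .* t)) -> False.
Proof.
move=> bX pX x0 ix hk xh.
have [B [sB BU UB Bh]] := hull_of_family pX x0 ix xh.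
(* c is the 2-adic valuation, which has infinite fibres, and s a section of it. *)
pose c k := logn 2 k; pose s a := (2 ^ a)%N.
have cs a : c (s a) = a by apply: pfactorK.
have fibre k n : exists2 k', (n <= k')%N & c k' = c k.
  exists (s (c k) * n.*2.+1)%N.
    apply: leq_trans (leq_pmull _ _); last by rewrite expn_gt0.
    by rewrite leqW// -addnn leq_addr.
  rewrite /c lognM ?expn_gt0// pfactorK//.
  by rewrite (@logn_coprime 2 n.*2.+1) ?addn0// coprime2n /= odd_double.
pose rho := fam_rel x (fun k => x (c k)).
have srho : subm rho := subm_fam_rel PT _ _.
have frho : functional rho by apply: (fam_rel_functional PT) => // k; apply: x0.
pose K : set X := [set u | rho (u, 0)].
have sK : subm K.
  apply: submI => [|u v Ku Kv|u r Ku]; first exact: (rel0 srho).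
    by rewrite /K /= -(addr0 0); apply: (relD srho).
  by rewrite /K /= -(ract0l X r); apply: rel_ract.
have KU : K `<=` spanTw x by move=> u; apply: (fam_rel_dom PT).
have Kc k k' t : T t -> c k = c k' -> K (x k .* t - x k' .* t).
  move=> Tt e; rewrite /K /= -(subrr (x (c k) .* t)).
  apply: (relB srho); first exact: (fam_rel_mem PT x (fun k => x (c k)) k Tt).
  by rewrite e; apply: (fam_rel_mem PT x (fun k => x (c k)) k' Tt).
have [|N [sN KN NC Nmax]] :=
  @max_subm _ _ K [set v | B v /\ (spanTw x v -> K v)] sK.
  by move=> v Kv; split=> //; apply/UB/KU.
have NB : N `<=` B by move=> v /NC[].
have NK v : N v -> spanTw x v -> K v by move=> /NC[_].
pose NN := closed_of_set sN.
pose pi : {linear X -> quotmod NN} := quotmod_pi NN.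
have pi0 v : pi v = 0 <-> N v by apply: quotmod_pi_closedE.
pose D := pi @` B.
have sD : subm D by apply: subm_image.
have sU : subm (spanTw x) := subm_spanTw PT x.
(* By maximality of N, the socle of B/N comes from U. *)
have socD b : B b -> annP (quotmod NN) 1 (pi b) -> exists2 u, spanTw x u & pi b = pi u.
  move=> Bb b1.
  pose C := [set y | B y /\ forall p, (P : set R) p -> N (y .* p)].
  have sC : subm C.
    apply: submI => [|y z [By yN] [Bz zN]|y r [By yN]].
    - by split; [apply: subm0|move=> p _; rewrite ract0l; apply: subm0].
    - split; first exact: submD.
      by move=> p Pp; rewrite ractD; apply: submD => //; [apply: yN|apply: zN].
    - split; first exact: subm_ract.
      by move=> p Pp; rewrite ractA; apply: yN; apply: Defs.idealMl.
  have [||||Z [sZ NZ ZC ZU CZU]] :=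
      @complement _ _ _ PT X N (subadd N (spanTw x)) C sN _ sC.
  - exact: subm_add.
  - exact: subadd_l.
  - apply: subadd_min => // y hy; split.
    + exact: NB.
    + by move=> p _; apply: subm_ract.
    + exact: UB.
    + by move=> p Pp; rewrite (spanTw_socle x0 hy Pp); apply: subm0.
  - by move=> y p [_]; apply.
  have ZN : Z `<=` N.
    apply: Nmax => // z Zz; split; first by have [] := ZC _ Zz.
    move=> Uz; apply: NK => //; apply: ZU; split=> //.
    exact: subadd_r.
  have [|z [_ [/ZN Nz [n [u [Nn Uu ->]]] ->]]] := CZU b.
    split=> // p Pp; apply/pi0; rewrite linear_ract; exact: b1.
  exists u => //; rewrite !linearD.
  by rewrite (proj2 (pi0 z) Nz) (proj2 (pi0 n) Nn) !add0r.
(* Modulo K, x_k can be replaced by x_k' with k' arbitrarily large. *)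
have Uheight j u : spanTw x u -> powP D j (pi u).
  suff : spanTw x `<=` pi @^-1` (powP D j) by apply.
  apply: spanTw_min => [|k t Tt]; first exact/subm_preimage/subm_powP.
  have [k' jk' ck'] := fibre k j.
  rewrite /preimage /= (_ : pi _ = pi (x k' .* t)).
    apply: powP_linear; apply: powP_le (Bh k' t Tt) => //.
    exact: leq_trans (hk k').
  apply/eqP; rewrite -subr_eq0 -linearB; apply/eqP/pi0/KN/Kc => //.
have DD : D `<=` mulP D.
  apply: (divisible_of_socle PT) => // [_ [b _ <-]|j _ [[b Bb <-] b1]].
    by have [n hn] := pX b; exists n; apply: annP_linear.
  by have [u Uu ->] := socD b Bb b1; apply: Uheight.
pose F0 : set (X * quotmod NN)%type := [set u | B u.1 /\ u.2 = pi u.1].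
have sF0 : subm F0.
  apply: submI => [|[v d] [v' d'] [/= Bv /= ->] [/= Bv' /= ->]|[v d] r [/= Bv /= ->]].
  - by split; [apply: subm0|rewrite /= linear0].
  - by split; [exact: submD Bv Bv'|exact: (esym (linearD pi v v'))].
  - by split; [exact: (subm_ract r sB Bv)|exact: (esym (linear_ract pi v r))].
have [th [thD thE]] : exists f : {linear X -> quotmod NN},
    (forall v, D (f v)) /\ (forall v d, F0 (v, d) -> f v = d).
  apply: (extend_divisible PT) => //.
    by move=> z [_ /= ->]; rewrite linear0.
  by move=> v d [/= Bv ->]; exists v.
have thb b : B b -> th b = pi b by move=> Bb; apply: thE.
(* x_a t |-> x_(s a) t is inverse to x_k t |-> x_(c k) t modulo K, so it embeds
   U into B/N. *)
pose y a := pi (x (s a)).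
have [j [jD jE]] : exists f : {linear X -> quotmod NN},
    (forall v, D (f v)) /\ (forall v d, fam_rel x y (v, d) -> f v = d).
  apply: (extend_divisible PT) => //; first exact: (subm_fam_rel PT).
    apply: (fam_rel_functional PT) => // k p Pp.
    by rewrite -linear_ract x0// linear0.
  move=> v d /(fam_rel_cod PT); apply: spanTw_min => // k t Tt.
  rewrite -linear_ract; exists (x (s k) .* t) => //; apply: UB.
  exact: (spanTw_mem PT).
have jU w : spanTw x w -> exists2 u', spanTw x u' & j w = pi u' /\ rho (u', w).
  suff : spanTw x `<=` [set u | exists2 u', spanTw x u' & j u = pi u' /\ rho (u', u)].
    by apply.
  apply: spanTw_min => [|k t Tt].
    apply: submI => [|u v [u' Uu [ju ru]] [v' Uv [jv rv]]|u r [u' Uu [ju ru]]].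
    - exists 0; first exact: subm0.
      by rewrite !linear0; split=> //; apply: rel0.
    - exists (u' + v'); first exact: submD.
      by rewrite !linearD ju jv; split=> //; apply: (relD srho).
    - exists (u' .* r); first exact: subm_ract.
      by rewrite !linear_ract ju; split=> //; apply: rel_ract.
  exists (x (s k) .* t); first exact: (spanTw_mem PT).
  split; first by rewrite (linear_ract pi); apply: jE; apply: (fam_rel_mem PT).
  by have := fam_rel_mem PT x (fun k => x (c k)) (s k) Tt; rewrite /= cs.
have [t0 Tt0 nPt0] := md_proper PT.
(* c 1 = c 3 = 0. *)
have [UT1 UT3] : spanTw x (x 1%N .* t0) /\ spanTw x (x 3%N .* t0).
  by split; apply: (spanTw_mem PT).
apply: nPt0; apply: (ix 3%N) => //.
rewrite (_ : x 3%N .* t0 = x 1%N .* t0); first exact: (spanT_mem PT).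
apply/esym/eqP; rewrite -subr_eq0; apply/eqP.
apply: (bassian_two_maps bX sB (th := th) (j := j)) => [v|v|||].
- by have [b Bb <-] := thD v; exists b => //; apply: thb.
- by have [b Bb <-] := jD v; exists b => //; apply: thb.
- apply: (@inj_on_socle _ P) => // b Bb b1 jb.
  have [u' Uu' [ju' ru']] := jU b (BU _ (conj Bb b1)).
  have Ku' : K u' by apply: NK => //; apply/pi0; rewrite -ju'.
  exact: functionalP srho frho ru' Ku'.
- by apply: UB; apply: submB.
- rewrite thb; last by apply: UB; apply: submB.
  by apply/pi0/KN/Kc.
Qed.

Hypothesis nR : noeth (setT : set R^c^o).

Lemma noeth_cycT X (x : X) : noeth (cycT x).
Proof.
have f_lin : linear (fun r : R^c^o => x .* r).
  by move=> a u v; rewrite /ract scalerDl -scalerA.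
pose f : {linear R^c^o -> X} :=
  HB.pack (fun r : R^c^o => x .* r) (GRing.isLinear.Build _ _ _ _ _ f_lin).
apply: (@noethS _ _ _ (f @` setT)); last exact: noeth_image.
by move=> _ [t _ ->]; exists t.
Qed.

Lemma noeth_spanT X (x : nat -> X) n : noeth (spanT x n).
Proof.
elim: n => [|n IH].
  by move=> N sN iN NA; exists 0%N => k _ y /NA ->; apply: subm0.
apply: noeth_add => //; [exact: (subm_spanT PT)|exact: (subm_cycT PT)|].
exact: noeth_cycT.
Qed.

(** No finitely generated submodule exhausts W, so each can be enlarged by a simple
    submodule that it does not contain. *)
Lemma indep_family X (W : set X) : subm W -> W `<=` annP X 1 -> ~ noeth W ->
  exists x : nat -> X, [/\ forall k, W (x k), socle_family x & indep x].
Proof.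
move=> sW W1 nW.
have next (F : set X) : {y | subm F -> noeth F -> F `<=` W ->
    W y /\ forall t, T t -> F (y .* t) -> (P : set R) t}.
  apply: cid; have [sF|nsF] := pselect (subm F); last by exists 0.
  have [nF|nnF] := pselect (noeth F); last by exists 0.
  have [v Wv nFv] : exists2 v, W v & ~ F v.
    apply: contrapT => h; apply: nW; apply: noethS nF => v Wv.
    by apply: contrapT => ?; apply: h; exists v.
  have [|a ha] := simple_handle PT sF nFv.
    by move=> p Pp; rewrite (W1 _ Wv p Pp); apply: subm0.
  by exists (v .* a) => _ _ _; split=> //; apply: subm_ract.
pose F n := iter n (fun F => subadd F (cycT (sval (next F)))) [set 0].
pose x n := sval (next (F n)).
have FE n : F n = spanT x n by elim: n => // n IH; rewrite /= -IH.
have FW n : F n `<=` W /\ W (x n).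
  have step : F n `<=` W -> W (x n).
    move=> FW; have [] := svalP (next (F n)) => //; rewrite FE.
      exact: (subm_spanT PT).
    exact: noeth_spanT.
  elim: n step => [|n IH] step.
    by have h : F 0%N `<=` W by [move=> _ ->; apply: subm0]; split=> //; apply: step.
  have [FnW Wxn] : F n `<=` W /\ W (x n).
    apply: IH => FW; have [] := svalP (next (F n)) => //; rewrite FE.
      exact: (subm_spanT PT).
    exact: noeth_spanT.
  have h : F n.+1 `<=` W.
    by apply: subadd_min => // _ [t _ ->]; apply: subm_ract.
  by split=> //; apply: step.
exists x; split=> [k|k p Pp|k t Tt].
- by have [] := FW k.
- by apply: (W1 (x k)) => //; have [] := FW k.
- rewrite -FE; have [] := svalP (next (F k)) => //; last by move=> _; apply.
  + by rewrite FE; apply: (subm_spanT PT).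
  + by rewrite FE; apply: noeth_spanT.
  + by have [] := FW k.
Qed.

(** A chain N is controlled by the chain NP and by its trace on the socle. *)
Lemma noeth_annP X n : noeth (annP X 1) -> noeth (annP X n).
Proof.
move=> n1; elim: n => [|n IH]; first by apply: noethS n1; apply: annPS.
move=> N sN iN NA.
have [k|k|k|m1 hm1] := n1 (fun k => N k `&` annP X 1).
- by apply: subm_setI => //; apply: subm_annP.
- by move=> v [Nv v1]; split=> //; apply: iN.
- by move=> v [].
have [k|k|k|m2 hm2] := IH (fun k => mulP (N k)).
- exact: subm_mulP.
- exact: mulPS.
- exact: mulP_annP.
exists (maxn m1 m2) => k; rewrite geq_max => /andP[m1k m2k] v Nv.
pose m := maxn m1 m2.
have m1m : (m1 <= m)%N by apply: leq_maxl.
have m2m : (m2 <= m)%N by apply: leq_maxr.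
have sA1 : subm (annP X 1) by apply: subm_annP.
have [w [e [Nw e1 vE]]] : subadd (N m) (annP X 1) v.
  apply: (mulP_cancel PT (@subm_setT _ X)) => //.
  - exact: subm_add.
  - by move=> y [_]; apply: subadd_r.
  move=> p Pp; have h : mulP (N m2) (v .* p) by apply: (hm2 k m2k); apply: mulP_mem.
  move: h; apply: mulPS => y Ny; apply: subadd_l => //.
  exact: chain_le Ny.
have [|Ne _] := hm1 (maxn k m) (leq_trans m1m (leq_maxr _ _)) e.
  split=> //; have -> : e = v - w by rewrite vE addrAC subrr add0r.
  apply: submB => //; [apply: chain_le Nv => //|apply: chain_le Nw => //].
    exact: leq_maxl.
  exact: leq_maxr.
by rewrite vE; apply: submD => //; apply: chain_le Ne.
Qed.

(** The socle is filtered by heights. If the filtration is not stationary,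
    there are independent simple submodules of unbounded heights; if it becomes
    stationary at m, then XP^m is divisible, hence 0, and a layer that is not
    Noetherian provides infinitely many simple submodules of equal height. *)
Theorem bassian_primary_noeth X : bassian X -> primary X ->
  noeth (setT : set X).
Proof.
move=> bX pX.
pose V n := powP (setT : set X) n `&` annP X 1.
have sP n : subm (powP (setT : set X) n) by apply: subm_powP.
have s1 : subm (annP X 1) by apply: subm_annP.
have sV n : subm (V n) by apply: subm_setI.
have Vle m n : (m <= n)%N -> V n `<=` V m.
  by move=> mn v [Pv v1]; split=> //; apply: powP_le Pv.
have [unst|st] := pselect (forall m, exists2 n, (m <= n)%N & ~ V n `<=` V n.+1).
  exfalso.
  have next m : {nx : nat * X | [/\ (m <= nx.1)%N, V nx.1 nx.2 &
      forall t, T t -> V nx.1.+1 (nx.2 .* t) -> (P : set R) t]}.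
    apply: cid; have [n mn nV] := unst m.
    have [v Vv nVv] : exists2 v, V n v & ~ V n.+1 v.
      apply: contrapT => h; apply: nV => v Vv.
      by apply: contrapT => ?; apply: h; exists v.
    have [|a ha] := simple_handle PT (sV n.+1) nVv.
      by move=> p Pp; have [_ /(_ p Pp) ->] := Vv; apply: subm0.
    by exists (n, v .* a); split=> //; apply: subm_ract.
  pose mm := fix mm k := if k is i.+1 then (sval (next (mm i))).1.+1 else 0%N.
  pose h k := (sval (next (mm k))).1.
  pose x k := (sval (next (mm k))).2.
  have mh k : (mm k <= h k)%N by have [] := svalP (next (mm k)).
  have Vx k : V (h k) (x k) by have [] := svalP (next (mm k)).
  have Px k t : T t -> V (h k).+1 (x k .* t) -> (P : set R) t.
    by have [_ _] := svalP (next (mm k)); apply.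
  have x0 : socle_family x by move=> k p Pp; have [_] := Vx k; apply.
  have Vxt k t : V (h k) (x k .* t) by apply: subm_ract.
  (* The sum of the first k members has no element of the height of the next. *)
  have avoid k : spanT x k `&` V (mm k) `<=` [set 0].
    elim: k => [v []//|k IH] _ [[u [_ [xu [t Tt ->] ->]]] Vut].
    have u0 : u = 0.
      apply: IH; split=> //; rewrite -(addrK (x k .* t) u).
      apply: submB => //; first by apply: Vle Vut; apply: leqW.
      exact: Vle (Vxt k t).
    rewrite u0 add0r in Vut *; rewrite x0//; exact: Px Vut.
  have ix : indep x.
    move=> k t Tt xt; apply: (Px k) => //.
    have -> : x k .* t = 0 by apply: (avoid k); split=> //; apply: Vle (Vxt k t).
    exact: subm0.
  apply: (bassian_heights bX pX x0 ix (h := h)) => [k|k t _].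
    by apply: leq_trans (mh k); elim: k => // k IH; rewrite ltnS (leq_trans IH).
  by have [] := Vxt k t.
have [m mst] : exists m, forall n, (m <= n)%N -> V n `<=` V n.+1.
  apply: contrapT => h; apply: st => m; apply: contrapT => h'; apply: h.
  by exists m => n mn; apply: contrapT => nV; apply: h'; exists n.
have mV k : V m `<=` V (k + m)%N.
  by elim: k => // k IH v /IH; apply: mst; apply: leq_addl.
have Pm0 : powP (setT : set X) m `<=` [set 0].
  apply: (bassian_reduced PT bX pX) => //.
  apply: (divisible_of_socle PT) => // k v /(mV k)[].
  by rewrite powP_add.
have annE j : (j <= m)%N -> powP (setT : set X) (m - j) `<=` annP X j.
  elim: j => [_|j IH jm]; first by rewrite subn0.
  move=> v hv p Pp; apply: IH; first exact: ltnW.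
  by rewrite -subnSK//; apply: mulP_mem.
apply: (@noethS _ _ _ (annP X m)).
  by move=> v _; apply: (annE m (leqnn m)); rewrite subnn.
apply: noeth_annP; apply: (@noethS _ _ _ (V 0%N)); first by move=> v.
suff nV j : (j <= m)%N -> noeth (V (m - j)%N) by rewrite -(subnn m); apply: nV.
elim: j => [_|j IH jm].
  rewrite subn0 => N sN iN NA; exists 0%N => k _ v /NA[/Pm0 -> _]; exact: subm0.
have {IH} := IH (ltnW jm); rewrite -subnSK//; set n := (m - j.+1)%N => nVS.
have [|||Z [sZ _ ZV ZU VZU]] := @complement _ _ _ PT X [set 0] (V n.+1) (V n)
  (@subm_set0 _ _) (sV _) (sV _).
- by move=> _ ->; apply: subm0.
- exact: Vle.
- by move=> v p [_ v1] Pp; apply: v1.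
apply: noethS VZU _; apply: noeth_add => //.
apply: contrapT => nZ.
have [|x [Zx x0 ix]] := indep_family sZ _ nZ; first by move=> v /ZV[].
have UZ : spanTw x `<=` Z by apply: spanTw_min => // k t _; apply: subm_ract.
apply: (bassian_homogeneous PT (n := n) bX pX x0 ix).
- by move=> k t _; have [] := ZV _ (subm_ract t sZ (Zx k)).
- move=> v [Uv hv]; apply: ZU; split; first exact: UZ.
  by split=> //; have [] := ZV _ (UZ _ Uv).
Qed.

End PrimaryBassian.

(** * Singular modules and their primary components *)

Section SingularModules.
Variables (R : nzRingType) (Q : unitRingType) (iota : {rmorphism R -> Q}).
Hypothesis iotaI : injective iota.
Hypothesis dR : dedekind_prime iota.
Hypothesis npR : ~ right_primitive R.
Implicit Types M X : lmodType R^c.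

Lemma dedekind_prime_ring : prime_ring R.
Proof. by have [[_ _ _ _ ]] := dR. Qed.
Lemma dedekind_noeth : noeth (setT : set R^c^o).
Proof. by have [[_ _ h _ _] _] := dR; apply/noetherian_setT. Qed.
Lemma dedekind_noeth_left : noeth (setT : set R^o).
Proof. by have [[_ _ _ h _] _] := dR; apply/noetherian_setT. Qed.
Lemma dedekind_hereditary : right_hereditary R.
Proof. by have [[]] := dR. Qed.
Lemma dedekind_invertible (I : ideal R) : nonzero_set I -> invertible iota I.
Proof.
by have [_ h] := dR; move=> [x Ix x0]; apply: h; exists x => //; apply/eqP.
Qed.
Local Notation pR := dedekind_prime_ring.
Local Notation nR := dedekind_noeth.

(** The singular submodule, in the elementwise form of essentiality. *)
Definition tor M : set M := [set x | ess [set r | x .* r = 0]].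

Lemma Sing_tor M (x : M) : @Sing R^c M x <-> tor x.
Proof.
rewrite /Sing /tor /= essential_ess.
have -> // : [set r | r \in annihilator x] = [set r : R | x .* r = 0].
by apply/seteqP; split=> r /=; rewrite /annihilator inE => /eqP.
Qed.

Lemma singular_tor M : singular M -> forall x : M, tor x.
Proof. by move=> sM x; apply/Sing_tor; rewrite (sM : @Sing R^c M = setT). Qed.

Lemma rideal_ann M (x : M) : rideal [set r | x .* r = 0].
Proof.
apply: submI => [|r s /= hr hs|r s /= hr] /=; first exact: ract0.
  by rewrite ractDr hr hs addr0.
by rewrite ract_ring -ractA hr ract0l.
Qed.

Lemma tor_ideal M (x : M) : tor x ->
  exists2 I : ideal R, nonzero_set I & forall i, (I : set R) i -> x .* i = 0.
Proof.
move=> tx; have [I nzI Ix] := ess_contains_ideal pR nR dedekind_noeth_left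
  dedekind_hereditary npR (rideal_ann x) tx.
by exists I.
Qed.

Lemma ideal_tor M (x : M) (I : ideal R) : nonzero_set I ->
  (forall i, (I : set R) i -> x .* i = 0) -> tor x.
Proof. by move=> [i Ii i0] xI; apply: essS xI _; apply: ideal_ess pR Ii i0. Qed.

(** Extensions of singular modules are singular: for k <> 0 choose kr in I, then s
    and j with x(krsj) = 0 and krsj <> 0. *)
Lemma tor_ext M (x : M) (I : ideal R) : nonzero_set I ->
  (forall i, (I : set R) i -> tor (x .* i)) -> tor x.
Proof.
move=> [i Ii i0] xI k k0; have [r [kr0 Ikr]] := ideal_ess pR Ii i0 k0.
have [J [j Jj j0] xJ] := tor_ideal (xI _ Ikr).
have [s krsj] : exists s, k * r * s * j <> 0.
  apply: contrapT => h; have [//|//] : k * r = 0 \/ j = 0.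
  by apply: prime_elt pR _ => s; apply: contrapT => ?; apply: h; exists s.
exists (r * (s * j)); rewrite !mulrA; split=> //=.
by rewrite -(mulrA _ s) -ractA; apply: xJ; apply: Defs.idealMl.
Qed.

(** ** Ideals and a maximal ideal P *)

(** Nakayama for an invertible ideal: I = IP would give R = P. *)
Lemma ideal_mul_right (I P : ideal R) : nonzero_set I -> ~ (P : set R) 1 ->
  ~ ((I : set R) `<=` @mulP R P R^c^o I).
Proof.
move=> nzI P1 h.
have [n [i [l [r [Ii m e]]]]] := invertible_left iotaI (dedekind_invertible nzI).
apply: P1; rewrite -e; apply: (subm_sum _ (subm_ideal P)) => s.
have [[lD lM] _ _ _] := m s.
have h' : @mulP R P R^c^o I `<=` [set x | (I : set R) x /\ (P : set R) (l s x)].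
  apply: mulP_min => [|a p Ia Pp].
    apply: submI => [|x y [Ix Px] [Iy Py]|x t [Ix Px]].
    - split; first exact: Defs.ideal0.
      by have := lM 0 0 (Defs.ideal0 I); rewrite !mulr0 => ->; apply: Defs.ideal0.
    - split; first exact: Defs.idealD.
      by rewrite /= [l s _]lD//; apply: Defs.idealD.
    - rewrite ract_ring; split; first exact: Defs.idealMr.
      by rewrite lM//; apply: Defs.idealMr.
  rewrite ract_ring; split; first exact: Defs.idealMr.
  by rewrite lM//; apply: Defs.idealMl.
by have [] := h' _ (h _ (Ii s)).
Qed.

(** Colon ideals stand for I P^-1 and P^-1 I. *)
Definition colon_right (P : ideal R) (A : set R) : set R :=
  [set r | forall p, (P : set R) p -> A (r * p)].
Definition colon_left (P : ideal R) (A : set R) : set R :=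
  [set r | forall p, (P : set R) p -> A (p * r)].

Definition ideal_colon_right (P I : ideal R) : ideal R.
Proof.
apply: (@Ideal R (colon_right P I)) => [p _|x y hx hy p Pp|r x hx p Pp|r x hx p Pp].
- by rewrite mul0r; apply: Defs.ideal0.
- by rewrite mulrDl; apply: Defs.idealD; [apply: hx|apply: hy].
- by rewrite -mulrA; apply: Defs.idealMl; apply: hx.
- by rewrite -mulrA; apply: hx; apply: Defs.idealMl.
Defined.

Definition ideal_colon_left (P I : ideal R) : ideal R.
Proof.
apply: (@Ideal R (colon_left P I)) => [p _|x y hx hy p Pp|r x hx p Pp|r x hx p Pp].
- by rewrite mulr0; apply: Defs.ideal0.
- by rewrite mulrDr; apply: Defs.idealD; [apply: hx|apply: hy].
- by rewrite mulrA; apply: hx; apply: Defs.idealMr.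
- by rewrite mulrA; apply: Defs.idealMr; apply: hx.
Defined.

(** Otherwise I P^-1 = I, that is, I = IP. *)
Lemma colon_right_bigger (P I : ideal R) : max_ideal P -> nonzero_set I ->
  I `<=` P -> ~ (ideal_colon_right P I `<=` I).
Proof.
move=> [nzP P1 _] nzI IP h; apply: (ideal_mul_right nzI P1) => i Ii.
have [n [p [l [r [Pp m e]]]]] := invertible_left iotaI (dedekind_invertible nzP).
rewrite -[i](@mulr1 R) -e mulr_sumr.
apply: (subm_sum _ (@subm_mulP R P R^c^o I)) => t.
have [_ _ _ lr] := m t; rewrite -lr//; last exact: IP.
apply: (@mulP_mem R P R^c^o) => //; apply: h => q Pq.
by rewrite lr//; [apply: Defs.idealMr|apply: IP].
Qed.

Lemma colon_left_bigger (P I : ideal R) : max_ideal P -> nonzero_set I ->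
  I `<=` P -> ~ (ideal_colon_left P I `<=` I).
Proof.
move=> [nzP P1 _] nzI IP h; apply: P1.
have [n [p [l [r [Pp m e]]]]] := invertible_right iotaI (dedekind_invertible nzP).
have [k [i [l' [r' [Ii m' <-]]]]] := invertible_right iotaI (dedekind_invertible nzI).
apply: (subm_sum _ (subm_ideal P)) => s.
have Il t : (I : set R) (l t (i s)).
  apply: h => q Pq; have [_ _ _ lr] := m t.
  by rewrite -lr//; [apply: Defs.idealMl|apply: IP].
have -> : i s = \sum_t p t * l t (i s).
  rewrite -{1}[i s](@mul1r R) -e mulr_suml; apply: eq_bigr => t _.
  by have [_ _ _ ->//] := m t; apply: IP.
have [_ rD rM _] := m' s.
have r0 : r' s 0 = 0 by have := rM 0 0 (Defs.ideal0 I); rewrite !mul0r.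
suff [] : (I : set R) (\sum_t p t * l t (i s)) /\
    (P : set R) (r' s (\sum_t p t * l t (i s))) by [].
elim: (index_enum _) => [|t ts [IHI IHP]].
  by rewrite big_nil r0; split; apply: Defs.ideal0.
have Ipl : (I : set R) (p t * l t (i s)) by apply: Defs.idealMl.
rewrite big_cons; split; first exact: Defs.idealD.
rewrite rD// rM//; apply: Defs.idealD => //.
exact: Defs.idealMr.
Qed.

(** Splitting off the P-primary part of an ideal on one side: as long as I is
    contained in P it can be replaced by the larger ideal I P^-1, and this
    stops since R is Noetherian. *)
Lemma colon_right_exhaust (P I : ideal R) : max_ideal P -> nonzero_set I ->
  exists n, exists2 J : ideal R, ~ J `<=` P & J `<=` iter n (colon_right P) I.
Proof.
move=> maxP nzI; apply: contrapT => nI.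
pose F (B : set R) := exists I : ideal R, [/\ (I : set R) = B, nonzero_set B &
  ~ exists n, exists2 J : ideal R, ~ J `<=` P & J `<=` iter n (colon_right P) B].
have [||_ [I' [<- nzI' nI']] Imax] := rideal_max (F := F) nR.
- by exists I, I.
- by move=> _ [I' [<- _ _]]; apply: subm_ideal.
have IP : I' `<=` P by apply: contrapT => nIP; apply: nI'; exists 0%N, I'.
have sub : I' `<=` ideal_colon_right P I' by move=> i Ii p _; apply: Defs.idealMr.
apply: (colon_right_bigger maxP nzI' IP); apply: (Imax _ _ sub).
exists (ideal_colon_right P I'); split=> //.
  by case: nzI' => x Ix x0; exists x => //; apply: sub.
move=> [n [J nJP JI]]; apply: nI'; exists n.+1, J => //.
by rewrite iterSr.
Qed.

Lemma colon_left_exhaust (P I : ideal R) : max_ideal P -> nonzero_set I ->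
  exists n, exists2 J : ideal R, ~ J `<=` P & J `<=` iter n (colon_left P) I.
Proof.
move=> maxP nzI; apply: contrapT => nI.
pose F (B : set R) := exists I : ideal R, [/\ (I : set R) = B, nonzero_set B &
  ~ exists n, exists2 J : ideal R, ~ J `<=` P & J `<=` iter n (colon_left P) B].
have [||_ [I' [<- nzI' nI']] Imax] := rideal_max (F := F) nR.
- by exists I, I.
- by move=> _ [I' [<- _ _]]; apply: subm_ideal.
have IP : I' `<=` P by apply: contrapT => nIP; apply: nI'; exists 0%N, I'.
have sub : I' `<=` ideal_colon_left P I' by move=> i Ii p _; apply: Defs.idealMl.
apply: (colon_left_bigger maxP nzI' IP); apply: (Imax _ _ sub).
exists (ideal_colon_left P I'); split=> //.
  by case: nzI' => x Ix x0; exists x => //; apply: sub.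
move=> [n [J nJP JI]]; apply: nI'; exists n.+1, J => //.
by rewrite iterSr.
Qed.

Lemma colon_right_annP (P : ideal R) M (x : M) (A : set R) n r :
  (forall i, A i -> x .* i = 0) -> iter n (colon_right P) A r ->
  annP P n (x .* r).
Proof.
move=> xA; elim: n r => [r /xA//|n IH] r hr p Pp.
by rewrite ractA; apply: IH; apply: hr.
Qed.

Lemma colon_left_pow (P I : ideal R) n a r : ideal_pow P n a ->
  iter n (colon_left P) I r -> (I : set R) (a * r).
Proof.
elim: n I a r => [|n IH] I a r; first by move=> _; apply: Defs.idealMl.
move=> [k [b [c [Pb Pc ->]]]]; rewrite iterSr => hr.
rewrite mulr_suml; apply: (subm_sum _ (subm_ideal I)) => i.
rewrite -mulrA; exact: (IH (ideal_colon_left P I) (c i) r (Pc i) hr _ (Pb i)).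
Qed.

Lemma annP_pow (P : ideal R) M (x : M) n :
  annP P n x <-> forall r, ideal_pow P n r -> x .* r = 0.
Proof.
elim: n x => [|n IH] x.
  split=> [-> r _|h].
    by rewrite ract0l.
  by rewrite -[x]ract1; apply: h.
split=> [hx r [k [a [b [Pa Pb ->]]]]|h p Pp].
  rewrite ract_sumr; apply: big1 => i _; rewrite -ractA.
  exact: ((IH _).1 (hx _ (Pa i)) _ (Pb i)).
apply/IH => r Pr; rewrite ractA; apply: h.
by exists 1%N, (fun=> p), (fun=> r); split=> //; rewrite big_ord1.
Qed.

Lemma comaximal (P J : ideal R) : max_ideal P -> ~ J `<=` P ->
  exists p j, [/\ (P : set R) p, (J : set R) j & 1 = p + j].
Proof.
move=> [_ P1 Pmax] nJP.
have @S : ideal R.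
  apply: (@Ideal R [set x | exists p j, [/\ (P : set R) p, (J : set R) j & x = p + j]]).
  - by exists 0, 0; rewrite addr0; split=> //; apply: Defs.ideal0.
  - move=> _ _ [p [j [Pp Jj ->]]] [q [k [Pq Jk ->]]]; exists (p + q), (j + k).
    by rewrite addrACA; split=> //; apply: Defs.idealD.
  - move=> r _ [p [j [Pp Jj ->]]]; exists (r * p), (r * j).
    by rewrite mulrDr; split=> //; apply: Defs.idealMl.
  - move=> r _ [p [j [Pp Jj ->]]]; exists (p * r), (j * r).
    by rewrite mulrDl; split=> //; apply: Defs.idealMr.
apply: contrapT => n1; apply: nJP => j Jj; apply: (Pmax S) => //.
  by move=> p Pp; exists p, 0; rewrite addr0; split=> //; apply: Defs.ideal0.
by exists 0, j; rewrite add0r; split=> //; apply: Defs.ideal0.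
Qed.

Lemma comaximal_pow (P J : ideal R) n : max_ideal P -> ~ J `<=` P ->
  exists a j, [/\ ideal_pow P n a, (J : set R) j & 1 = a + j].
Proof.
move=> maxP nJP; elim: n => [|n [a [j [Pa Jj e]]]].
  by exists 1, 0; rewrite addr0; split=> //; apply: Defs.ideal0.
have [p [k [Pp Jk e']]] := comaximal maxP nJP.
exists (p * a), (p * j + k); split.
- by exists 1%N, (fun=> p), (fun=> a); split=> //; rewrite big_ord1.
- by apply: Defs.idealD => //; apply: Defs.idealMl.
- by rewrite addrA -mulrDr -e mulr1.
Qed.

Lemma primary_disjoint (P J : ideal R) M (x : M) n : max_ideal P ->
  ~ J `<=` P -> annP P n x -> (forall j, (J : set R) j -> x .* j = 0) -> x = 0.
Proof.
move=> maxP nJP /annP_pow xP xJ.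
have [a [j [Pa Jj e]]] := comaximal_pow n maxP nJP.
by rewrite -[x]ract1 e ractDr xP// xJ// addr0.
Qed.

(** If xI = 0, J1 P^n1 <= I and P^n2 J2 <= I, write 1 = a + b with a in J1 and b in
    P^n2. *)
Lemma primary_decomposition (P : ideal R) M (x : M) : max_ideal P -> tor x ->
  exists a b, [/\ 1 = a + b, exists n, annP P n (x .* a) &
    exists2 J : ideal R, ~ J `<=` P &
      forall j, (J : set R) j -> x .* b .* j = 0].
Proof.
move=> maxP /tor_ideal[I nzI xI].
have [n1 [J1 nJ1 h1]] := colon_right_exhaust maxP nzI.
have [n2 [J2 nJ2 h2]] := colon_left_exhaust maxP nzI.
have [b [a [Pb Ja e]]] := comaximal_pow n2 maxP nJ1.
exists a, b; split; first by rewrite addrC.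
  by exists n1; apply: colon_right_annP xI _; apply: h1.
exists J2 => // j Jj; rewrite ractA; apply: xI.
by apply: colon_left_pow Pb _; apply: h2.
Qed.

Definition component (P : ideal R) M : set M := [set x | exists n, annP P n x].
Definition cocomponent (P : ideal R) M : set M :=
  [set x | exists2 J : ideal R, ~ J `<=` P & forall j, (J : set R) j -> x .* j = 0].

Arguments component : clear implicits.
Arguments cocomponent : clear implicits.

Lemma subm_component (P : ideal R) M : subm (component P M).
Proof. by apply: subm_cup => n; [apply: subm_annP|apply: annPS]. Qed.

Lemma subm_cocomponent (P : ideal R) M : max_ideal P -> subm (cocomponent P M).
Proof.
move=> maxP; have [_ P1 _] := maxP.
apply: submI => [|x y [J nJ xJ] [K nK yK]|x r [J nJ xJ]].
- exists (principal_ideal 1); first by move=> /(_ 1 (@principal_ideal_mem R 1)).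
  by move=> j _; rewrite ract0l.
- have [p [j [Pp Jj ej]]] := comaximal maxP nJ.
  have [q [k [Pq Kk ek]]] := comaximal maxP nK.
  have sub (L : ideal R) : (L : set R) (j * k) -> principal_ideal (j * k) `<=` L.
    by move=> Ljk z; apply.
  exists (principal_ideal (j * k)).
    move=> /(_ _ (@principal_ideal_mem R _)) Pjk; apply: P1.
    rewrite -[1](@mulr1 R) {1}ej ek mulrDl; apply: Defs.idealD; first exact: Defs.idealMr.
    by rewrite mulrDr; apply: Defs.idealD => //; apply: Defs.idealMl.
  move=> z hz; rewrite ractD xJ ?yK ?addr0//.
    by apply: sub hz; apply: Defs.idealMl.
  by apply: sub hz; apply: Defs.idealMr.
- by exists J => // j Jj; rewrite ractA xJ//; apply: Defs.idealMl.
Qed.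

Lemma component_tor (P : ideal R) M (x : M) : max_ideal P -> component P M x -> tor x.
Proof.
move=> [nzP _ _] [n]; elim: n x => [x ->|n IH x hx].
  by apply: (ideal_tor nzP) => i _; rewrite ract0l.
by apply: (tor_ext nzP) => p Pp; apply: IH; apply: hx.
Qed.

Lemma primary_componentE (P : ideal R) M :
  [set x | x \in primary_component P M] = component P M.
Proof.
apply/seteqP; split=> x /=.
  by move=> /asboolP[n _ h]; exists n; apply/annP_pow => r; apply: h.
move=> [n hx]; apply/asboolP; exists n.+1 => // r.
by move: r; apply/annP_pow; apply: annPS.
Qed.

(** A singular module is the direct sum of its P-primary component and its
    cocomponent; the Bassian property passes to the direct summand. *)
Lemma bassian_component (P : ideal R) M : max_ideal P -> (forall x : M, tor x) ->
  bassian M -> noeth (component P M).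
Proof.
move=> maxP tM /bassianP bM.
rewrite -primary_componentE -noetherian_submod noetherian_setT.
have inC (x : M) : x \in primary_component P M <-> component P M x.
  by rewrite -primary_componentE.
have [T PT] := max_data_exists iotaI dR maxP.
apply: (bassian_primary_noeth PT nR); last first.
  move=> x; pose v : {linear submod (primary_component P M) -> M} := val.
  have /inC[n hn] := valP x.
  by exists n; apply: (annP_inj (f := v)) => //; apply: val_inj.
apply/bassianP => G sG fG oG u Gu0.
have sC := subm_cocomponent M maxP.
have sA := subm_component P M.
pose G' : set (M * M)%type := [set w | exists u v c,
  [/\ G (u, v), cocomponent P M c & w = (val u + c, val v + c)]].
apply: val_inj; apply: (bM G') => [|z [u' [v [c [Guv Cc [e ->]]]]]|z|].
- apply: submI => [|_ _ [u1 [v1 [c1 [G1 C1 ->]]]] [u2 [v2 [c2 [G2 C2 ->]]]]|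
      _ r [u1 [v1 [c1 [G1 C1 ->]]]]].
  + exists 0, 0, 0; rewrite !addr0; split=> //; [exact: rel0|exact: subm0].
  + exists (u1 + u2), (v1 + v2), (c1 + c2); split.
    * exact: relD.
    * exact: submD.
    * by congr (_, _); rewrite /= addrACA.
  + exists (u1 .* r), (v1 .* r), (c1 .* r); split.
    * exact: rel_ract.
    * exact: subm_ract.
    * by congr (_, _); rewrite /= -ractD.
- have uc : val u' = - c by apply/eqP; rewrite -addr_eq0 -e.
  have u0 : u' = 0.
    apply: val_inj; have /inC[n hn] := valP u'.
    have [J nJ hJ] : cocomponent P M (val u') by rewrite uc; apply: submN.
    exact: primary_disjoint hn hJ.
  have c0 : c = 0 by rewrite -[c]opprK -uc u0 oppr0.
  by move: Guv; rewrite u0 c0 addr0 => /fG ->.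
- have [a [b [e Aa Cb]]] := primary_decomposition maxP (tM z).
  have za : z .* a \in primary_component P M by apply/inC.
  have [u' Gu'] := oG (Submod za).
  exists (val u' + z .* b), u', (Submod za), (z .* b); split=> //.
  by rewrite /= -ractDr -e ract1.
- by exists u, 0, 0; rewrite !addr0; split=> //; apply: subm0.
Qed.

(** A nonzero element of a torsion submodule K killed by an ideal that is
    maximal for this property is killed by a maximal ideal. *)
Lemma component_meets M (K : set M) : subm K -> (forall k, K k -> tor k) ->
  (forall P, max_ideal P -> K `&` component P M `<=` [set 0]) -> K `<=` [set 0].
Proof.
move=> sK tK K0 k0 Kk0; apply: contrapT => k00.
pose F (B : set R) := exists2 I : ideal R, (I : set R) = B /\ nonzero_set B &
  exists k, [/\ K k, k <> 0 & forall i, B i -> k .* i = 0].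
have [||_ [I [<- nzI] [k [Kk k1 kI]]] Imax] := rideal_max (F := F) nR.
- by have [I nzI kI] := tor_ideal (tK _ Kk0); exists I, I => //; exists k0.
- by move=> _ [I [<- _] _]; apply: subm_ideal.
have I1 : ~ (I : set R) 1 by move=> /kI; rewrite ract1.
have [P maxP IP] := max_ideal_above nR nzI I1.
have [p Pp kp] : exists2 p, (P : set R) p & k .* p <> 0.
  apply: contrapT => h; apply: k1; apply: (K0 P maxP); split=> //.
  by exists 1%N => p Pp /=; apply: contrapT => ?; apply: h; exists p.
have sub : I `<=` ideal_colon_left P I by move=> i Ii q _; apply: Defs.idealMl.
apply: (colon_left_bigger maxP nzI IP); apply: (Imax _ _ sub).
exists (ideal_colon_left P I).
  by split=> //; case: nzI => x Ix x0; exists x => //; apply: sub.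
exists (k .* p); split=> //; first exact: subm_ract.
by move=> i Ii; rewrite ractA; apply: kI; apply: Ii.
Qed.

(** ** The finiteness condition behind both parts *)

Fixpoint rel_iter M (G : set (M * M)%type) (n : nat) : set (M * M)%type :=
  if n is k.+1 then
    [set u | exists2 y, G (u.1, y) & rel_iter G k (y, u.2)]
  else [set u | u.1 = u.2].

Lemma rel_iter_subm M (G : set (M * M)%type) n : subm G -> subm (rel_iter G n).
Proof.
move=> sG; elim: n => [|n IH].
  split=> [//|u v /= e e'|a u /= e]; last by rewrite -e.
  by rewrite e e'.
split.
- by exists 0; [apply: rel0|apply: rel0].
- move=> u v [y Gy hy] [z Gz hz]; exists (y + z).
    exact: (relD sG Gy Gz).
  exact: (relD IH hy hz).
- move=> a u [y Gy hy]; exists (a *: y); first exact: (relZ a sG Gy).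
  exact: (relZ a IH hy).
Qed.

Lemma rel_iter_functional M (G : set (M * M)%type) n : functional G ->
  functional (rel_iter G n).
Proof.
move=> fG; elim: n => [z /= <-//|n IH z [y /= Gy hy]].
by apply: IH; rewrite -(fG _ Gy).
Qed.

Lemma rel_iter_onto M (G : set (M * M)%type) n :
  (forall z, exists y, G (y, z)) -> forall z, exists y, rel_iter G n (y, z).
Proof.
move=> oG; elim: n => [z|n IH z]; first by exists z.
by have [y hy] := IH z; have [x Gx] := oG y; exists x, y.
Qed.

Lemma rel_iter_kernel M (G : set (M * M)%type) n x z : rel_iter G n (x, z) ->
  G (z, 0) -> rel_iter G n.+1 (x, 0).
Proof.
elim: n x => [x /= -> Gz|n IH x [y Gy hy] Gz]; first by exists 0.
by exists y => //; apply: IH.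
Qed.

(** A module with a Noetherian submodule H such that M/H is singular, and with
    Noetherian primary components, is Bassian. Given an epimorphism g from a
    submodule of M onto M, the chain of the kernels of the g^n is stationary on
    H, which makes the kernel of g singular; on each primary component g is
    then an epimorphism and hence injective. *)
Lemma bassian_of_components M (H : set M) : subm H -> noeth H ->
  (forall x, exists2 I : ideal R, nonzero_set I &
     forall i, (I : set R) i -> H (x .* i)) ->
  (forall P, max_ideal P -> noeth (component P M)) -> bassian M.
Proof.
move=> sH nH MH nC; apply/bassianP => G sG fG oG.
have sGn n : subm (rel_iter G n) by apply: rel_iter_subm.
have fGn n : functional (rel_iter G n) by apply: rel_iter_functional.
pose K := [set y | G (y, 0)].
have sK : subm K.
  apply: submI => [|x y Kx Ky|x r Kx]; first exact: rel0.
    by rewrite /K /= -(addr0 0); apply: relD.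
  by rewrite /K /= -(ract0l M r); apply: rel_ract.
pose V n := H `&` [set x | rel_iter G n (x, 0)].
have [n|n x [Hx hx]|n x []//|m hm] := nH V.
- apply: subm_setI => //; apply: submI => [|x y hx hy|x r hx] /=.
  + exact: rel0.
  + by rewrite -(addr0 0); apply: relD.
  + by rewrite -(ract0l M r); apply: rel_ract.
- split=> //; elim: n x {Hx} hx => [x /= ->|n IH x [y Gy hy]].
    by exists 0 => //; apply: rel0.
  by exists y => //; apply: IH.
have Ktor k : K k -> tor k.
  move=> Kk; have [x hx] := rel_iter_onto m oG k.
  have [I nzI xI] := MH x; apply: (ideal_tor nzI) => i Ii.
  have [|_ h0] := hm m.+1 (leqnSn m) (x .* i).
    split; first exact: xI.
    by rewrite /= -(ract0l M i); apply: (rel_ract i (sGn m.+1) (rel_iter_kernel hx Kk)).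
  exact: (functionalP (sGn m) (fGn m) (rel_ract i (sGn m) hx) h0).
move=> y Gy; apply: (component_meets sK Ktor) => // P maxP k [Kk Ck].
have sC := subm_component P M.
apply: (noeth_rel_inj (nC P maxP) sC sG fG _ Ck Kk) => z Cz.
have [x Gx] := oG z.
have tx : tor x.
  have [I nzI zI] := tor_ideal (component_tor maxP Cz).
  apply: (tor_ext nzI) => i Ii; apply: Ktor.
  by rewrite /K /= -(zI i Ii); apply: rel_ract.
have [a [b [e Ca [J nJ xJ]]]] := primary_decomposition maxP tx.
exists (x .* a) => //; have zb : z .* b = 0.
  have [n hn] : component P M (z .* b) by apply: subm_ract.
  apply: (primary_disjoint maxP nJ hn) => j Jj; apply: fG.
  by rewrite -(xJ j Jj); exact: rel_ract j sG (rel_ract b sG Gx).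
have -> : z = z .* a by rewrite -{1}(ract1 z) e ractDr zb addr0.
exact: rel_ract.
Qed.

(** The hypotheses of the preceding lemma pass to M/N: an element whose class in
    M/N is P-primary is, up to N, one whose class in M/H is P-primary. *)
Lemma super_bassian_of_components M (H : submodClosed M) :
  noeth [set x | x \in H] ->
  (forall x : M, exists2 I : ideal R, nonzero_set I &
     forall i, (I : set R) i -> x .* i \in H) ->
  (forall P, max_ideal P ->
     noeth [set x | component P (quotmod H) (quotmod_pi H x)]) ->
  super_bassian M.
Proof.
move=> nH MH nC N; have sH := subm_closed H.
pose piH : {linear M -> quotmod H} := quotmod_pi H.
pose piN : {linear M -> quotmod N} := quotmod_pi N.
have piH0 x : piH x = 0 <-> x \in H by apply: quotmod_pi_eq0.
apply: (@bassian_of_components _ (piN @` [set x | x \in H])).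
- exact: subm_image.
- exact: noeth_image.
- move=> y; have [x <-] := quotmod_pi_surj y; have [I nzI xI] := MH x.
  exists I => // i Ii; exists (x .* i); first exact: xI.
  by rewrite linear_ract.
move=> P maxP; pose HP := [set x | component P _ (piH x)].
have sHP : subm HP by apply/subm_preimage/subm_component.
apply: (@noethS _ _ _ (piN @` HP)); last by apply: noeth_image => //; apply: nC.
move=> y [n yn]; have [x xy] := quotmod_pi_surj y.
have tx : tor (piH x).
  have [I nzI xI] := MH x; apply: (ideal_tor nzI) => i Ii.
  by rewrite -linear_ract; apply/piH0/xI.
have [a [b [e Ca [J nJ xJ]]]] := primary_decomposition maxP tx.
have [c [j [Pc Jj e']]] := comaximal_pow n maxP nJ.
exists (x .* a + x .* b .* j).
  apply: submD => //.
    by rewrite -[HP _]/(component P _ (piH (x .* a))) linear_ract.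
  rewrite -[HP _]/(component P _ (piH (x .* b .* j))) !linear_ract xJ//.
  exact: subm0 (subm_component P _).
have ybc : y .* b .* c = 0 by move/annP_pow: (annP_ract b yn); apply.
have piNx : piN x = y by [].
rewrite linearD !linear_ract piNx -[in RHS](ract1 y) e ractDr; congr (_ + _).
by rewrite -[in RHS](ract1 (y .* b)) e' ractDr ybc add0r.
Qed.

Lemma super_bassian_singular M : (forall x : M, tor x) ->
  (forall P, max_ideal P -> noeth (component P M)) -> super_bassian M.
Proof.
move=> tM nC; pose O := closed_of_set (@subm_set0 _ M).
have OE x : x \in O <-> x = 0 by apply: closed_of_setP.
apply: (@super_bassian_of_components _ O).
- by move=> N sN iN NA; exists 0%N => k _ x /NA /OE ->; apply: subm0.
- move=> x; have [I nzI xI] := tor_ideal (tM x); exists I => // i Ii.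
  by apply/OE; apply: xI.
move=> P maxP; apply: noethS (nC P maxP) => x [n hn]; exists n.
pose pi0 : {linear M -> quotmod O} := quotmod_pi O.
apply: (annP_inj (f := pi0) _ hn) => u v e; apply/eqP; rewrite -subr_eq0; apply/eqP.
have h : pi0 (u - v) = 0 by rewrite linearB e subrr.
exact: (quotmod_pi_closedE (@subm_set0 _ M) _).1 h.
Qed.

(** ** Super Bassian modules have finite rank *)

(** If no M/H with H finitely generated is singular, then M contains a direct
    sum F of nonzero cyclic modules w_i R, each isomorphic to a right ideal
    k_i R. Taking G maximal with G & F = FP makes M/G singular with a primary
    component containing the infinite direct sum F/FP. *)
Lemma super_bassian_fin_gen M : super_bassian M ->
  exists g n, forall x : quotmod (closed_of_set (subm_gen (M := M) g n)), tor x.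
Proof.
move=> bM; apply: contrapT => nfg.
have next (g : nat -> M) n : {wk : M * R | [/\ wk.2 <> 0,
    forall r, wk.2 * r = 0 -> wk.1 .* r = 0 &
    forall r, gen g n (wk.1 .* r) -> wk.2 * r = 0]}.
  apply: cid; have [y ny] : exists y : quotmod (closed_of_set (subm_gen g n)), ~ tor y.
    apply: contrapT => h; apply: nfg; exists g, n => y.
    by apply: contrapT => ?; apply: h; exists y.
  have [x xy] := quotmod_pi_surj y.
  have [k /not_implyP[k0 hk]] : exists k : R,
      ~ (k <> 0 -> exists r, k * r <> 0 /\ y .* (k * r) = 0).
    exact/existsNP.
  exists (x .* k, k) => /=; split=> // r.
    by rewrite ractA => ->; rewrite ract0.
  move=> hr; apply: contrapT => kr; apply: hk; exists r; split=> //.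
  pose pi : {linear M -> quotmod (closed_of_set (subm_gen g n))} :=
    quotmod_pi (closed_of_set (subm_gen g n)).
  rewrite -xy -[quotmod_pi _ x]/(pi x) -linear_ract -ractA.
  exact/quotmod_pi_closedE.
(* w_n is chosen depending on the list st n of the preceding ones. *)
pose st n := iter n (fun s : seq M => rcons s (sval (next (nth 0 s) (size s))).1) [::].
have size_st n : size (st n) = n by elim: n => //= n IH; rewrite size_rcons IH.
pose w n := (sval (next (nth 0 (st n)) n)).1.
pose k n := (sval (next (nth 0 (st n)) n)).2.
have stS n : st n.+1 = rcons (st n) (w n) by rewrite /= size_st.
have st_nth n i : (i < n)%N -> nth 0 (st n) i = w i.
  elim: n => // n IH; rewrite ltnS leq_eqVlt stS nth_rcons size_st => /predU1P[->|lt].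
    by rewrite ltnn eqxx.
  by rewrite lt; apply: IH.
have [k0 kw wk] : [/\ forall n, k n <> 0, forall n r, k n * r = 0 -> w n .* r = 0 &
    forall n r, gen w n (w n .* r) -> k n * r = 0].
  split=> n; have [h1 h2 h3] := svalP (next (nth 0 (st n)) n) => // r hr.
  by apply: h3; apply: eq_gen hr => i lt; rewrite st_nth.
have [P maxP] := max_ideal_exists nR npR.
have [nzP P1 _] := maxP.
pose wP i := [set y | exists2 p, (P : set R) p & y = w i .* p].
have swP i : subm (wP i).
  apply: submI => [|_ _ [p Pp ->] [q Pq ->]|_ r [p Pp ->]].
  - by exists 0; [apply: Defs.ideal0|rewrite ract0].
  - by exists (p + q); [apply: Defs.idealD|rewrite ractDr].
  - by exists (p * r); [apply: Defs.idealMr|rewrite ractA].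
pose FPn := sum_upto wP.
have sFPn n : subm (FPn n) by elim: n => //= n IH; apply: subm_add.
have iFPn n : FPn n `<=` FPn n.+1 by apply: subadd_l.
have FPn_gen n : FPn n `<=` gen w n.
  elim: n => // n IH; apply: subadd_min; first exact: subm_gen.
    by move=> y /IH Gy; apply: subadd_l => //; apply: subm_cyc.
  by move=> _ [p _ ->]; apply: subm_ract; [apply: subm_gen|apply: gen_mem].
pose F := [set y | exists n, gen w n y].
pose FP := [set y | exists n, FPn n y].
have iF n : gen w n `<=` gen w n.+1 by apply: subadd_l; apply: subm_cyc.
have sF : subm F by apply: subm_cup => // n; apply: subm_gen.
have sFP : subm FP by apply: subm_cup.
have wFP i p : (P : set R) p -> FP (w i .* p).
  by move=> Pp; exists i.+1; apply: subadd_r => //; exists p.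
have FPF y p : F y -> (P : set R) p -> FP (y .* p).
  move=> [n /genP[c ->]] Pp; rewrite ract_suml; apply: subm_sum => // i.
  by rewrite -/(ract (w i) (c i)) ractA; apply: wFP; apply: Defs.idealMl.
(* The sum of the w_i R is direct, so the later summands can be left out. *)
have drop n N y : gen w n y -> FPn (N + n)%N y -> FPn n y.
  move=> Gy; elim: N => // N IH [q [_ [hq [p Pp ->] yE]]]; apply: IH.
  have le := chain_le iF (leq_addl N n).
  have w0 : w (N + n)%N .* p = 0.
    apply/kw/wk; have -> : w (N + n)%N .* p = y - q by rewrite yE addrAC subrr add0r.
    by apply: submB; [apply: subm_gen|apply: le|apply: FPn_gen].
  by rewrite yE w0 addr0.
(* w_n is not in the sum of the preceding terms and FP: that would give k_n R =
   k_n P, hence I = IP for the ideal I generated by k_n. *)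
have nw n g : gen w n g -> ~ FP (w n - g).
  move=> Gg [N hN].
  have Gwg : gen w n.+1 (w n - g).
    by apply: submB; [apply: subm_gen|apply: gen_mem|apply: iF].
  have [q [_ [hq [p Pp ->] e]]] : FPn n.+1 (w n - g).
    by apply: (drop _ N) => //; apply: chain_le hN => //; apply: leq_addr.
  have kp : k n = k n * p.
    apply/eqP; rewrite -subr_eq0 -[X in X - _]mulr1 -mulrBr; apply/eqP/wk.
    rewrite ractBr ract1; have -> : w n - w n .* p = g + q.
      by apply/eqP; rewrite subr_eq -addrA -e addrC subrK.
    by apply: submD => //; [apply: subm_gen|apply: FPn_gen].
  have nzk : nonzero_set (principal_ideal (k n)).
    by exists (k n); [apply: principal_ideal_mem|apply: k0].
  apply: (ideal_mul_right nzk P1).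
  pose MP : set R := @mulP R P R^c^o (principal_ideal (k n)).
  have sMP : rideal MP := @subm_mulP R P R^c^o _.
  have @J : ideal R.
    apply: (@Ideal R [set x | forall r, MP (r * x)]) => /=.
    - by move=> r; rewrite mulr0; apply: (subm0 sMP).
    - by move=> x y hx hy r; rewrite mulrDr; apply: (submD sMP).
    - by move=> s x hx r; rewrite mulrA; apply: hx.
    - by move=> s x hx r; rewrite mulrA; apply: (subm_ract _ sMP); apply: hx.
  move=> x /(_ J) h; rewrite -[x](@mul1r R); apply: h => r.
  rewrite kp mulrA; apply: (@mulP_mem R P R^c^o) => //.
  by apply: Defs.idealMl; apply: principal_ideal_mem.
have [|G [sG FPG GC Gmax]] := @max_subm _ _ FP [set x | F x -> FP x] sFP.
  by move=> x FPx _.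
(* If yk generates a submodule meeting G trivially, then by maximality G + ykR
   contains an element g + ykr of F outside FP; but (g + ykr)P <= FP, so that
   ykrP = 0 and kr = 0. *)
have tG (x : quotmod (closed_of_set sG)) : tor x.
  have [y <-] := quotmod_pi_surj x; move=> k1 k10; apply: contrapT => h.
  have kG r : G (y .* (k1 * r)) -> k1 * r = 0.
    move=> Gy; apply: contrapT => ?; apply: h; exists r; split=> //=.
    by rewrite -linear_ract; apply/quotmod_pi_closedE.
  pose Z := subadd G [set z | exists a : R^c, z = a *: (y .* k1)].
  have sZ : subm Z by apply: subm_add => //; apply: subm_cyc.
  apply: k10; rewrite -[k1]mulr1; apply: (kG 1); apply: (Gmax Z) => //.
  - by apply: subadd_l; apply: subm_cyc.
  - move=> _ [g [_ [Gg [r ->] ->]]] Fz.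
    rewrite -/(ract (y .* k1) r) ractA in Fz *.
    have kr0 : k1 * r = 0.
      apply: contrapT => kr; have [p Pp p0] := nzP.
      have [//|//] : k1 * r = 0 \/ p = 0.
      apply: prime_elt pR _ => s; rewrite -!mulrA; apply: kG.
      have Psp : (P : set R) (s * p) by apply: Defs.idealMl.
      have := FPG _ (FPF _ _ Fz Psp); rewrite ractD ractA -mulrA.
      by apply: submDr => //; apply: subm_ract.
    by rewrite kr0 ract0 addr0 in Fz *; apply: GC.
  - by apply: subadd_r => //; exists 1; rewrite scale1r mulr1.
pose pi : {linear M -> quotmod (closed_of_set sG)} := quotmod_pi (closed_of_set sG).
have nC := bassian_component maxP tG (bM (closed_of_set sG)).
have [n|n|n _ [y Gy <-]|m hm] := nC (fun n => pi @` gen w n).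
- by apply: subm_image; apply: subm_gen.
- by move=> _ [y Gy <-]; exists y => //; apply: iF.
- exists 1%N => p Pp /=; rewrite -linear_ract; apply/quotmod_pi_closedE/FPG.
  by apply: FPF => //; exists n.
have [|g Gg e] := hm m.+1 (leqnSn m) (pi (w m)).
  by exists (w m) => //; apply: gen_mem.
apply: (nw m g Gg); apply: GC.
  apply/(quotmod_pi_closedE sG).
  by rewrite quotmod_piB -/(pi (w m)) -/(pi g) e subrr.
by exists m.+1; apply: submB; [apply: subm_gen|apply: gen_mem|apply: iF].
Qed.

End SingularModules.

Theorem corollary1p14 (R : nzRingType) (Q : unitRingType)
    (iota : {rmorphism R -> Q}) (HQ : classical_fractions iota)
    (HR : dedekind_prime iota) (Hnp : non_primitive R) (M : lmodType R^c) :
  (singular M ->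
     (super_bassian M <->
        (forall P : ideal R, maximal_invertible iota P ->
           noetherian (submod (primary_component P M)))) /\
     ((forall P : ideal R, maximal_invertible iota P ->
         noetherian (submod (primary_component P M))) <-> bassian M)) /\
  (super_bassian M <->
     bassian M /\
     exists H : submodClosed M,
       [/\ fin_gen (submod H), singular (quotmod H) & bassian (quotmod H)]).
Proof.
have [iI _ _ _] := HQ; have [npR _] := Hnp.
have maxE P : maximal_invertible iota P <-> max_ideal P.
  by apply: max_invertibleP => // I; apply: dedekind_invertible.
split=> [sM|].
  have tM := singular_tor sM.
  have compE : (forall P : ideal R, maximal_invertible iota P ->
      noetherian (submod (primary_component P M))) <->
      (forall P, max_ideal P -> noeth (@component R P M)).
    split=> h P maxP; first by rewrite -primary_componentE -noetherian_submod;
      apply/h/maxE.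
    by rewrite noetherian_submod primary_componentE; apply/h/maxE.
  have c_b : bassian M -> forall P, max_ideal P -> noeth (@component R P M).
    by move=> bM P maxP; apply: (bassian_component iI HR npR).
  have b_a : (forall P, max_ideal P -> noeth (@component R P M)) -> super_bassian M.
    exact: (super_bassian_singular iI HR npR).
  rewrite compE; split; split=> [h|h].
  - by apply: c_b; apply: super_bassian_bassian.
  - exact: b_a.
  - by apply: super_bassian_bassian; apply: b_a.
  - exact: c_b.
split=> [sM|[_ [H [[n [g gH]] sMH bMH]]]].
  split; first exact: super_bassian_bassian.
  have [g [n tH]] := super_bassian_fin_gen iI HR npR sM.
  pose sG := subm_gen (M := M) g n.
  exists (closed_of_set sG); split; last exact: sM.
    have gG (i : 'I_n) : g i \in closed_of_set sG.
      by apply/closed_of_setP/gen_mem.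
    exists n, (fun i => Submod (gG i)) => x.
    pose v : {linear submod (closed_of_set sG) -> M} := val.
    have /closed_of_setP/genP[c xE] := valP x.
    exists (fun i => c i); apply: val_inj.
    rewrite -[RHS]/(v _) linear_sum [LHS]xE; apply: eq_bigr => i _.
    by rewrite linearZ.
  by apply/seteqP; split=> // x _; apply/Sing_tor.
have tMH := singular_tor sMH.
pose pi : {linear M -> quotmod H} := quotmod_pi H.
have piH x : pi x = 0 <-> x \in H by apply: quotmod_pi_eq0.
have nH : noeth [set x | x \in H].
  pose v : {linear submod H -> M} := val.
  pose h (i : nat) : M := if insub i is Some j then v (g j) else 0.
  apply: (@noethS _ _ _ (gen h n)); last exact/noeth_gen/(dedekind_noeth HR).
  move=> x Hx; have [c xE] := gH (Submod Hx).
  apply/genP; exists (fun i => if insub i is Some j then c j else 0).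
  rewrite -[x]/(v (Submod Hx)) xE linear_sum; apply: eq_bigr => i _.
  by rewrite linearZ /h valK.
apply: (super_bassian_of_components iI HR npR (H := H)) => // [x|P maxP].
  have [I nzI xI] := tor_ideal HR npR (tMH (pi x)).
  by exists I => // i Ii; apply/piH; rewrite linear_ract xI.
have nC := bassian_component iI HR npR maxP tMH bMH.
apply: (noeth_ext (f := pi)).
- exact/(subm_preimage pi)/subm_component.
- by apply: noethS nH => x [_ /= /piH].
- by apply: noethS nC => _ [x Cx <-].
Qed.
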